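(* Let $\underline{E}=E_0[0]\oplus\ldots\oplus E_{n-1}[n-1]$ be a graded vector bundle over a smooth manifold $M$, and let $A\to M$ be a Lie algebroid. If there exists an $n$-representation $\mathcal D$ of $A$ on $\underline{E}$, then the $A$-Pontryagin characters $\sigma_A^l(E_i)$, $l>1$, of the vector bundles $E_i$, $i=0,\ldots,n-1$, satisfy $$\sum_{i=0}^{n-1}(-1)^i\sigma^l_A(E_i)=0\in H^{2l}(A)$$ for all $l>1$.
   Context: For a Lie algebroid $(A\to M,\rho,[\cdot,\cdot])$, $\Omega^\bullet(A)=\Gamma(\wedge^\bullet A^* )$, $\mathbf d_A$ is the Lie algebroid differential, and $H^\bullet(A)$ is the cohomology of $(\Omega^\bullet(A),\mathbf d_A)$. For a vector bundle $E\to M$, $\Omega^\bullet(A,E)=\Gamma(\wedge^\bullet A^*\otimes E)$. $A$-Pontryagin characters: choose any linear $A$-connection $\nabla\colon\Gamma(A)\times\Gamma(E)\to\Gamma(E)$, with curvature $R_\nabla\in\Omega^2(A,\operatorname{End}(E))$, $R_\nabla(a,b)=\nabla_a\nabla_b-\nabla_b\nabla_a-\nabla_{[a,b]}$. Let $R_\nabla^l\in\Omega^{2l}(A,\operatorname{End}(E))$ be its $l$-th power (wedge product combined with composition). The form $\operatorname{tr}(R_\nabla^l)\in\Omega^{2l}(A)$ is $\mathbf d_A$-closed and its class $\sigma_A^l(E):=[\operatorname{tr}(R_\nabla^l)]\in H^{2l}(A)$ does not depend on $\nabla$; it is the $l$-th $A$-Pontryagin character of $E$ ($l\ge1$). For a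 graded vector bundle $\underline{E}=E_0[0]\oplus\ldots\oplus E_{n-1}[n-1]$ (with $E_z$ placed in degree $z$), $\Omega(A,\underline{E})_\bullet$ denotes $\Gamma(\wedge^\bullet A^*\otimes\underline{E})$ with the total grading in which $\Omega^s(A,E_z)$ has degree $s+z$. An $n$-representation of $A$ on $\underline{E}$ is an $\mathbb R$-linear operator $\mathcal D\colon\Omega(A,\underline{E})_\bullet\to\Omega(A,\underline{E})_{\bullet+1}$ of total degree $1$ such that $\mathcal D^2=0$ and $\mathcal D(\omega\wedge\eta)=\mathbf d_A\omega\wedge\eta+(-1)^{l}\omega\wedge\mathcal D\eta$ for $\omega\in\Omega^l(A)$ and $\eta\in\Omega(A,\underline{E})_\bullet$. *)

(* Defs.v *)
From HB Require Import structures.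
From mathcomp Require Import all_boot all_order all_algebra.
From mathcomp Require Import all_classical all_reals all_analysis.
Import Order.TTheory GRing.Theory Num.Theory numFieldNormedType.Exports.
Set Implicit Arguments. Unset Strict Implicit. Unset Printing Implicit Defensive.
Local Open Scope classical_set_scope.
Local Open Scope ring_scope.

(* [Ck U k f]: [f] is of class C^k on the open set [U]. *)
Fixpoint Ck (R : realType) (V W : normedModType R) (U : set V) (k : nat)
    (f : V -> W) : Prop :=
  if k is k'.+1 then
    (forall x, U x -> differentiable f x) /\
    forall v, Ck U k' (fun x => 'D_v f x)
  else forall x, U x -> {for x, continuous f}.

Definition smooth_on (R : realType) (V W : normedModType R) (U : set V)
  (f : V -> W) : Prop := forall k, Ck U k f.

Section Calculus.
Variables (R : realType) (V : normedModType R).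

Lemma near_eq_differentiable (W : normedModType R) (f g : V -> W) (x : V) :
  (\near x, f x = g x) -> differentiable f x -> differentiable g x.
Proof.
move=> fg df; pose h := g - f.
have -> : g = f + h by rewrite /h addrC subrK.
apply: differentiableD => //.
have h0 : h x = 0 by rewrite /h /= -[_ x]/(g x - f x) (nbhs_singleton fg) subrr.
pose z : {linear V -> W} := \0.
have zc : continuous (z : V -> W) by move=> y; exact: cst_continuous.
have hz : h \o shift x = cst (h x) + z +o_ (0 : V) id.
  apply/eqaddoP => e e0.
  move: fg; rewrite (near_shift 0 x) subr0; apply: filterS => y /= fg.
  have -> : (h \o shift x - (cst (h x) + z)) y = 0.
    rewrite -[LHS]/((g (y + x) - f (y + x)) - (h x + z y)) fg subrr h0 /z /=.
    by rewrite addr0 subrr.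
  by rewrite normr0 mulr_ge0 // ltW.
by apply/diff_locallyP; rewrite (diff_unique zc hz).
Qed.

Variable U : set V.
Hypothesis oU : open U.

Lemma near_open (P : V -> Prop) (x : V) :
  (forall y, U y -> P y) -> U x -> \near x, P x.
Proof. by move=> HP Ux; apply: filterS (open_nbhs_nbhs (conj oU Ux)). Qed.

Lemma Ck_ext (W : normedModType R) k (f g : V -> W) :
  (forall x, U x -> f x = g x) -> Ck U k f -> Ck U k g.
Proof.
elim: k f g => [|k IH] f g fg /=.
  move=> cf x Ux; rewrite /prop_for /continuous_at -(fg _ Ux).
  have := cf x Ux; rewrite /prop_for /continuous_at; apply: cvg_trans.
  by apply: near_eq_cvg; exact: near_open.
move=> [df Df]; split=> [x Ux|v].
  by apply: near_eq_differentiable (df x Ux); exact: near_open.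
by apply: IH (Df v) => x Ux; apply: near_eq_derive; exact: near_open.
Qed.

Lemma CkW (W : normedModType R) k (f : V -> W) : Ck U k.+1 f -> Ck U k f.
Proof.
elim: k f => [|k IH] f [df Df].
  by move=> x Ux; apply: differentiable_continuous; exact: df.
by split=> // v; exact: IH (Df v).
Qed.

Lemma Ck_cst (W : normedModType R) k (c : W) : Ck U k (fun=> c).
Proof.
elim: k c => [|k IH] c /=; first by move=> x _; exact: cst_continuous.
split=> [x _|v]; first exact: differentiable_cst.
by apply: Ck_ext (IH 0) => x _; rewrite derive_cst.
Qed.

Lemma CkD (W : normedModType R) k (f g : V -> W) :
  Ck U k f -> Ck U k g -> Ck U k (fun x => f x + g x).
Proof.
elim: k f g => [|k IH] f g /=.
  by move=> cf cg x Ux; apply: continuousD; [exact: cf|exact: cg].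
move=> [df Df] [dg Dg]; split=> [x Ux|v].
  by apply: differentiableD; [exact: df|exact: dg].
apply: Ck_ext (IH _ _ (Df v) (Dg v)) => x Ux.
by rewrite deriveD //; apply: diff_derivable; [exact: df|exact: dg].
Qed.

Lemma CkM k (f g : V -> R) :
  Ck U k f -> Ck U k g -> Ck U k (fun x => f x * g x).
Proof.
elim: k f g => [|k IH] f g.
  by move=> cf cg x Ux; apply: continuousM; [exact: cf|exact: cg].
move=> Cf Cg; have [df Df] := Cf; have [dg Dg] := Cg; split=> [x Ux|v].
  by apply: differentiableM; [exact: df|exact: dg].
have := CkD (IH _ _ (CkW Cf) (Dg v)) (IH _ _ (CkW Cg) (Df v)).
apply: Ck_ext => x Ux.
by rewrite deriveM //; apply: diff_derivable; [exact: df|exact: dg].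
Qed.

End Calculus.

(* A smooth manifold given by an atlas. The maps [mphi i] and [mpsi i] are
   total and only meaningful on the chart domain, resp. on its image. *)
Record manifold (R : realType) := Manifold {
  mpoint :> topologicalType;
  mdim : nat;
  mhausdorff : hausdorff_space mpoint;
  msecond_countable : @second_countable mpoint;
  mchart : Type;
  mdom : mchart -> set mpoint;
  mphi : mchart -> mpoint -> 'rV[R]_mdim;
  mpsi : mchart -> 'rV[R]_mdim -> mpoint;
  mdom_open : forall i, open (mdom i);
  mdom_cover : forall x, exists i, mdom i x;
  mimage_open : forall i, open (mphi i @` mdom i);
  mphiK : forall i x, mdom i x -> mpsi i (mphi i x) = x;
  mphi_continuous : forall i x, mdom i x -> {for x, continuous (mphi i)};
  mpsi_continuous :
    forall i y, (mphi i @` mdom i) y -> {for y, continuous (mpsi i)};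
  mtransition : forall i j,
    smooth_on (mphi i @` (mdom i `&` mdom j)) (mphi j \o mpsi i) }.

Arguments mdom_open {R m} i.
Arguments mimage_open {R m} i.

Definition smooth_fun (R : realType) (M : manifold R) (W : set M)
    (f : M -> R) : Prop :=
  forall i, smooth_on (mphi i @` (mdom i `&` W)) (f \o mpsi i).

Section SmoothFun.
Variables (R : realType) (M : manifold R) (W : set M).
Hypothesis oW : open W.

Lemma chart_image_open (i : mchart M) : open (mphi i @` (mdom i `&` W)).
Proof.
rewrite openE => _ [x [Dx Wx] <-]; rewrite /interior.
have Iy : (mphi i @` mdom i) (mphi i x) by exists x.
have n1 := open_nbhs_nbhs (conj (mimage_open i) Iy).
have n2 : nbhs (mphi i x) (mpsi i @^-1` W).
  apply: (mpsi_continuous Iy); rewrite mphiK //.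
  exact: open_nbhs_nbhs (conj oW Wx).
apply: filterS (filterI n1 n2) => y [[x' Dx' <-]] /=.
by rewrite mphiK // => Wx'; exists x'.
Qed.

Lemma smooth_fun_ext (f g : M -> R) :
  (forall x, W x -> f x = g x) -> smooth_fun W f -> smooth_fun W g.
Proof.
move=> fg sf i k; apply: (Ck_ext (chart_image_open (i := i)) _ (sf i k)).
by move=> _ [x [Dx Wx] <-] /=; rewrite mphiK // fg.
Qed.

Lemma smooth_fun_cst (c : R) : smooth_fun W (fun=> c).
Proof. by move=> i k; exact: (Ck_cst (chart_image_open (i := i))). Qed.

Lemma smooth_funD (f g : M -> R) :
  smooth_fun W f -> smooth_fun W g -> smooth_fun W (fun x => f x + g x).
Proof.
by move=> sf sg i k; apply: (CkD (chart_image_open (i := i))) (sf i k) (sg i k).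
Qed.

Lemma smooth_funM (f g : M -> R) :
  smooth_fun W f -> smooth_fun W g -> smooth_fun W (fun x => f x * g x).
Proof.
by move=> sf sg i k; apply: (CkM (chart_image_open (i := i))) (sf i k) (sg i k).
Qed.

End SmoothFun.

Lemma smooth_funW (R : realType) (M : manifold R) (W W' : set M) (f : M -> R) :
  open W -> W `<=` W' -> smooth_fun W' f -> smooth_fun W f.
Proof.
move=> oW WW sf i k.
have im : mphi i @` (mdom i `&` W) `<=` mphi i @` (mdom i `&` W').
  by move=> _ [x [? ?] <-]; exists x => //; split => //; exact: WW.
have : forall (U U' : set 'rV[R]_(mdim M)) k (f : 'rV[R]_(mdim M) -> R),
    U `<=` U' -> Ck U' k f -> Ck U k f.
  move=> U U' + + UU; elim=> [|m IH] g /=; first by move=> cg x /UU; exact: cg.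
  by move=> [dg Dg]; split=> [x /UU|v]; [exact: dg|exact: IH].
by apply; [exact: im|exact: sf].
Qed.

(* A real vector bundle of rank [vrank] presented by its fibres and an atlas
   of local trivializations with smooth transition functions; this determines
   the topology and smooth structure of the total space. The maps [vfr j x] and
   [vinv j x] are mutually inverse for [x] in the domain [vdom j]. *)
Record vbundle (R : realType) (M : manifold R) := VBundle {
  vfib :> M -> vectType R;
  vrank : nat;
  vtriv : Type;
  vdom : vtriv -> set M;
  vfr : forall (j : vtriv) x, {linear vfib x -> 'rV[R]_vrank};
  vinv : forall (j : vtriv) x, {linear 'rV[R]_vrank -> vfib x};
  vdom_open : forall j, open (vdom j);
  vdom_cover : forall x, exists j, vdom j x;
  vfrK : forall j x, vdom j x -> cancel (vfr j x) (vinv j x);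
  vinvK : forall j x, vdom j x -> cancel (vinv j x) (vfr j x);
  vtransition : forall i j (v : 'rV[R]_vrank) c,
    smooth_fun (vdom i `&` vdom j) (fun x => vfr j x (vinv i x v) 0 c) }.

Arguments vdom_open {R M v0} j.

Definition smooth_section (R : realType) (M : manifold R) (E : vbundle M)
    (s : forall x, E x) : Prop :=
  forall j c, smooth_fun (vdom j) (fun x => vfr j x (s x) 0 c).

Record sec (R : realType) (M : manifold R) (E : vbundle M) := Sec {
  sec_val :> forall x, E x;
  sec_smooth : smooth_section sec_val }.

Section SectionModule.
Variables (R : realType) (M : manifold R) (E : vbundle M).
Implicit Types s t : sec E.

Lemma sec_eq s t : (forall x, s x = t x) -> s = t.
Proof.
case: s t => [s Hs] [t Ht] /= st; have e : s = t by apply: functional_extensionality_dep.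
by rewrite e in Hs *; congr Sec; exact: Prop_irrelevance.
Qed.

Lemma smooth_section0 : smooth_section (fun x => 0 : E x).
Proof.
move=> j c; apply: (smooth_fun_ext (vdom_open j) _ (smooth_fun_cst (vdom_open j) 0)).
by move=> x _; rewrite linear0 mxE.
Qed.

Lemma smooth_sectionD (s t : forall x, E x) : smooth_section s ->
  smooth_section t -> smooth_section (fun x => s x + t x).
Proof.
move=> ss st j c; apply: (smooth_fun_ext (vdom_open j) _
  (smooth_funD (vdom_open j) (ss j c) (st j c))).
by move=> x _; rewrite linearD mxE.
Qed.

Lemma smooth_sectionZ (k : R) (s : forall x, E x) : smooth_section s ->
  smooth_section (fun x => k *: s x).
Proof.
move=> ss j c; apply: (smooth_fun_ext (vdom_open j) _
  (smooth_funM (vdom_open j) (smooth_fun_cst (vdom_open j) k) (ss j c))).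
by move=> x _; rewrite linearZ mxE.
Qed.

HB.instance Definition _ := gen_eqMixin (sec E).
HB.instance Definition _ := gen_choiceMixin (sec E).

Definition sec0 : sec E := Sec smooth_section0.
Definition secD s t : sec E :=
  Sec (smooth_sectionD (sec_smooth s) (sec_smooth t)).
Definition secZ (k : R) s : sec E := Sec (smooth_sectionZ k (sec_smooth s)).
Definition secN s : sec E := secZ (-1) s.

Fact secDA : associative secD.
Proof. by move=> s t u; apply: sec_eq => x /=; rewrite addrA. Qed.
Fact secDC : commutative secD.
Proof. by move=> s t; apply: sec_eq => x /=; rewrite addrC. Qed.
Fact sec0D : left_id sec0 secD.
Proof. by move=> s; apply: sec_eq => x /=; rewrite add0r. Qed.
Fact secND : left_inverse sec0 secN secD.
Proof. by move=> s; apply: sec_eq => x /=; rewrite scaleN1r addNr. Qed.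
HB.instance Definition _ := GRing.isZmodule.Build (sec E) secDA secDC sec0D secND.

Fact secZA (a b : R) s : secZ a (secZ b s) = secZ (a * b) s.
Proof. by apply: sec_eq => x /=; rewrite scalerA. Qed.
Fact sec1Z : left_id 1 secZ.
Proof. by move=> s; apply: sec_eq => x /=; rewrite scale1r. Qed.
Fact secZDr : right_distributive secZ +%R.
Proof. by move=> a s t; apply: sec_eq => x /=; rewrite scalerDr. Qed.
Fact secZDl s : {morph secZ^~ s : a b / a + b}.
Proof. by move=> a b; apply: sec_eq => x /=; rewrite scalerDl. Qed.
HB.instance Definition _ :=
  GRing.Zmodule_isLmodule.Build R (sec E) secZA sec1Z secZDr secZDl.

End SectionModule.

Section Line.
Variables (R : realType) (M : manifold R).

Definition line_fr (_ : unit) (x : M) (a : R^o) : 'rV[R]_1 := \row_(_ < 1) a.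
Definition line_inv (_ : unit) (x : M) (v : 'rV[R]_1) : R^o := v 0 0.

Fact line_fr_linear j x : linear (line_fr j x).
Proof. by move=> k a b; apply/rowP => c; rewrite !mxE. Qed.
HB.instance Definition _ j x :=
  GRing.isLinear.Build R R^o 'rV[R]_1 _ (line_fr j x) (line_fr_linear j x).
Fact line_inv_linear j x : linear (line_inv j x).
Proof. by move=> k a b; rewrite /line_inv !mxE. Qed.
HB.instance Definition _ j x :=
  GRing.isLinear.Build R 'rV[R]_1 R^o _ (line_inv j x) (line_inv_linear j x).

Fact line_frK j x : [set: M] x -> cancel (line_fr j x) (line_inv j x).
Proof. by move=> _ a; rewrite /line_inv mxE. Qed.
Fact line_invK j x : [set: M] x -> cancel (line_inv j x) (line_fr j x).
Proof. by move=> _ v; apply/rowP => c; rewrite mxE !ord1. Qed.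
Fact line_transition (i j : unit) (v : 'rV[R]_1) c :
  smooth_fun ([set: M] `&` [set: M]) (fun x => line_fr j x (line_inv i x v) 0 c).
Proof.
rewrite setTI; apply: (smooth_fun_ext openT _ (smooth_fun_cst openT (v 0 0))).
by move=> x _; rewrite mxE.
Qed.

Definition line : vbundle M := @VBundle R M (fun=> R^o) 1 unit (fun=> [set: M])
  (fun j x => line_fr j x) (fun j x => line_inv j x) (fun=> openT)
  (fun=> ex_intro _ tt I) line_frK line_invK line_transition.

Lemma line_smoothP (f : M -> R) :
  smooth_section (fun x => f x : line x) <-> smooth_fun [set: M] f.
Proof.
split=> [sf|sf j c].
  by apply: (smooth_fun_ext openT _ (sf tt 0)) => x _; rewrite /= mxE.
by apply: (smooth_fun_ext openT _ sf) => x _; rewrite /= mxE.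
Qed.

End Line.
Arguments line {R} M.

(* Smooth functions are the sections of the trivial line bundle [line M]. *)
Notation Cinf M := (sec (line M)).

Lemma smooth_section_smul (R : realType) (M : manifold R) (E : vbundle M)
    (f : M -> R) (s : forall x, E x) :
  smooth_section (fun x => f x : line M x) -> smooth_section s ->
  smooth_section (fun x => f x *: s x).
Proof.
move=> /line_smoothP sf ss j c.
have sfj := smooth_funW (vdom_open j) (@subsetT _ _) sf.
apply: (smooth_fun_ext (vdom_open j) _ (smooth_funM (vdom_open j) sfj (ss j c))).
by move=> x _; rewrite linearZ mxE.
Qed.

Definition smul (R : realType) (M : manifold R) (E : vbundle M)
    (f : Cinf M) (s : sec E) : sec E :=
  Sec (smooth_section_smul (sec_smooth f) (sec_smooth s)).

(* The tangent space of [M] at [x] is the space of derivations at [x] of the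
   algebra of smooth functions. *)
Definition is_tangent (R : realType) (M : manifold R) (x : M)
    (v : Cinf M -> R) : Prop :=
  (forall (c : R) (f g : Cinf M), v (c *: f + g) = c * v f + v g) /\
  (forall f g : Cinf M, v (smul f g) = v f * g x + f x * v g).

(* A vector bundle morphism from [A] to the tangent bundle of [M]. *)
Record anchor_map (R : realType) (M : manifold R) (A : vbundle M) := AnchorMap {
  anc :> forall x, A x -> Cinf M -> R;
  anc_tangent : forall x (u : A x), is_tangent x (anc u);
  anc_linear : forall x (c : R) (u v : A x) (f : Cinf M),
    anc (c *: u + v) f = c * anc u f + anc v f;
  anc_smooth : forall (a : sec A) (f : Cinf M),
    smooth_section (fun x => anc (a x) f : line M x) }.

Definition rho (R : realType) (M : manifold R) (A : vbundle M)
  (r : anchor_map A) (a : sec A) (f : Cinf M) : Cinf M := Sec (anc_smooth r a f).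

(* The compatibility [br_anchor] of the anchor with the brackets follows from
   the other axioms; it is listed because it is customary. *)
Record lie_algebroid (R : realType) (M : manifold R) := LieAlgebroid {
  la_bundle :> vbundle M;
  la_anchor : anchor_map la_bundle;
  br : sec la_bundle -> sec la_bundle -> sec la_bundle;
  br_linear : forall a (k : R) b c, br a (k *: b + c) = k *: br a b + br a c;
  br_skew : forall a b, br a b = - br b a;
  br_jacobi : forall a b c, br a (br b c) + br b (br c a) + br c (br a b) = 0;
  br_leibniz : forall a (f : Cinf M) b,
    br a (smul f b) = smul f (br a b) + smul (rho la_anchor a f) b;
  br_anchor : forall a b (f : Cinf M),
    rho la_anchor (br a b) f =
    rho la_anchor a (rho la_anchor b f) - rho la_anchor b (rho la_anchor a f) }.

(* An element of Gamma(Lambda^* A^* (x) E), of arbitrary mixed degree: at every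
   point it is a function on lists of vectors of the fibre of [A], whose
   restriction to lists of length [k] is the degree [k] component, a
   skew-symmetric [k]-linear map. Components of degree above the rank of [A]
   vanish automatically, so this is the direct sum over all degrees. Since
   global sections span every fibre and extend local frames near any point,
   smoothness can be tested on tuples of global sections of [A]. *)
Record form (R : realType) (M : manifold R) (A E : vbundle M) := Form {
  form_val :> forall x, seq (A x) -> E x;
  form_linear : forall x (s1 s2 : seq (A x)) (c : R) (u v : A x),
    form_val (s1 ++ (c *: u + v) :: s2) =
    c *: form_val (s1 ++ u :: s2) + form_val (s1 ++ v :: s2);
  form_skew : forall x (s1 s2 : seq (A x)) (u v : A x),
    form_val (s1 ++ u :: v :: s2) = - form_val (s1 ++ v :: u :: s2);
  form_smooth : forall a : seq (sec A),
    smooth_section (fun x => form_val [seq (b : sec A) x | b <- a]) }.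

Definition has_degree (R : realType) (M : manifold R) (A E : vbundle M)
    (k : nat) (w : form A E) : Prop :=
  forall x (s : seq (A x)), size s != k -> w x s = 0.

Section FormModule.
Variables (R : realType) (M : manifold R) (A E : vbundle M).
Implicit Types w t : form A E.

Lemma form_eq w t : (forall x s, w x s = t x s) -> w = t.
Proof.
case: w t => [w l1 k1 s1] [t l2 k2 s2] /= wt.
have e : w = t.
  by apply: functional_extensionality_dep => x; apply/funext => s; exact: wt.
by subst t; congr Form; exact: Prop_irrelevance.
Qed.

Definition form0 : form A E.
Proof.
exists (fun x _ => 0).
- by move=> *; rewrite scaler0 addr0.
- by move=> *; rewrite oppr0.
- by move=> a; exact: smooth_section0.
Defined.

Definition formD w t : form A E.
Proof.
exists (fun x s => w x s + t x s).
- by move=> *; rewrite !form_linear scalerDr addrACA.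
- by move=> *; rewrite form_skew (form_skew t) opprD.
- by move=> a; apply: smooth_sectionD; exact: form_smooth.
Defined.

Definition formZ (k : R) w : form A E.
Proof.
exists (fun x s => k *: w x s).
- by move=> *; rewrite !form_linear scalerDr !scalerA mulrC.
- by move=> *; rewrite form_skew scalerN.
- by move=> a; apply: smooth_sectionZ; exact: form_smooth.
Defined.

Definition formN w := formZ (-1) w.

HB.instance Definition _ := gen_eqMixin (form A E).
HB.instance Definition _ := gen_choiceMixin (form A E).

Fact formDA : associative formD.
Proof. by move=> s t u; apply: form_eq => x l /=; rewrite addrA. Qed.
Fact formDC : commutative formD.
Proof. by move=> s t; apply: form_eq => x l /=; rewrite addrC. Qed.
Fact form0D : left_id form0 formD.
Proof. by move=> s; apply: form_eq => x l /=; rewrite add0r. Qed.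
Fact formND : left_inverse form0 formN formD.
Proof. by move=> s; apply: form_eq => x l /=; rewrite scaleN1r addNr. Qed.
HB.instance Definition _ :=
  GRing.isZmodule.Build (form A E) formDA formDC form0D formND.

Fact formZA (a b : R) w : formZ a (formZ b w) = formZ (a * b) w.
Proof. by apply: form_eq => x l /=; rewrite scalerA. Qed.
Fact form1Z : left_id 1 formZ.
Proof. by move=> w; apply: form_eq => x l /=; rewrite scale1r. Qed.
Fact formZDr : right_distributive formZ +%R.
Proof. by move=> a s t; apply: form_eq => x l /=; rewrite scalerDr. Qed.
Fact formZDl w : {morph formZ^~ w : a b / a + b}.
Proof. by move=> a b; apply: form_eq => x l /=; rewrite scalerDl. Qed.
HB.instance Definition _ :=
  GRing.Zmodule_isLmodule.Build R (form A E) formZA form1Z formZDr formZDl.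

Definition form_app w (a : seq (sec A)) : sec E := Sec (form_smooth w a).

Lemma form_appB w t a : form_app (w - t) a = form_app w a - form_app t a.
Proof. by apply: sec_eq. Qed.

Lemma form_app0 a : form_app 0 a = 0.
Proof. by apply: sec_eq. Qed.

End FormModule.

(* The wedge product of alternating maps combined with a bilinear pairing [mu]
   of the values, i.e. the sum over shuffles with signs, written recursively:
     i_u (f /\ g) = i_u f /\ g + (-1)^deg(f) f /\ i_u g
   where [i_u f] is [f \o cons u]. *)
Section Wedge.
Variables (R : realType) (T : Type) (U V W : lmodType R) (mu : U -> V -> W).

Definition deg_sign (f : seq T -> U) (s : seq T) : U := (-1) ^+ size s *: f s.

Fixpoint wedge_with (f : seq T -> U) (g : seq T -> V) (s : seq T) : W :=
  if s is u :: s' then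
    wedge_with (f \o cons u) g s' + wedge_with (deg_sign f) (g \o cons u) s'
  else mu (f [::]) (g [::]).

End Wedge.

Section WedgeForm.
Variables (R : realType) (M : manifold R) (A E : vbundle M).

Definition wedge_val (w : forall x, seq (A x) -> line M x)
    (t : forall x, seq (A x) -> E x) (x : M) : seq (A x) -> E x :=
  wedge_with (fun (a : R^o) (e : E x) => a *: e) (w x) (t x).

Section Fibre.
Variable x : M.
Implicit Types (f : seq (A x) -> R^o) (g : seq (A x) -> E x).
Local Notation wg := (wedge_with (fun (a : R^o) (e : E x) => a *: e)).

Lemma wedge_lin_l (c : R) f1 f2 g s :
  wg (fun s => c *: f1 s + f2 s) g s = c *: wg f1 g s + wg f2 g s.
Proof.
elim: s f1 f2 g => [|u s IH] f1 f2 g /=; first by rewrite scalerDl scalerA.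
have -> : deg_sign (fun s0 => c *: f1 s0 + f2 s0) =
          (fun s => c *: deg_sign f1 s + deg_sign f2 s).
  by apply/funext => t; rewrite /deg_sign scalerDr !scalerA mulrC.
rewrite (IH (f1 \o cons u) (f2 \o cons u)) IH scalerDr addrACA.
by [].
Qed.

Lemma wedge_lin_r (c : R) f g1 g2 s :
  wg f (fun s => c *: g1 s + g2 s) s = c *: wg f g1 s + wg f g2 s.
Proof.
elim: s f g1 g2 => [|u s IH] f g1 g2 /=.
  by rewrite scalerDr !scalerA mulrC.
by rewrite IH (IH _ (g1 \o cons u) (g2 \o cons u)) scalerDr addrACA.
Qed.

Definition mlin (W : lmodType R) (f : seq (A x) -> W) := forall s1 s2 (c : R) u v,
  f (s1 ++ (c *: u + v) :: s2) = c *: f (s1 ++ u :: s2) + f (s1 ++ v :: s2).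
Definition skew (W : lmodType R) (f : seq (A x) -> W) := forall s1 s2 u v,
  f (s1 ++ u :: v :: s2) = - f (s1 ++ v :: u :: s2).

Lemma mlin_cons (W : lmodType R) (f : seq (A x) -> W) u :
  mlin f -> mlin (f \o cons u).
Proof. by move=> mf s1 s2 c v w; rewrite /= -!cat_cons mf. Qed.
Lemma skew_cons (W : lmodType R) (f : seq (A x) -> W) u :
  skew f -> skew (f \o cons u).
Proof. by move=> mf s1 s2 v w; rewrite /= -!cat_cons mf. Qed.
Lemma mlin_sign (W : lmodType R) (f : seq (A x) -> W) :
  mlin f -> mlin (deg_sign f).
Proof.
move=> mf s1 s2 c u v; rewrite /deg_sign !size_cat /= mf.
by rewrite scalerDr !scalerA mulrC.
Qed.
Lemma skew_sign (W : lmodType R) (f : seq (A x) -> W) :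
  skew f -> skew (deg_sign f).
Proof. by move=> mf s1 s2 u v; rewrite /deg_sign !size_cat /= mf scalerN. Qed.

Lemma wedge_mlin f g : mlin f -> mlin g -> mlin (wg f g).
Proof.
move=> mf mg s1; elim: s1 f g mf mg => [|w s1 IH] f g mf mg s2 c u v /=.
  have -> : f \o cons (c *: u + v) =
      (fun s => c *: (f \o cons u) s + (f \o cons v) s).
    by apply/funext => s; exact: (mf [::]).
  have -> : g \o cons (c *: u + v) =
      (fun s => c *: (g \o cons u) s + (g \o cons v) s).
    by apply/funext => s; exact: (mg [::]).
  by rewrite wedge_lin_l wedge_lin_r scalerDr addrACA.
rewrite (IH _ _ (mlin_cons w mf) mg).
by rewrite (IH _ _ (mlin_sign mf) (mlin_cons w mg)) scalerDr addrACA.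
Qed.

Lemma wedge_skew f g : skew f -> skew g -> skew (wg f g).
Proof.
have wN1 f1 g1 s : wg (fun s => - f1 s) g1 s = - wg f1 g1 s.
  have := wedge_lin_l (-1) f1 (fun=> 0) g1 s.
  have := wedge_lin_l (-1) (fun=> 0) (fun=> 0) g1 s.
  have -> : (fun _ : seq (A x) => -1 *: (0 : R^o) + 0) = (fun=> 0).
    by apply/funext => ?; rewrite scaler0 addr0.
  rewrite scaleN1r addNr => ->; rewrite addr0 scaleN1r => <-; congr (wg _ _ _).
  by apply/funext => t; rewrite scaleN1r addr0.
have wN2 f1 g1 s : wg f1 (fun s => - g1 s) s = - wg f1 g1 s.
  have := wedge_lin_r (-1) f1 g1 (fun=> 0) s.
  have := wedge_lin_r (-1) f1 (fun=> 0) (fun=> 0) s.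
  have -> : (fun _ : seq (A x) => -1 *: (0 : E x) + 0) = (fun=> 0).
    by apply/funext => ?; rewrite scaler0 addr0.
  rewrite scaleN1r addNr => ->; rewrite addr0 scaleN1r => <-; congr (wg _ _ _).
  by apply/funext => t; rewrite scaleN1r addr0.
move=> kf kg s1; elim: s1 f g kf kg => [|w s1 IH] f g kf kg s2 u v /=; last first.
  rewrite (IH _ _ (skew_cons w kf) kg s2 u v).
  by rewrite (IH _ _ (skew_sign kf) (skew_cons w kg) s2 u v) opprD.
have -> : (f \o cons u) \o cons v = fun s => - ((f \o cons v) \o cons u) s.
  by apply/funext => s; exact: (kf [::]).
have -> : (g \o cons u) \o cons v = fun s => - ((g \o cons v) \o cons u) s.
  by apply/funext => s; exact: (kg [::]).
have sg z : deg_sign f \o cons z = fun s => - deg_sign (f \o cons z) s.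
  by apply/funext => s; rewrite /= /deg_sign /= exprS mulN1r scaleNr.
rewrite !sg !wN1 wN2 !opprD !opprK -!addrA; congr (_ + _).
by rewrite addrCA; congr (_ + _).
Qed.

End Fibre.

Lemma wedge_smooth (w : forall x, seq (A x) -> line M x)
    (t : forall x, seq (A x) -> E x) :
  (forall a : seq (sec A),
     smooth_section (fun x => w x [seq (b : sec A) x | b <- a])) ->
  (forall a : seq (sec A),
     smooth_section (fun x => t x [seq (b : sec A) x | b <- a])) ->
  forall a : seq (sec A),
    smooth_section (fun x => wedge_val w t [seq (b : sec A) x | b <- a]).
Proof.
move=> sw st a; elim: a w t sw st => [|b a IH] w t sw st.
  exact: smooth_section_smul (sw [::]) (st [::]).
apply: smooth_sectionD.
  apply: (IH (fun x => w x \o cons (b x)) t) => // a'.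
  exact: (sw (b :: a')).
apply: (IH (fun x => deg_sign (w x)) (fun x => t x \o cons (b x))) => a'.
  rewrite /deg_sign.
  have -> : (fun x => (-1) ^+ size [seq (b : sec A) x | b <- a'] *:
              w x [seq (b : sec A) x | b <- a']) =
            (fun x => (-1) ^+ size a' *: w x [seq (b : sec A) x | b <- a']).
    by apply/funext => x; rewrite size_map.
  exact: smooth_sectionZ.
exact: (st (b :: a')).
Qed.

Definition wedge (w : form A (line M)) (t : form A E) : form A E :=
  Form (fun x => wedge_mlin (form_linear w (x := x)) (form_linear t (x := x)))
       (fun x => wedge_skew (form_skew w (x := x)) (form_skew t (x := x)))
       (wedge_smooth (form_smooth w) (form_smooth t)).

End WedgeForm.

Section Differential.
Variables (R : realType) (M : manifold R) (A : lie_algebroid M).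
Implicit Types w t : form A (line M).

Definition omit (T : Type) (i : nat) (s : seq T) : seq T :=
  take i s ++ drop i.+1 s.

Definition koszul w (a : seq (sec A)) : Cinf M :=
  \sum_(i < size a)
     (-1) ^+ i *: rho (la_anchor A) a`_i (form_app w (omit i a)) +
  \sum_(j < size a) \sum_(i < j)
     (-1) ^+ (i + j) *: form_app w (br a`_i a`_j :: omit i (omit j a)).

(* [t] is the Lie algebroid differential of [w], as given by the Koszul
   formula. A form is determined by its values on global sections. *)
Definition is_dA w t : Prop := forall a, form_app t a = koszul w a.

Lemma koszulB w t a : koszul (w - t) a = koszul w a - koszul t a.
Proof.
have rhoB b (f g : Cinf M) : rho (la_anchor A) b (f - g) =
    rho (la_anchor A) b f - rho (la_anchor A) b g.
  apply: sec_eq => x /=; rewrite [f - g]addrC -scaleN1r.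
  have [-> _] := anc_tangent (la_anchor A) (b x).
  by rewrite mulN1r addrC scaleN1r.
rewrite /koszul opprD addrACA -!sumrB; congr (_ + _); apply: eq_bigr => i _.
  by rewrite form_appB rhoB scalerBr.
by rewrite -sumrB; apply: eq_bigr => j _; rewrite form_appB scalerBr.
Qed.

Lemma is_dAB w1 t1 w2 t2 :
  is_dA w1 t1 -> is_dA w2 t2 -> is_dA (w1 - w2) (t1 - t2).
Proof. by move=> d1 d2 a; rewrite koszulB form_appB d1 d2. Qed.

Lemma is_dA0 : is_dA 0 0.
Proof. by move=> a; rewrite -[X in koszul X](subrr 0) koszulB subrr form_app0. Qed.

Lemma has_degreeB k w t :
  has_degree k w -> has_degree k t -> has_degree k (w - t).
Proof.
move=> dw dt x s sk; rewrite -[LHS]/(w x s + -1 *: t x s).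
by rewrite dw // dt // scaler0 addr0.
Qed.

Definition cocycle_pred (k : nat) : {pred form A (line M)} :=
  fun w => `[< has_degree k w /\ is_dA w 0 >].

Fact cocycle_zmod_closed k : zmod_closed (cocycle_pred k).
Proof.
split; first by apply/asboolP; split=> //; exact: is_dA0.
move=> w t /asboolP[dw cw] /asboolP[dt ct]; apply/asboolP.
split; first exact: has_degreeB.
by rewrite -[0]subr0; exact: is_dAB.
Qed.
HB.instance Definition _ k :=
  GRing.isZmodClosed.Build (form A (line M)) (cocycle_pred k)
    (cocycle_zmod_closed k).

Record cocycle (k : nat) := Cocycle {
  cocycle_val :> form A (line M);
  cocycleP : cocycle_val \in cocycle_pred k }.
HB.instance Definition _ k := [isSub for @cocycle_val k].
HB.instance Definition _ k := [Choice of cocycle k by <:].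
HB.instance Definition _ k := [SubChoice_isSubZmodule of cocycle k by <:].

(* The degree condition on the primitive [t] means degree [k - 1], and [t = 0]
   when [k = 0]. *)
Definition coboundary_pred (k : nat) : {pred cocycle k} :=
  fun z => `[< exists2 t : form A (line M),
    (forall x (s : seq (A x)), (size s).+1 != k -> t x s = 0) & is_dA t z >].

Fact coboundary_zmod_closed k : zmod_closed (@coboundary_pred k).
Proof.
split; first by apply/asboolP; exists 0 => //; exact: is_dA0.
move=> z1 z2 /asboolP[t1 d1 e1] /asboolP[t2 d2 e2]; apply/asboolP.
exists (t1 - t2); last by have := is_dAB e1 e2.
move=> x s sk; rewrite -[LHS]/(t1 x s + -1 *: t2 x s).
by rewrite d1 // d2 // scaler0 addr0.
Qed.
HB.instance Definition _ k :=
  GRing.isZmodClosed.Build (cocycle k) (@coboundary_pred k)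
    (coboundary_zmod_closed k).

Definition cohomology (k : nat) : zmodType := {ideal_quot @coboundary_pred k}.

Definition cohomology_class (k : nat) (z : cocycle k) : cohomology k :=
  (\pi_(cohomology k) z)%qT.

End Differential.
Arguments cohomology {R M} A k.

Record connection (R : realType) (M : manifold R) (A : lie_algebroid M)
    (E : vbundle M) := Connection {
  nab :> sec A -> sec E -> sec E;
  nabDl : forall a b s, nab (a + b) s = nab a s + nab b s;
  nabZl : forall (f : Cinf M) a s, nab (smul f a) s = smul f (nab a s);
  nab_linear : forall a (k : R) s t, nab a (k *: s + t) = k *: nab a s + nab a t;
  nab_leibniz : forall a (f : Cinf M) s,
    nab a (smul f s) = smul f (nab a s) + smul (rho (la_anchor A) a f) s }.

Section Pontryagin.
Variables (R : realType) (M : manifold R) (A : lie_algebroid M) (E : vbundle M).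

(* Forms with values in the bundle End(E) are handled fibrewise. The curvature
   is determined by the formula below because every vector of a fibre is the
   value of a global section. *)
Definition is_curvature (nabla : connection A E)
    (F : forall x, seq (A x) -> 'End(E x)) : Prop :=
  (forall x (s : seq (A x)), size s != 2 -> F x s = 0) /\
  (forall (a b : sec A) (e : sec E) x,
     F x [:: a x; b x] (e x) =
     (nabla a (nabla b e) - nabla b (nabla a e) - nabla (br a b) e) x).

Definition end_one (x : M) (s : seq (A x)) : 'End(E x) :=
  if s is [::] then \1%VF else 0.

Definition end_pow (F : forall x, seq (A x) -> 'End(E x)) (l : nat) (x : M) :
    seq (A x) -> 'End(E x) :=
  iter l (wedge_with (fun f g : 'End(E x) => (f \o g)%VF) (F x)) (@end_one x).

Definition lftrace (V : vectType R) (f : 'End(V)) : R :=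
  \tr (passmx.mxof (vbasis {:V}) (vbasis {:V}) f).

(* [c] is the class of tr(F^l) in degree 2l, where [F] is the curvature of
   [nabla]; in particular tr(F^l) is required to be a closed form. The class is
   independent of [nabla], which therefore may be chosen arbitrarily. *)
Definition is_pontryagin_char (nabla : connection A E) (l : nat)
    (c : cohomology A l.*2) : Prop :=
  exists (F : forall x, seq (A x) -> 'End(E x)) (z : cocycle A l.*2),
    [/\ is_curvature nabla F,
        forall x (s : seq (A x)), (z : form A (line M)) x s = lftrace (end_pow F l s)
      & c = cohomology_class z].

End Pontryagin.
Arguments is_pontryagin_char {R M A E} nabla l c.

Section Representation.
Variables (R : realType) (M : manifold R) (A : lie_algebroid M).
Variables (n : nat) (E : 'I_n -> vbundle M).

(* [gform] is Gamma(Lambda^* A^* (x) E) for the graded bundle with [E z] placed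
   in degree [z]. *)
Definition gform : Type := forall z : 'I_n, form A (E z).

Definition has_total_degree (p : nat) (eta : gform) : Prop :=
  forall (z : 'I_n) x (s : seq (A x)), (size s + z)%N != p -> eta z x s = 0.

Definition is_nrepresentation (D : gform -> gform) : Prop :=
  [/\ forall (c : R) (eta xi : gform) z,
        D (fun y => c *: eta y + xi y) z = c *: D eta z + D xi z,
      forall p eta, has_total_degree p eta -> has_total_degree p.+1 (D eta),
      forall eta z, D (D eta) z = 0
    & forall l (w dw : form A (line M)) (eta : gform) z,
        has_degree l w -> is_dA w dw ->
        D (fun y => wedge w (eta y)) z =
        wedge dw (eta z) + (-1) ^+ l *: wedge w (D eta z)].

End Representation.

(* Main.v *)
(* Let nabla be the direct sum of the given connections, with curvature R, and
   write D = nabla + theta. Comparing Leibniz rules, theta is linear over forms,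
   so it is an End-valued form of odd total degree, and D^2 = 0 becomes
   R + [nabla, theta] + theta^2 = 0. Along the path nabla + t theta, of curvature
   R_t = R + t [nabla, theta] + t^2 theta^2, the derivative of R_t^l is the
   covariant derivative of sum_i R_t^i theta R_t^(l-1-i) at time t. The supertrace
   turns the covariant derivative into d_A and kills supercommutators, hence
   str(R^l) = str(R_0^l) - str(R_1^l) is exact. The trace of each R_i^l is closed
   by the Bianchi identity.

   Forms are handled as alternating C^oo(M)-multilinear cochains on the Lie
   algebra of sections of A. Bump functions show that such cochains, and
   C^oo(M)-linear operators between sections, are given pointwise. *)

Require Import Defs.
From HB Require Import structures.
From mathcomp Require Import all_boot all_order all_algebra.
From mathcomp Require Import all_classical all_reals all_analysis.
From mathcomp Require Import ring.
Import Order.TTheory GRing.Theory Num.Theory numFieldNormedType.Exports.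
Local Open Scope ring_scope.

Set Implicit Arguments. Unset Strict Implicit. Unset Printing Implicit Defensive.
Local Open Scope classical_set_scope.

(* MathComp also defines a [form]. *)
Local Notation form := Defs.form.

(** * Bump functions and dual frames *)

(** No integral over t is taken: R_t^l is a polynomial in t, its value at t = 1 is the sum of its
    coefficients, and that sum vanishes because R_1 = 0 is the flatness of D. Differentiating
    t^(k+1) produces a factor k + 1, which is divided out once the supertrace has been taken. There
    are two obstacles. D is given only as an operator on global elements, so the formula nabla +
    theta has to be recovered from the values of D on sections: after multiplication by a cut-off
    function g, an element becomes a finite sum of products of forms with frame sections, and the
    term in d_A g is the same for both operators. The signs, moreover, depend on form degree and
    internal degree together; a fixed twist of the module turns End-valued operators into plain
    wedge products, at the price of the parity operator [eps] in front of the covariant derivative.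
    This [eps] cancels the one in the supertrace, so the primitive is an ordinary trace. As the
    connections are arbitrary, theta may have components in several form degrees, and the primitive
    must be cut down to a single one. *)

Section FlatFunction.
Variable R : realType.

(** All powers k are taken together because the derivative of one such function is a linear
    combination of two others; smoothness then follows by induction. *)
Definition flat_exp (k : nat) (t : R) : R :=
  if 0 < t then t^-1 ^+ k * expR (- t^-1) else 0.

Lemma flat_exp_le0 k t : t <= 0 -> flat_exp k t = 0.
Proof. by move=> t0; rewrite /flat_exp ltNge t0. Qed.

Lemma flat_exp_ge0 k t : 0 <= flat_exp k t.
Proof.
rewrite /flat_exp; case: ifP => // t0.
by rewrite mulr_ge0 ?expR_ge0 // exprn_ge0 // invr_ge0 ltW.
Qed.

(** With u = 1/t this is u^(k+2) / (k+2)! <= exp u. A bound quadratic in t is what makes the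
    difference quotient at 0 tend to 0. *)
Lemma flat_exp_le k t : flat_exp k t <= k.+2`!%:R * `|t| ^+ 2.
Proof.
rewrite /flat_exp; case: ifP => t0; last by rewrite mulr_ge0 ?exprn_ge0.
have u0 : 0 < t^-1 by rewrite invr_gt0.
have := expR_ge1Dxn k.+1 (ltW u0).
set u := t^-1 in u0 *; rewrite gtr0_norm // -[t]invrK -/u expRN => H.
have F0 : (0 : R) < k.+2`!%:R by rewrite ltr0n fact_gt0.
have {}H : u ^+ k.+2 / k.+2`!%:R <= expR u.
  by apply: le_trans H; rewrite lerDr.
rewrite ler_pdivrMr ?expR_gt0 //.
rewrite ler_pdivrMr // in H.
have -> : k.+2`!%:R * u^-1 ^+ 2 * expR u = (u ^+ 2)^-1 * (expR u * k.+2`!%:R).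
  by rewrite exprVn; ring.
by rewrite ler_pdivlMl ?exprn_gt0 // -exprD add2n.
Qed.

Lemma flat_exp_lt t t' : t < t' -> 0 < t' -> flat_exp 0 t < flat_exp 0 t'.
Proof.
move=> tt t'0; rewrite /flat_exp t'0 !expr0 !mul1r; case: ifP => [t0|_]; last first.
  exact: expR_gt0.
by rewrite ltr_expR ltrN2 ltf_pV2.
Qed.

Lemma is_derive_flat_exp k (t : R) :
  is_derive t 1 (flat_exp k) (flat_exp k.+2 t - k%:R * flat_exp k.+1 t).
Proof.
have [t0|t0|t0] := ltgtP t 0.
- apply: (near_eq_is_derive (f := cst 0)).
  + near=> y; rewrite flat_exp_le0 //.
    by apply: ltW; near: y; exact: lt_nbhsl.
  + by rewrite !flat_exp_le0 ?ltW // mulr0 subr0; exact: is_derive_cst.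
- apply: (@near_eq_is_derive _ _ _ (fun y : R => y^-1 ^+ k * expR (- y^-1))).
  + near=> y; rewrite /flat_exp ifT //.
    by near: y; exact: lt_nbhsr.
  + have tn0 : t != 0 by rewrite gt_eqF.
    have dV : is_derive t 1 (fun y : R => y^-1) (- t ^- 2).
      have := is_deriveV tn0 (is_derive_id t 1).
      by rewrite /GRing.scale /= mulr1.
    have dk := is_deriveX k dV.
    have dN := is_deriveN dV.
    have dE := @is_derive1_comp R expR (fun y => - y^-1) t _ _ (is_derive_expR (- t^-1)) dN.
    have -> : (fun y : R => y^-1 ^+ k * expR (- y^-1)) =
        ((fun y => y^-1) ^+ k) * (expR \o (fun y => - y^-1)).
      by apply/funext => y; rewrite !fctE.
    apply: (is_derive_eq (is_deriveM dk dE)).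
    rewrite /flat_exp t0 !fctE.
    rewrite /GRing.scale /= !opprK -!exprVn.
    case: k {dk} => [|k] /=; rewrite ?mul0r ?mulr0 ?subr0 ?addr0; first by rewrite expr0; ring.
    by rewrite !exprS; ring.
- rewrite t0 !flat_exp_le0 // mulr0 subr0.
  have C0 : (0 : R) < k.+2`!%:R by rewrite ltr0n fact_gt0.
  have lim0 : (fun h : R => h^-1 *: ((flat_exp k \o shift 0) (h *: (1 : R^o)) - flat_exp k 0))
      @ 0^' --> (0 : R^o).
    apply/cvgrPdist_lt => e e0; near=> h.
    rewrite /= addr0 (flat_exp_le0 _ (lexx 0)) subr0 sub0r normrN.
    rewrite /GRing.scale /= mulr1 normrM normfV (ger0_norm (flat_exp_ge0 _ _)).
    have hn0 : 0 < `|h| by rewrite normr_gt0; near: h; exact: nbhs_dnbhs_neq.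
    rewrite ltr_pdivrMl //; apply: le_lt_trans (flat_exp_le _ _) _.
    rewrite expr2 mulrCA ltr_pM2l // -ltr_pdivlMl //.
    near: h; apply: dnbhs0_lt; by rewrite mulr_gt0 ?invr_gt0.
  apply: DeriveDef; first exact: cvgP lim0.
  exact: cvg_lim lim0.
Unshelve. all: by end_near.
Qed.
End FlatFunction.

Section CkLemmas.
Variables (R : realType) (V : normedModType R).
Implicit Types U : set V.

Lemma Ck_sub (W : normedModType R) U U' k (f : V -> W) :
  U `<=` U' -> Ck U' k f -> Ck U k f.
Proof.
move=> UU; elim: k f => [|k IH] f /=; first by move=> cf x /UU; exact: cf.
by move=> [df Df]; split=> [x /UU|v]; [exact: df|exact: IH].
Qed.

(** The clauses of [Ck] are pointwise conditions on total functions and their iterated directional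
    derivatives, so they may be tested on singletons, although these are not open. *)
Lemma Ck_local (W : normedModType R) U k (f : V -> W) :
  (forall x, U x -> Ck [set x] k f) -> Ck U k f.
Proof.
elim: k f => [|k IH] f /= H; first by move=> x Ux; exact: H Ux x erefl.
split=> [x Ux|v]; first by have [+ _] := H x Ux; exact.
by apply: IH => x Ux; have [_] := H x Ux; exact.
Qed.

Lemma Ck_sum U (oU : open U) k (I : Type) (r : seq I) (F : I -> V -> R) :
  (forall i, Ck U k (F i)) -> Ck U k (fun x => \sum_(i <- r) F i x).
Proof.
move=> CF; elim: r => [|i r IH].
  by apply: (Ck_ext oU _ (Ck_cst oU k (0 : R))) => x _; rewrite big_nil.
by apply: (Ck_ext oU _ (CkD oU (CF i) IH)) => x _; rewrite big_cons.
Qed.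

Lemma Ck_coord n U (oU : open U) k (f : V -> 'rV[R]_n) c :
  Ck U k f -> Ck U k (fun x => f x 0 c).
Proof.
elim: k f => [|k IH] f /=.
  move=> cf x Ux; apply: (@continuous_comp _ _ _ f (fun N : 'rV[R]_n => N 0 c)).
    exact: cf.
  exact: coord_continuous.
move=> [df Df]; split=> [x Ux|v].
  exact: (differentiable_comp (df x Ux) (differentiable_coord _ _ _)).
apply: (Ck_ext oU _ (IH _ (Df v))) => x Ux.
by rewrite derive_mx ?mxE //; apply: diff_derivable; exact: df.
Qed.

(** The induction on n keeps k general, since the chain rule brings in the indices k + 1 and k +
    2. *)
Lemma Ck_flat_exp U (oU : open U) n k (f : V -> R) :
  Ck U n f -> Ck U n (fun x => flat_exp k (f x)).
Proof.
have dflat m (t : R) : differentiable (flat_exp m) t.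
  by apply/derivable1_diffP; have [] := is_derive_flat_exp m t.
elim: n k f => [|n IH] k f.
  move=> cf x Ux; apply: (@continuous_comp _ _ _ f (flat_exp k)); first exact: cf.
  exact: differentiable_continuous.
move=> Cf; have [df Df] := Cf; split=> [x Ux|v].
  exact: (differentiable_comp (df x Ux) (dflat _ _)).
pose g x := (flat_exp k.+2 (f x) + - k%:R * flat_exp k.+1 (f x)) * 'D_v f x.
have Cg : Ck U n g.
  have Cf' := CkW Cf.
  apply: (CkM oU _ (Df v)); apply: (CkD oU (IH _ _ Cf')).
  exact: (CkM oU (Ck_cst oU _ _) (IH _ _ Cf')).
apply: (Ck_ext oU _ Cg) => x Ux.
rewrite (deriveE _ (differentiable_comp (df x Ux) (dflat k (f x)))).
rewrite (diff_comp (df x Ux) (dflat k (f x))) /= -(deriveE v (df x Ux)).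
have [dk ek] := is_derive_flat_exp k (f x).
rewrite deriv1E // derive1E ek /g /GRing.scale /= mulNr mulrC.
by [].
Qed.

End CkLemmas.

Section SmoothLocal.
Variables (R : realType) (M : manifold R).

Lemma smooth_fun_local (W : set M) (f : M -> R) :
  (forall x, W x -> exists2 W', W' x & smooth_fun W' f) -> smooth_fun W f.
Proof.
move=> H i k; apply: Ck_local => _ [x [Dx Wx] <-].
have [W' W'x sf] := H x Wx.
apply: (Ck_sub _ (sf i k)) => _ ->.
by exists x.
Qed.

Lemma smooth_fun_sum (W : set M) (oW : open W) (I : Type) (r : seq I) (F : I -> M -> R) :
  (forall i, smooth_fun W (F i)) -> smooth_fun W (fun x => \sum_(i <- r) F i x).
Proof.
by move=> sF i k; apply: (Ck_sum (chart_image_open oW (i := i))) => j; exact: sF.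
Qed.

End SmoothLocal.

Section Bump.
Variables (R : realType) (M : manifold R).

(** A cut-off function of the squared distance in a chart at x, extended by 0. The closed set Z is
    recorded because it lets other objects defined only on W be extended by 0 as well. *)
Lemma bump_function (x : M) (W : set M) : open W -> W x ->
  exists2 chi : Cinf M, (\near x, chi x = 1) &
    exists2 Z, closed Z /\ Z `<=` W & forall y, ~ Z y -> chi y = 0.
Proof.
move=> oW Wx; have [i Dx] := mdom_cover x.
set p := mphi i x.
have oU := chart_image_open oW (i := i).
have Up : (mphi i @` (mdom i `&` W)) p by exists x.
have /nbhs_ballP[r /= r0 Br] := open_nbhs_nbhs (conj oU Up).
(* The norm of row vectors is a maximum, hence not smooth, so the sum of squares is used for the
   cut-off. The threshold [t1] makes q y < t1 force y into the closed ball of radius r / 2. *)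
pose q (y : 'rV[R]_(mdim M)) : R := \sum_(c < mdim M) (y 0 c - p 0 c) ^+ 2.
pose t1 : R := (r / 2) ^+ 2.
pose t0 : R := t1 / 2.
have t1_gt0 : 0 < t1 by rewrite exprn_gt0 // divr_gt0.
have t0_gt0 : 0 < t0 by rewrite divr_gt0.
have t01 : t0 < t1 by rewrite /t0 ltr_pdivrMr // ltr_pMr // ltr1n.
pose c := flat_exp 0 (t1 - t0).
have c_gt0 : 0 < c.
  by rewrite -(flat_exp_le0 0 (lexx (0 : R))) flat_exp_lt // subr_gt0.
(* [psi] is 1 where [q <= t0] and 0 where [t1 <= q]; composing [flat_exp] with
   itself avoids dividing by a nonconstant function. *)
pose psi y : R := (flat_exp 0 c)^-1 * flat_exp 0 (c - flat_exp 0 (q y - t0)).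
have hc_gt0 : 0 < flat_exp 0 c by rewrite -(flat_exp_le0 0 (lexx (0 : R))) flat_exp_lt.
have psi1 y : q y <= t0 -> psi y = 1.
  move=> qy; rewrite /psi [flat_exp 0 (q y - _)]flat_exp_le0 ?subr_le0 // subr0.
  by rewrite mulVf // gt_eqF.
have psi0 y : t1 <= q y -> psi y = 0.
  move=> qy; rewrite /psi [X in _ * X]flat_exp_le0 ?mulr0 // subr_le0 /c.
  move: qy; rewrite le_eqVlt => /predU1P[->//|qy].
  apply/ltW/flat_exp_lt; first by rewrite ltrD2r.
  by rewrite subr_gt0 (lt_trans t01).
pose B := closed_ball p (r / 2).
have r2 : 0 < r / 2 by rewrite divr_gt0.
have qB y : q y < t1 -> B y.
  move=> qy; rewrite /B closed_ballE // /closed_ball_ /=.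
  rewrite [`|_|]mx_normrE; apply/bigmax_leP; split; first exact: ltW.
  move=> [a b] _ /=; rewrite !ord1 !mxE distrC -(ler_pXn2r (n := 2)) ?nnegrE ?normr_ge0 ?(ltW r2) //.
  rewrite -normrX ger0_norm ?sqr_ge0 //. apply: ltW; apply: le_lt_trans qy.
  by rewrite /q (bigD1 b) //= lerDl sumr_ge0 // => ? _; exact: sqr_ge0.
have BU : B `<=` mphi i @` (mdom i `&` W).
  apply: (subset_trans _ Br); apply: closed_ball_subset => //.
  by rewrite ltr_pdivrMr // ltr_pMr // ltr1n.
pose Z := mpsi i @` B.
have ZD : Z `<=` mdom i `&` W.
  by move=> _ [y /BU[z [Dz Wz] <-] <-]; rewrite mphiK.
(* Z is the image of a compact ball, and compact sets of a Hausdorff space are closed. *)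
have cZ : closed Z.
  apply: compact_closed; first exact: mhausdorff.
  apply: continuous_compact.
    apply: continuous_in_subspaceT => y /set_mem /BU[z [Dz Wz] <-].
    by apply: mpsi_continuous; exists z.
  apply: bounded_closed_compact; last exact: closed_ball_closed.
  exists (`|p| + r / 2); split; first exact: num_real.
  move=> m hm y; rewrite /B closed_ballE // /closed_ball_ /= => py.
  apply: le_trans (ltW hm); rewrite -[y](subrK p) addrC.
  by apply: le_trans (ler_normD _ _) _; rewrite lerD2l distrC.
pose chi y := if `[< mdom i y >] then psi (mphi i y) else 0.
have chiZ y : ~ Z y -> chi y = 0.
  rewrite /chi; case: asboolP => // Dy nZ; apply: psi0; rewrite leNgt.
  by apply/negP => /qB By; apply: nZ; exists (mphi i y) => //; rewrite mphiK.
have Cq (V : normedModType R) (U : set V) (oV : open U) k (f : V -> 'rV[R]_(mdim M)) :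
    Ck U k f -> Ck U k (fun y => q (f y)).
  move=> Cf; apply: (Ck_sum oV) => b.
  have Cb := CkD oV (Ck_coord oV b Cf) (Ck_cst oV k (- p 0 b)).
  by apply: (Ck_ext oV _ (CkM oV Cb Cb)) => y _; rewrite expr2.
have sq (V : normedModType R) (U : set V) (oV : open U) k (f : V -> 'rV[R]_(mdim M)) :
    Ck U k f -> Ck U k (fun y => psi (f y)).
  move=> Cf.
  have hq := Ck_flat_exp oV 0 (CkD oV (Cq _ _ oV _ _ Cf) (Ck_cst oV _ (- t0))).
  have hN := CkD oV (Ck_cst oV k c) (CkM oV (Ck_cst oV k (-1 : R)) hq).
  apply: (Ck_ext oV _ (CkM oV (Ck_cst oV k (flat_exp 0 c)^-1) (Ck_flat_exp oV 0 hN))).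
  by move=> y _; rewrite mulN1r.
(* The chart domain and the complement of Z cover M, as Z lies in the chart domain; on the second
   set the function is 0. *)
have schi : smooth_fun [set: M] chi.
  apply: smooth_fun_local => y _.
  have [Dy|nDy] := pselect (mdom i y).
    exists (mdom i) => // j k.
    have oj := chart_image_open (mdom_open i) (i := j).
    apply: (Ck_ext oj _ (sq _ _ oj _ _ (@mtransition _ M j i k))).
    by move=> _ [z [Dz Dz'] <-] /=; rewrite mphiK // /chi asboolT.
  exists (~` Z); first by move=> /ZD[].
  have oZ : open (~` Z) by rewrite openC.
  by apply: (smooth_fun_ext oZ _ (smooth_fun_cst oZ 0)) => z /chiZ.
pose chis : Cinf M := Sec (proj2 (line_smoothP chi) schi).
exists chis; last by exists Z => //; split=> // y /ZD[].
have n1 : nbhs x (mdom i) by apply: open_nbhs_nbhs; split => //; exact: mdom_open.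
have qc : {for p, continuous q}.
  have C0 : Ck setT 0 (@id 'rV[R]_(mdim M)) by move=> y _; exact: cvg_id.
  exact: (Cq _ _ openT _ _ C0 p I).
have n2 : \near x, q (mphi i x) < t0.
  have qx0 : q (mphi i x) = 0.
    by rewrite /q big1 // => b _; rewrite subrr expr0n.
  have : {for x, continuous (q \o mphi i)}.
    by apply: continuous_comp; [exact: mphi_continuous|exact: qc].
  by move=> qm; apply: (qm [set t | t < t0]); rewrite /= qx0; exact: lt_nbhsl.
apply: filterS (filterI n1 n2) => y [Dy qy] /=.
by rewrite /chi asboolT // psi1 // ltW.
Qed.

End Bump.

(* A local frame and its dual coframe, both cut off by a bump function so as to
   be globally defined; [g], the square of the bump function, is equal to 1 near
   the point of interest. *)
Record dual_frame (R : realType) (M : manifold R) (E : vbundle M) (g : M -> R) := DualFrame {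
  fsize : nat;
  fvec : 'I_fsize -> sec E;
  fcov : 'I_fsize -> forall y, E y -> R;
  fcov_linear : forall i y (c : R) (u v : E y),
    fcov i (c *: u + v) = c * fcov i u + fcov i v;
  fcov_smooth : forall i (s : sec E),
    smooth_section (fun y => fcov i (s y) : line M y);
  fdual : forall y (v : E y), \sum_i fcov i v *: fvec i y = g y *: v }.

Arguments fvec {R M E g} d i.
Arguments fcov {R M E g} d i {y} v.
Arguments fcov_linear {R M E g} d i {y} c u v.
Arguments fcov_smooth {R M E g} d i s.
Arguments fdual {R M E g} d {y} v.

Section DualFrame.
Variables (R : realType) (M : manifold R).

Section Extension.
Variables (E : vbundle M) (j : vtriv E) (chi : Cinf M) (Z : set M).
Hypothesis closed_Z : closed Z.
Hypothesis Z_dom : Z `<=` vdom j.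
Hypothesis chi0 : forall y, ~ Z y -> chi y = 0.

Let chi_smooth (W : set M) : open W -> smooth_fun W chi.
Proof.
move=> oW; apply: (smooth_funW oW (@subsetT _ W)).
exact/line_smoothP/(sec_smooth chi).
Qed.

Let off_support (W : set M) (f : M -> R) (y : M) : open W -> W y -> ~ vdom j y ->
  (forall y, ~ Z y -> f y = 0) -> exists2 W', W' y & smooth_fun W' f.
Proof.
move=> oW Wy nD f0; exists (~` Z); first by move=> /Z_dom.
have oZ : open (~` Z) by rewrite openC.
by apply: (smooth_fun_ext oZ _ (smooth_fun_cst oZ 0)) => z /f0.
Qed.

Lemma cutoff_frame_smooth (v : 'rV[R]_(vrank E)) :
  smooth_section (fun y => chi y *: vinv j y v : E y).
Proof.
move=> k c; apply: smooth_fun_local => y Dk.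
have [Dj|nDj] := pselect (vdom j y); last first.
  apply: (off_support (vdom_open k) Dk nDj) => z nZ.
  by rewrite chi0 // scale0r linear0 mxE.
exists (vdom j `&` vdom k) => //.
have o : open (vdom j `&` vdom k) by apply: openI; exact: vdom_open.
apply: (smooth_fun_ext o _ (smooth_funM o (chi_smooth o) (@vtransition _ _ E j k v c))).
by move=> z _; rewrite linearZ mxE.
Qed.

Lemma cutoff_coord_smooth (c : 'I_(vrank E)) (s : sec E) :
  smooth_section (fun y => chi y * vfr j y (s y) 0 c : line M y).
Proof.
apply/line_smoothP; apply: smooth_fun_local => y _.
have [Dj|nDj] := pselect (vdom j y); last first.
  by apply: (off_support openT I nDj) => z nZ; rewrite chi0 // mul0r.
exists (vdom j) => //; have o := vdom_open j.
exact: (smooth_funM o (chi_smooth o) (sec_smooth s j c)).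
Qed.

Lemma cutoff_dual_frame : inhabited (dual_frame E (fun y => chi y ^+ 2)).
Proof.
split; exists (vrank E) (fun i => Sec (cutoff_frame_smooth (delta_mx 0 i)))
  (fun i y v => chi y * vfr j y v 0 i).
- by move=> i y c u v; rewrite linearP !mxE; ring.
- exact: cutoff_coord_smooth.
- move=> y v /=; have [Dy|nDy] := pselect (vdom j y); last first.
    rewrite chi0 => [|/Z_dom//]; rewrite expr0n scale0r big1 // => i _.
    by rewrite mul0r scale0r.
  rewrite -[v in RHS](vfrK Dy) [X in vinv j y X]row_sum_delta linear_sum scaler_sumr.
  apply: eq_bigr => i _; rewrite [in RHS]linearZ /= !scalerA; congr (_ *: _).
  by rewrite expr2 mulrAC.
Qed.

End Extension.

(** One function g serves all the bundles, because a whole element of the graded module will be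
    multiplied by it. This is possible since finitely many trivialization domains have an open
    intersection. *)
Lemma near_dual_frames (n : nat) (E : 'I_n -> vbundle M) (x : M) :
  exists2 g : Cinf M, \near x, g x = 1 & forall z, inhabited (dual_frame (E z) g).
Proof.
pose j z := sval (cid (@vdom_cover _ _ (E z) x)).
have Dj z : vdom (j z) x := svalP (cid (@vdom_cover _ _ (E z) x)).
have [W [oW Wx WD]] : exists W : set M, [/\ open W, W x &
    forall z, z \in enum 'I_n -> W `<=` vdom (j z)].
  elim: (enum 'I_n) => [|z r [W [oW Wx WD]]]; first by exists setT; split=> //; exact: openT.
  exists (W `&` vdom (j z)); split => [||z']; first by apply: openI => //; exact: vdom_open.
    by [].
  by rewrite inE => /predU1P[->|/WD zW] y [] // /zW.
have [chi chi1 [Z [cZ ZW] chi0]] := bump_function oW Wx.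
exists (smul chi chi).
  apply: filterS chi1 => y e; by rewrite -[LHS]/(chi y * chi y : R) e mulr1.
move=> z; have ZD : Z `<=` vdom (j z) by apply: subset_trans ZW (WD z _); rewrite mem_enum.
have [df] := cutoff_dual_frame cZ ZD chi0; split.
exact: df.
Qed.

End DualFrame.

(** * Signed shuffle products and the Chevalley-Eilenberg differential *)

Lemma ptwD (T : Type) (U : zmodType) (f g : T -> U) s : (f + g) s = f s + g s.
Proof. by []. Qed.
Lemma ptwN (T : Type) (U : zmodType) (f : T -> U) s : (- f) s = - f s.
Proof. by []. Qed.

Lemma ptw_sum (T : Type) (U : zmodType) (I : Type) (r : seq I) (F : I -> T -> U) s :
  (\sum_(i <- r) F i) s = \sum_(i <- r) F i s.
Proof. by elim: r => [|i r IH]; rewrite ?big_nil // !big_cons ptwD IH. Qed.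

Section DegSign.
Variables (R : realType) (T : Type) (U : lmodType R).
Implicit Types f g : seq T -> U.

Lemma deg_signE f s : deg_sign f s = if odd (size s) then - f s else f s.
Proof. by rewrite /deg_sign -signr_odd; case: odd; rewrite ?scaleN1r ?scale1r. Qed.

Lemma deg_signK f : deg_sign (deg_sign f) = f.
Proof. by apply/funext => s; rewrite !deg_signE; case: odd; rewrite ?opprK. Qed.

Lemma deg_signD f g : deg_sign (f + g) = deg_sign f + deg_sign g.
Proof. by apply/funext => s; rewrite /deg_sign /= scalerDr. Qed.

Lemma deg_signN f : deg_sign (- f) = - deg_sign f.
Proof. by apply/funext => s; rewrite /deg_sign /= scalerN. Qed.

Lemma deg_sign_cons f u : deg_sign f \o cons u = - deg_sign (f \o cons u).
Proof. by apply/funext => s; rewrite /= /deg_sign /= exprS mulN1r scaleNr. Qed.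

End DegSign.

Section WedgeBiadditive.
Variables (R : realType) (T : Type) (U V W : lmodType R) (mu : U -> V -> W).
Hypothesis muDl : forall u u' v, mu (u + u') v = mu u v + mu u' v.
Hypothesis muDr : forall u v v', mu u (v + v') = mu u v + mu u v'.
Implicit Types (f : seq T -> U) (g : seq T -> V).

Lemma biadd0l v : mu 0 v = 0.
Proof. by apply: (addIr (mu 0 v)); rewrite -muDl !add0r. Qed.
Lemma biadd0r u : mu u 0 = 0.
Proof. by apply: (addIr (mu u 0)); rewrite -muDr !add0r. Qed.
Lemma biaddNl u v : mu (- u) v = - mu u v.
Proof. by apply/eqP; rewrite -addr_eq0 -muDl addNr biadd0l. Qed.
Lemma biaddNr u v : mu u (- v) = - mu u v.
Proof. by apply/eqP; rewrite -addr_eq0 -muDr addNr biadd0r. Qed.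

Lemma wedge_cons f g u :
  wedge_with mu f g \o cons u =
  wedge_with mu (f \o cons u) g + wedge_with mu (deg_sign f) (g \o cons u).
Proof. by []. Qed.

Lemma wedgeDl f f' g :
  wedge_with mu (f + f') g = wedge_with mu f g + wedge_with mu f' g.
Proof.
apply/funext => s; elim: s f f' g => [|u s IH] f f' g /=; first exact: muDl.
by rewrite deg_signD (IH (f \o cons u) (f' \o cons u)) IH /= addrACA.
Qed.

Lemma wedgeDr f g g' :
  wedge_with mu f (g + g') = wedge_with mu f g + wedge_with mu f g'.
Proof.
apply/funext => s; elim: s f g g' => [|u s IH] f g g' /=; first exact: muDr.
by rewrite (IH _ (g \o cons u) (g' \o cons u)) IH /= addrACA.
Qed.

Lemma wedge0l g : wedge_with mu 0 g = 0.
Proof. by apply: (addIr (wedge_with mu 0 g)); rewrite -wedgeDl !add0r. Qed.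
Lemma wedge0r f : wedge_with mu f 0 = 0.
Proof. by apply: (addIr (wedge_with mu f 0)); rewrite -wedgeDr !add0r. Qed.
Lemma wedgeNl f g : wedge_with mu (- f) g = - wedge_with mu f g.
Proof. by apply/eqP; rewrite -addr_eq0 -wedgeDl addNr wedge0l. Qed.
Lemma wedgeNr f g : wedge_with mu f (- g) = - wedge_with mu f g.
Proof. by apply/eqP; rewrite -addr_eq0 -wedgeDr addNr wedge0r. Qed.

(** [deg_sign] is the grading involution, which anticommutes with contraction; the two signs agree
    in each term of the recursion. *)
Lemma deg_sign_wedge f g :
  deg_sign (wedge_with mu f g) = wedge_with mu (deg_sign f) (deg_sign g).
Proof.
apply/funext => s; elim: s f g => [|u s IH] f g.
  by rewrite /= /deg_sign /= !expr0 !scale1r.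
rewrite -[LHS]/((deg_sign (wedge_with mu f g) \o cons u) s) deg_sign_cons wedge_cons.
rewrite deg_signD -[RHS]/((wedge_with mu (deg_sign f) (deg_sign g) \o cons u) s).
rewrite wedge_cons !deg_sign_cons wedgeNl wedgeNr opprD.
by rewrite -[LHS]/(- deg_sign _ s - deg_sign _ s) !IH.
Qed.

Definition cochain0 (X : lmodType R) (v : X) (s : seq T) : X := if s is [::] then v else 0.

Lemma deg_sign_cochain0 (X : lmodType R) (v : X) : deg_sign (cochain0 v) = cochain0 v.
Proof. by apply/funext => -[|a s]; rewrite deg_signE //=; case: ifP; rewrite ?oppr0. Qed.

Lemma cochain0_cons (X : lmodType R) (v : X) a : cochain0 v \o cons a = 0.
Proof. by []. Qed.

Lemma wedge_cochain0l u g s : wedge_with mu (cochain0 u) g s = mu u (g s).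
Proof.
elim: s g => [//|a s IH] g /=.
by rewrite cochain0_cons wedge0l deg_sign_cochain0 IH add0r.
Qed.

Lemma wedge_cochain0r f v s : wedge_with mu f (cochain0 v) s = mu (f s) v.
Proof.
elim: s f => [//|a s IH] f /=.
by rewrite cochain0_cons wedge0r IH addr0.
Qed.

Lemma wedge_degree f g p q s : (forall s, size s != p -> f s = 0) ->
  (forall s, size s != q -> g s = 0) -> size s != (p + q)%N -> wedge_with mu f g s = 0.
Proof.
elim: s p q f g => [|a s IH] p q f g f0 g0 spq /=.
  case: p f0 spq => [|p] f0 spq; last by rewrite f0 // biadd0l.
  by case: q g0 spq => // q g0 _; rewrite g0 // biadd0r.
have sign0 t : size t != p -> deg_sign f t = 0.
  by move=> tp; rewrite deg_signE f0 //; case: odd; rewrite ?oppr0.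
have -> : wedge_with mu (f \o cons a) g s = 0.
  case: p f0 spq {sign0} => [|p] f0 spq; last by apply: (IH p q) => // t tp; exact: f0.
  have -> : f \o cons a = 0 by apply/funext => t; exact: f0.
  by rewrite wedge0l.
rewrite add0r; case: q g0 spq => [|q] g0 spq.
  have -> : g \o cons a = 0 by apply/funext => t; exact: g0.
  by rewrite wedge0r.
by apply: (IH p q) => // [t tq|]; [exact: g0|rewrite addnS in spq].
Qed.

End WedgeBiadditive.

(** A parametricity principle for the recursion defining the product. It serves to compare products
    of sections with products at a point, and to carry parity conditions on values through a
    product. Only [RU] has to respect negation, since the recursion changes the sign of the left
    factor alone. *)
Lemma wedge_rel (R : realType) (T T' : Type) (h : T -> T')
    (U V W U' V' W' : lmodType R)
    (mu : U -> V -> W) (mu' : U' -> V' -> W')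
    (RU : U -> U' -> Prop) (RV : V -> V' -> Prop) (RW : W -> W' -> Prop) :
  (forall u u', RU u u' -> RU (- u) (- u')) ->
  (forall w w' x x', RW w w' -> RW x x' -> RW (w + x) (w' + x')) ->
  (forall u u' v v', RU u u' -> RV v v' -> RW (mu u v) (mu' u' v')) ->
  forall f f' g g', (forall s, RU (f s) (f' (map h s))) ->
    (forall s, RV (g s) (g' (map h s))) ->
  forall s, RW (wedge_with mu f g s) (wedge_with mu' f' g' (map h s)).
Proof.
move=> RUN RWD Rmu f f' g g' + + s.
elim: s f f' g g' => [|a s IH] f f' g g' Rf Rg.
  by apply: Rmu; [exact: (Rf [::])|exact: (Rg [::])].
apply: RWD; apply: IH => // t; [exact: (Rf (a :: t))| |exact: (Rg (a :: t))].
by rewrite !deg_signE size_map; case: odd => //; exact: RUN.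
Qed.

Lemma wedge_map (R : realType) (T : Type) (U V W U' V' W' : lmodType R)
    (mu : U -> V -> W) (mu' : U' -> V' -> W')
    (FU : U -> U') (FV : V -> V') (FW : W -> W') :
  (forall u, FU (- u) = - FU u) -> (forall w x, FW (w + x) = FW w + FW x) ->
  (forall u v, FW (mu u v) = mu' (FU u) (FV v)) ->
  forall f g (s : seq T),
    FW (wedge_with mu f g s) = wedge_with mu' (FU \o f) (FV \o g) s.
Proof.
move=> FUN FWD Fmu f g s; rewrite -[in RHS](map_id s).
apply: (@wedge_rel R T T id _ _ _ _ _ _ mu mu' (fun u u' => u' = FU u)
  (fun v v' => v' = FV v) (fun w w' => FW w = w')) => //.
- by move=> u _ ->; rewrite FUN.
- by move=> w _ x _ <- <-.
- by move=> u _ v _ -> ->.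
- by move=> t; rewrite map_id.
- by move=> t; rewrite map_id.
Qed.

(** Contracted with a, both sides become i_a f g h + f' i_a g h + f' g' i_a h, where the prime is
    [deg_sign]. Four pairings are allowed because functions, operators and sections occur in the
    same product. *)
Lemma wedgeA (R : realType) (T : Type) (U V W X Y Z : lmodType R)
    (m1 : U -> V -> X) (m2 : X -> W -> Z) (m3 : V -> W -> Y) (m4 : U -> Y -> Z) :
  (forall u u' v, m1 (u + u') v = m1 u v + m1 u' v) ->
  (forall u v v', m1 u (v + v') = m1 u v + m1 u v') ->
  (forall u u' v, m2 (u + u') v = m2 u v + m2 u' v) ->
  (forall u v v', m4 u (v + v') = m4 u v + m4 u v') ->
  (forall u v w, m2 (m1 u v) w = m4 u (m3 v w)) ->
  forall (f : seq T -> U) g h,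
  wedge_with m2 (wedge_with m1 f g) h = wedge_with m4 f (wedge_with m3 g h).
Proof.
move=> m1Dl m1Dr m2D m4D mA f g h; apply/funext => s.
elim: s f g h => [|a s IH] f g h; first exact: mA.
rewrite /= !wedge_cons wedgeDl // wedgeDr // deg_sign_wedge //.
by rewrite !ptwD -!IH addrA.
Qed.

Section WedgeC.
Variables (R : realType) (T : Type) (U V W : lmodType R) (mu : U -> V -> W).
Hypothesis muDl : forall u u' v, mu (u + u') v = mu u v + mu u' v.
Hypothesis muDr : forall u v v', mu u (v + v') = mu u v + mu u v'.

Let um v u := mu u v.

(** The hypothesis says that f has only components whose degree has parity b; the Koszul sign
    (-1)^(deg f deg g) then reduces to a [deg_sign] on g. *)
Lemma wedgeC (f : seq T -> U) (g : seq T -> V) (b : bool) :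
  deg_sign f = (if b then - f else f) ->
  wedge_with mu f g = wedge_with um (if b then deg_sign g else g) f.
Proof.
move=> fb; apply/funext => s; elim: s b f g fb => [|a s IH] b f g fb /=.
  by case: b {fb}; rewrite ?deg_signE.
have fab : deg_sign (f \o cons a) = (if ~~ b then - (f \o cons a) else f \o cons a).
  apply: oppr_inj; rewrite -deg_sign_cons fb; case: b {fb} => //=.
  by rewrite opprK.
rewrite (IH (~~ b)) // fb; case: b fb fab => /= fb fab.
  rewrite deg_sign_cons deg_signK.
  rewrite (wedgeNl muDl) (wedgeNl (mu := um)) => [|u u' v]; last exact: muDr.
  by rewrite addrC; congr (_ + _); congr (- _); rewrite (IH true).
by rewrite (IH false) // addrC.
Qed.

End WedgeC.

(* Chevalley-Eilenberg differential of cochains on [T] with bracket [br] and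
   coefficients in [V], defined by Cartan's formula i_a d = L_a - d i_a. The
   action [act] of [T] on [V] need not be flat. *)
Section Cartan.
Variables (R : realType) (T : Type) (br : T -> T -> T) (V : lmodType R).
Variable act : T -> V -> V.
Implicit Types f g : seq T -> V.

(** The recursion is the relation i_b L_a = L_a i_b - i_[a,b]. *)
Fixpoint lie_der (a : T) (f : seq T -> V) (s : seq T) : V :=
  if s is b :: s' then lie_der a (f \o cons b) s' - f (br a b :: s')
  else act a (f [::]).

Fixpoint ce_diff (f : seq T -> V) (s : seq T) : V :=
  if s is a :: s' then lie_der a f s' - ce_diff (f \o cons a) s' else 0.

Lemma lie_der_cons a f b :
  lie_der a f \o cons b = lie_der a (f \o cons b) - (f \o cons (br a b)).
Proof. by []. Qed.

Lemma ce_diff_cons f a : ce_diff f \o cons a = lie_der a f - ce_diff (f \o cons a).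
Proof. by []. Qed.

Hypothesis actD : forall a u v, act a (u + v) = act a u + act a v.

Lemma act_zero a : act a 0 = 0.
Proof. by apply: (addIr (act a 0)); rewrite -actD !add0r. Qed.

Lemma lie_derD a f g : lie_der a (f + g) = lie_der a f + lie_der a g.
Proof.
apply/funext => s; elim: s f g => [|b s IH] f g /=; first exact: actD.
rewrite (IH (f \o cons b) (g \o cons b)) !ptwD /= opprD.
by rewrite -!addrA; congr (_ + _); rewrite addrCA.
Qed.

Lemma lie_der0 a : lie_der a 0 = 0.
Proof. by apply: (addIr (lie_der a 0)); rewrite -lie_derD !add0r. Qed.
Lemma lie_derN a f : lie_der a (- f) = - lie_der a f.
Proof. by apply/eqP; rewrite -addr_eq0 -lie_derD addNr lie_der0. Qed.

Lemma ce_diffD f g : ce_diff (f + g) = ce_diff f + ce_diff g.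
Proof.
apply/funext => s; elim: s f g => [|b s IH] f g /=; first by rewrite ptwD /= addr0.
rewrite (IH (f \o cons b) (g \o cons b)) lie_derD !ptwD /= opprD.
by rewrite -!addrA; congr (_ + _); rewrite addrCA.
Qed.

Lemma ce_diff0 : ce_diff 0 = 0.
Proof. by apply: (addIr (ce_diff 0)); rewrite -ce_diffD !add0r. Qed.
Lemma ce_diffN f : ce_diff (- f) = - ce_diff f.
Proof. by apply/eqP; rewrite -addr_eq0 -ce_diffD addNr ce_diff0. Qed.
Lemma ce_diffB f g : ce_diff (f - g) = ce_diff f - ce_diff g.
Proof. by rewrite ce_diffD ce_diffN. Qed.

Lemma lie_der_sign a f : lie_der a (deg_sign f) = deg_sign (lie_der a f).
Proof.
apply/funext => s; elim: s f => [|b s IH] f; first by rewrite deg_signE /= deg_signE.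
rewrite -[RHS]/((deg_sign (lie_der a f) \o cons b) s) deg_sign_cons lie_der_cons.
rewrite -[LHS]/((lie_der a (deg_sign f) \o cons b) s) lie_der_cons !deg_sign_cons.
by rewrite deg_signD deg_signN lie_derN ptwD !ptwN ptwD ptwN IH opprD.
Qed.

Lemma ce_diff_sign f : ce_diff (deg_sign f) = - deg_sign (ce_diff f).
Proof.
apply/funext => s; elim: s f => [|a s IH] f; first by rewrite ptwN deg_signE oppr0.
rewrite -[RHS]/(- (deg_sign (ce_diff f) \o cons a) s) deg_sign_cons ce_diff_cons.
rewrite -[LHS]/((ce_diff (deg_sign f) \o cons a) s) ce_diff_cons deg_sign_cons.
rewrite deg_signD deg_signN ce_diffN lie_der_sign !ptwD !ptwN IH ptwN !ptwD !ptwN.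
by rewrite !opprK.
Qed.

Lemma lie_der_degree a f s m : (forall s, size s != m -> f s = 0) ->
  size s != m -> lie_der a f s = 0.
Proof.
elim: s m f => [|b s IH] m f f0 sm /=; first by rewrite f0 // act_zero.
rewrite f0 // subr0; case: m sm f0 => [|m] sm f0; last by apply: (IH m) => // t tm; exact: f0.
have -> : f \o cons b = 0 by apply/funext => t; exact: f0.
by rewrite lie_der0.
Qed.

Lemma ce_diff_degree f s m : (forall s, size s != m -> f s = 0) ->
  size s != m.+1 -> ce_diff f s = 0.
Proof.
elim: s m f => [|b s IH] m f f0 sm //=.
rewrite (lie_der_degree _ (m := m)) // sub0r; case: m sm f0 => [|m] sm f0.
  have -> : f \o cons b = 0 by apply/funext => t; exact: f0.
  by rewrite ce_diff0 oppr0.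
by rewrite (IH m) ?oppr0 // => t tm; exact: f0.
Qed.

Lemma lie_der_at a f s : (forall t, size t = size s -> f t = 0) -> lie_der a f s = 0.
Proof.
elim: s f => [|b s IH] f f0 /=; first by rewrite f0 // act_zero.
by rewrite f0 // subr0; apply: IH => t ts; apply: f0; rewrite /= ts.
Qed.

(** The component of df in one degree depends only on the component of f one degree below, for f of
    mixed degree. This allows a primitive to be truncated. *)
Lemma ce_diff_at f s : (forall t, (size t).+1 = size s -> f t = 0) -> ce_diff f s = 0.
Proof.
elim: s f => [|b s IH] f f0 //=.
rewrite lie_der_at => [|t ts]; last by apply: f0; rewrite /= ts.
rewrite sub0r IH ?oppr0 // => t ts.
by apply: f0; rewrite /= ts.
Qed.

Lemma ce_diff_cochain0 v s :
  ce_diff (cochain0 v) s = if s is [:: a] then act a v else 0.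
Proof.
have lie0 a t : t <> [::] -> lie_der a (cochain0 v) t = 0.
  by case: t => // b t _ /=; rewrite cochain0_cons lie_der0 subr0.
case: s => [//|a s] /=; rewrite cochain0_cons ce_diff0 subr0.
by case: s => // b s; exact: lie0.
Qed.

End Cartan.

Section CartanLeibniz.
Variables (R : realType) (T : Type) (br : T -> T -> T) (U V W : lmodType R).
Variables (aU : T -> U -> U) (aV : T -> V -> V) (aW : T -> W -> W).
Variable mu : U -> V -> W.
Hypothesis muDl : forall u u' v, mu (u + u') v = mu u v + mu u' v.
Hypothesis muDr : forall u v v', mu u (v + v') = mu u v + mu u v'.
Hypothesis aUD : forall a u v, aU a (u + v) = aU a u + aU a v.
Hypothesis aVD : forall a u v, aV a (u + v) = aV a u + aV a v.
Hypothesis aWD : forall a u v, aW a (u + v) = aW a u + aW a v.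
Hypothesis aM : forall a u v, aW a (mu u v) = mu (aU a u) v + mu u (aV a v).

Lemma lie_der_wedge a (f : seq T -> U) (g : seq T -> V) :
  lie_der br aW a (wedge_with mu f g) =
  wedge_with mu (lie_der br aU a f) g + wedge_with mu f (lie_der br aV a g).
Proof.
apply/funext => s; elim: s f g => [|b s IH] f g /=; first exact: aM.
rewrite -[RHS]/((wedge_with mu (lie_der br aU a f) g \o cons b) s +
  (wedge_with mu f (lie_der br aV a g) \o cons b) s).
rewrite !wedge_cons !lie_der_cons lie_derD // ptwD !IH lie_der_sign //.
rewrite (wedgeDl muDl) (wedgeNl muDl) (wedgeDr muDr) (wedgeNr muDr).
rewrite !ptwD !ptwN opprD.
by rewrite [LHS](AC (2*2*2) ((1*5*3)*(2*(4*6)))).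
Qed.

(** Cartan's formula reduces the claim to the two Leibniz rules for contraction and for the Lie
    derivative; [deg_sign] commutes with L_a and anticommutes with i_a and d. *)
Lemma ce_diff_wedge (f : seq T -> U) (g : seq T -> V) :
  ce_diff br aW (wedge_with mu f g) =
  wedge_with mu (ce_diff br aU f) g + wedge_with mu (deg_sign f) (ce_diff br aV g).
Proof.
apply/funext => s; elim: s f g => [|a s IH] f g /=.
  by rewrite ptwD /= (biadd0l muDl) (biadd0r muDr) addr0.
rewrite -[RHS]/((wedge_with mu (ce_diff br aU f) g \o cons a) s +
  (wedge_with mu (deg_sign f) (ce_diff br aV g) \o cons a) s).
rewrite !wedge_cons !ce_diff_cons ce_diffD // ptwD !IH lie_der_wedge.
rewrite deg_sign_cons deg_signK (wedgeNl muDl) ce_diff_sign // (wedgeNl muDl).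
rewrite (wedgeDl muDl) (wedgeNl muDl) (wedgeDr muDr) (wedgeNr muDr).
rewrite !ptwD !ptwN !opprD !opprK.
by rewrite [LHS](AC (2*(2*2)) ((1*3*5)*(4*(2*6)))).
Qed.

End CartanLeibniz.

(** A change of coefficients that intertwines the actions commutes with d. The traces and the parity
    operator are used in this way. *)
Lemma ce_diff_map (R : realType) (T : Type) (br : T -> T -> T) (V W : lmodType R)
    (aV : T -> V -> V) (aW : T -> W -> W) (F : V -> W) :
  (forall u v, F (u + v) = F u + F v) -> (forall a v, F (aV a v) = aW a (F v)) ->
  forall f, F \o ce_diff br aV f = ce_diff br aW (F \o f).
Proof.
move=> FD Fa f.
have F0 : F 0 = 0 by apply: (addIr (F 0)); rewrite -FD !add0r.
have FN u : F (- u) = - F u by apply/eqP; rewrite -addr_eq0 -FD addNr F0.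
have FL a g s : F (lie_der br aV a g s) = lie_der br aW a (F \o g) s.
  by elim: s g => [|b s IH] g /=; rewrite ?Fa // FD FN IH.
by apply/funext => s /=; elim: s f => [|a s IH] f //=; rewrite FD FN FL IH.
Qed.

(** * Transgression in an abstract algebra with a graded derivation *)

(* Sequences [nat -> K] are the coefficients of power series in a central
   variable t, and [shift] is multiplication by t. The curvature of
   delta + t [theta, -] is R_t = Rc + t delta(theta) + t^2 theta^2; it is
   covariantly constant, and its t-derivative is the covariant derivative of
   theta. *)
Section Transgression.
Variables (K : zmodType) (m : K -> K -> K) (par delta : K -> K) (Rc theta : K).
Hypothesis mDl : forall x y z, m (x + y) z = m x z + m y z.
Hypothesis mDr : forall x y z, m x (y + z) = m x y + m x z.
Hypothesis mA : forall x y z, m x (m y z) = m (m x y) z.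
Hypothesis parD : forall x y, par (x + y) = par x + par y.
Hypothesis parM : forall x y, par (m x y) = m (par x) (par y).
Hypothesis deltaD : forall x y, delta (x + y) = delta x + delta y.
Hypothesis deltaM : forall x y, delta (m x y) = m (delta x) y + m (par x) (delta y).
Hypothesis par_curv : par Rc = Rc.
Hypothesis par_theta : par theta = - theta.
Hypothesis bianchi : delta Rc = 0.
Variables (a b : K).
Hypothesis aE : a = m theta theta.
Hypothesis bE : b = delta theta.
Hypothesis flat : Rc + b + a = 0.
Implicit Types (x y : K) (c : nat -> K).

Let m0l x : m 0 x = 0. Proof. by apply: (addIr (m 0 x)); rewrite -mDl !add0r. Qed.
Let m0r x : m x 0 = 0. Proof. by apply: (addIr (m x 0)); rewrite -mDr !add0r. Qed.
Let mNl x y : m (- x) y = - m x y.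
Proof. by apply/eqP; rewrite -addr_eq0 -mDl addNr m0l. Qed.
Let mNr x y : m x (- y) = - m x y.
Proof. by apply/eqP; rewrite -addr_eq0 -mDr addNr m0r. Qed.
Let par0 : par 0 = 0. Proof. by apply: (addIr (par 0)); rewrite -parD !add0r. Qed.
Let parN x : par (- x) = - par x.
Proof. by apply/eqP; rewrite -addr_eq0 -parD addNr par0. Qed.
Let delta0 : delta 0 = 0.
Proof. by apply: (addIr (delta 0)); rewrite -deltaD !add0r. Qed.
Let deltaN x : delta (- x) = - delta x.
Proof. by apply/eqP; rewrite -addr_eq0 -deltaD addNr delta0. Qed.

Let par_a : par a = a. Proof. by rewrite aE parM par_theta mNl mNr opprK. Qed.
Let bE' : b = - Rc - a. Proof. by apply/eqP; rewrite -subr_eq0 opprD !opprK addrCA addrA flat. Qed.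
Let par_b : par b = b. Proof. by rewrite bE' parD !parN par_curv par_a. Qed.
Let delta_a : delta a = m b theta - m theta b.
Proof. by rewrite aE deltaM par_theta mNl bE. Qed.
(** This is delta^2 theta = [Rc, theta]. It is extracted from flatness rather than from a general
    formula for delta^2: in b = - Rc - theta^2 the Bianchi identity kills the first term, and the
    derivation rule computes the second. *)
Let delta_b : delta b = m Rc theta - m theta Rc.
Proof.
rewrite {1}bE' deltaD !deltaN bianchi oppr0 add0r delta_a bE' !(mDl, mDr, mNl, mNr) opprD !opprK.
by rewrite aE mA !opprD !opprK addrACA subrr addr0.
Qed.

Definition shift c (k : nat) : K := if k is k'.+1 then c k' else 0.

Let lm x c k := m x (c k).
Let Dt c := (delta \o c) + shift (lm theta c - (fun k => m (par (c k)) theta)).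

Definition mul_curv c := lm Rc c + shift (lm b c) + shift (shift (lm a c)).

Let shiftD c c' : shift (c + c') = shift c + shift c'.
Proof. by apply/funext => -[|k] //=; rewrite ptwD addr0. Qed.

Let Dt_shift c : Dt (shift c) = shift (Dt c).
Proof.
apply/funext => -[|[|k]]; rewrite /Dt ?ptwD ?ptwN /= ?delta0 ?addr0 //.
by rewrite ptwD ptwN /lm /= par0 m0l m0r subr0.
Qed.

Let DtD c c' : Dt (c + c') = Dt c + Dt c'.
Proof.
apply/funext => -[|k]; rewrite /Dt !ptwD /= deltaD ?addr0 //.
rewrite !ptwD !ptwN /lm !ptwD mDr parD mDl opprD.
by rewrite [LHS](AC (2*(2*2)) ((1*(3*5))*(2*(4*6)))).
Qed.

Let Dt_lm x c : par x = x ->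
  Dt (lm x c) = lm x (Dt c) + lm (delta x) c + shift (lm (m theta x - m x theta) c).
Proof.
move=> px; apply/funext => -[|k]; rewrite /Dt /lm !ptwD /= deltaM px ?addr0.
  by rewrite addrC.
rewrite !ptwD !ptwN parM px mDr mDr mNr mDl mNl !mA.
rewrite [LHS](AC (2*2) ((2*(1*(3*4))))) [RHS](AC ((1*2)*1*2) ((1*(4*(5*(3*(2*6))))))).
by rewrite /= subrr addr0.
Qed.

Let lmNx x c : lm (- x) c = - lm x c.
Proof. by apply/funext => k; exact: mNl. Qed.
Let lm0 c : lm 0 c = 0.
Proof. by apply/funext => k; exact: m0l. Qed.
Let shift0 : shift 0 = 0.
Proof. by apply/funext => -[]. Qed.
Let shiftN c : shift (- c) = - shift c.
Proof. by apply/funext => -[|k] //=; rewrite ptwN oppr0. Qed.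

(** This is D_t R_t = 0. By powers of t it reads delta Rc = 0, delta b + [theta, Rc] = 0, delta a +
    [theta, b] = 0 and [theta, a] = 0. *)
Let Dt_curv c : Dt (mul_curv c) = mul_curv (Dt c).
Proof.
rewrite /mul_curv !DtD !Dt_shift !Dt_lm // bianchi delta_b delta_a.
have -> : m theta a - m a theta = 0 by rewrite aE mA subrr.
rewrite -[m Rc theta - _]opprB -[m b theta - _]opprB !lmNx !lm0 !(shiftD, shiftN, shift0).
rewrite !addr0 -!addrA; congr (_ + _).
by rewrite addrCA addNKr; congr (_ + _); rewrite addrCA subrr addr0.
Qed.

(** The coefficients of R_t^(l+1); the recursion starts at R_t itself, as K comes without a unit. *)
Fixpoint curv_pow (l : nat) : nat -> K :=
  if l is l'.+1 then mul_curv (curv_pow l')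
  else fun k => match k with 0 => Rc | 1 => b | 2 => a | _ => 0 end.

(** The coefficients of the sum of R_t^i theta R_t^(l-i) over i <= l, built by T_(l+1) = R_t T_l +
    theta R_t^(l+1). *)
Fixpoint transgressor (l : nat) : nat -> K :=
  if l is l'.+1 then mul_curv (transgressor l') + lm theta (curv_pow l')
  else fun k => if k is 0 then theta else 0.

Let par_curv_pow l k : par (curv_pow l k) = curv_pow l k.
Proof.
elim: l k => [|l IH] k /=; first by case: k => [|[|[|k]]].
rewrite /mul_curv /lm; case: k => [|[|k]]; rewrite !ptwD /= !parD !parM ?par0.
- by rewrite par_curv IH.
- by rewrite par_curv par_b !IH.
- by rewrite par_curv par_b par_a !IH.
Qed.

Lemma par_transgressor l k : par (transgressor l k) = - transgressor l k.
Proof.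
elim: l k => [|l IH] k /=; first by case: k => [|k]; rewrite ?par0 ?oppr0.
rewrite /mul_curv /lm; case: k => [|[|k]]; rewrite !ptwD /= !parD !parM ?par0.
- by rewrite par_curv IH par_theta par_curv_pow mNr mNl !opprD oppr0.
- by rewrite par_curv par_b !IH par_theta par_curv_pow !mNr mNl !opprD oppr0.
- by rewrite par_curv par_b par_a !IH par_theta par_curv_pow !mNr mNl !opprD.
Qed.

Let Dt_curv_pow l : Dt (curv_pow l) = 0.
Proof.
elim: l => [|l IH] /=; last first.
  by rewrite Dt_curv IH; apply/funext => -[|[|k]]; rewrite /mul_curv !ptwD /lm /= ?m0r !addr0.
apply/funext => -[|[|[|[|k]]]]; rewrite /Dt ptwD /=.
- by rewrite bianchi addr0.
- by rewrite delta_b ptwD ptwN /lm par_curv addrA subrK subrr.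
- by rewrite delta_a ptwD ptwN /lm par_b addrA subrK subrr.
- by rewrite delta0 ptwD ptwN /lm par_a add0r aE mA subrr.
- by rewrite delta0 ptwD ptwN /lm par0 m0l m0r subrr addr0.
Qed.

Let deriv c k := c k.+1 *+ k.+1.

Let derivD c c' : deriv (c + c') = deriv c + deriv c'.
Proof. by apply/funext => k; rewrite /deriv !ptwD mulrnDl. Qed.
Let deriv_shift c : deriv (shift c) = c + shift (deriv c).
Proof. by apply/funext => -[|k]; rewrite ptwD /deriv //= ?mulr1n ?addr0 // mulrS. Qed.
Let deriv_lm x c : deriv (lm x c) = lm x (deriv c).
Proof.
have mMn y j : m x y *+ j = m x (y *+ j).
  by elim: j => [|j IH]; rewrite ?mulr0n ?m0r // !mulrS mDr IH.
by apply/funext => k; exact: mMn.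
Qed.

(** D_t theta = b + 2 t a is the derivative of R_t, and D_t kills R_t; so D_t replaces theta by the
    derivative of R_t in every term of the transgressor. *)
Lemma deriv_curv_pow l : deriv (curv_pow l) = Dt (transgressor l).
Proof.
elim: l => [|l IH].
  apply/funext => -[|[|k]]; rewrite /deriv /Dt ptwD /=.
  - by rewrite addr0 mulr1n bE.
  - by rewrite delta0 add0r ptwD ptwN /lm par_theta mNl opprK mulr2n aE.
  - by rewrite delta0 ptwD ptwN /lm par0 m0l m0r subrr addr0 mul0rn.
rewrite /= DtD Dt_curv -IH.
have -> : Dt (lm theta (curv_pow l)) = lm b (curv_pow l) + shift (lm a (curv_pow l)) *+ 2.
  have <- : Dt (lm theta (curv_pow l)) + lm theta (Dt (curv_pow l)) =
      lm b (curv_pow l) + shift (lm a (curv_pow l)) *+ 2.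
    apply/funext => -[|k]; rewrite /Dt mulr2n !ptwD /lm /= deltaM par_theta mNl -bE.
      by rewrite ptwD /= !addr0 subrK.
    rewrite !ptwD !ptwN parM par_theta !par_curv_pow mDr mDr mNr !mNl opprK !mA -aE.
    by rewrite [LHS](AC ((2*2)*(1*2)) (1*(3*6)*((2*5)*(4*7)))) /= addNr par_curv_pow add0r subrr addr0.
  by rewrite Dt_curv_pow; apply/funext => k; rewrite ptwD /lm m0r addr0.
rewrite /mul_curv !derivD !deriv_shift !deriv_lm !shiftD mulr2n.
by rewrite [LHS](AC ((1*2)*(1*2)) ((1*3*6)*(2*(4*5)))).
Qed.

(** The previous identity read off at t^k. As the transgressor is odd, its graded commutator with
    theta is an anticommutator. *)
Lemma curv_pow_deriv l k :
  curv_pow l k.+1 *+ k.+1 = delta (transgressor l k) +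
  (m theta (shift (transgressor l) k) + m (shift (transgressor l) k) theta).
Proof.
have /(congr1 (@^~ k)) := deriv_curv_pow l.
rewrite /deriv /Dt ptwD => ->; congr (_ + _).
case: k => [|k] /=; first by rewrite m0l m0r addr0.
by rewrite ptwD ptwN par_transgressor mNl opprK.
Qed.

Lemma curv_pow0 l : curv_pow l 0 = iter l (m Rc) Rc.
Proof. by elim: l => //= l IH; rewrite /mul_curv !ptwD /= !addr0 /lm IH. Qed.

(** The coefficients add up to R_1^(l+1), which is 0 because R_1 = Rc + b + a. The polynomial has
    degree 2 l + 2 in t, whence the bound. *)
Lemma curv_pow_sum l : curv_pow l 0 = - \sum_(k < l.*2.+2) curv_pow l k.+1.
Proof.
apply/eqP; rewrite -addr_eq0 -(big_ord_recl l.*2.+2 (fun k : 'I_l.*2.+3 => curv_pow l k)).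
suff H N : (l.*2.+3 <= N)%N -> \sum_(k < N) curv_pow l k = 0 by rewrite H.
elim: l N => [|l IH] [|[|[|N]]] // lN.
  rewrite !big_ord_recl /= big1 // addr0 addrA; exact: flat.
have {}IH j : (l.*2.+3 <= j)%N -> forall x, \sum_(k < j) m x (curv_pow l k) = 0.
  move=> lj x; transitivity (m x (\sum_(k < j) curv_pow l k)); last by rewrite IH.
  by elim/big_rec2: _ => [|k y z _ ->]; rewrite ?m0r ?mDr.
have lN' : (l.*2.+3 <= N.+1)%N by rewrite doubleS in lN.
rewrite /= /mul_curv; under eq_bigr do rewrite !ptwD.
rewrite !big_split /= IH; last exact: leqW (leqW lN').
have sum_shift c j : \sum_(k < j.+1) shift c k = \sum_(k < j) c k.
  by rewrite big_ord_recl /= add0r.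
by rewrite !sum_shift !IH ?addr0 //; exact: leqW.
Qed.

(** K will consist of all functions on lists of sections, and [S] will single out the alternating
    multilinear ones. For b = delta theta, membership comes from b = - Rc - theta^2, so nothing is
    asked about delta and [S]. *)
Lemma transgressor_closed (S : K -> Prop) l k :
  S 0 -> (forall x y, S x -> S y -> S (x + y)) -> (forall x, S x -> S (- x)) ->
  (forall x y, S x -> S y -> S (m x y)) -> S Rc -> S theta -> S (transgressor l k).
Proof.
move=> S0 SD SN SM SR St.
have Sa : S a by rewrite aE; exact: SM.
have Sb : S b by rewrite bE'; apply: SD; exact: SN.
have Ssh c j : (forall j, S (c j)) -> S (shift c j) by move=> Sc; case: j => [|j] /=.
have Scurv c j : (forall j, S (c j)) -> S (mul_curv c j).
  move=> Sc; rewrite /mul_curv !ptwD; apply: (SD); first apply: (SD).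
  - exact: SM.
  - by refine (Ssh _ _ _) => i; exact: SM.
  - by apply: (Ssh) => i; apply: (Ssh) => i'; exact: SM.
have Sp j i : S (curv_pow j i).
  by elim: j i => [|j IH] i /=; [case: i => [|[|[|i]]]|exact: Scurv].
elim: l k => [|l IH] k /=; first by case: k.
by rewrite ptwD; apply: (SD); [exact: Scurv|exact: SM].
Qed.

(** Integration over [0, 1] would divide by k + 1; as K is only an abelian group, the multiple stays
    on the left. *)
Lemma transgression l : exists2 Q : nat -> K,
  iter l (m Rc) Rc = - \sum_(k < l.*2.+2) Q k &
  exists U V : nat -> K, [/\ forall k, Q k *+ k.+1 = delta (U k) + (m theta (V k) + m (V k) theta),
    forall k, par (V k) = - V k, forall k, par (U k) = - U k &
    forall S : K -> Prop, S 0 -> (forall x y, S x -> S y -> S (x + y)) ->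
      (forall x, S x -> S (- x)) -> (forall x y, S x -> S y -> S (m x y)) ->
      S Rc -> S theta -> forall k, S (U k) /\ S (V k)].
Proof.
exists (fun k => curv_pow l k.+1); first by rewrite -curv_pow0 curv_pow_sum.
exists (transgressor l), (shift (transgressor l)); split.
- exact: curv_pow_deriv.
- by case=> [|k] /=; rewrite ?par0 ?oppr0 ?par_transgressor.
- exact: par_transgressor.
- move=> S S0 SD SN SM SR St k; split; first exact: transgressor_closed.
  by case: k => [|k] //=; exact: transgressor_closed.
Qed.

End Transgression.

(** * Forms as cochains on sections *)

Section Smul.
Variables (R : realType) (M : manifold R) (E : vbundle M).
Implicit Types (f g : Cinf M) (s t : sec E).

Lemma smulDl f g s : smul (f + g) s = smul f s + smul g s.
Proof. by apply: sec_eq => x; exact: scalerDl. Qed.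
Lemma smulDr f s t : smul f (s + t) = smul f s + smul f t.
Proof. by apply: sec_eq => x; exact: scalerDr. Qed.
Lemma smulA f g s : smul f (smul g s) = smul (smul f g) s.
Proof. by apply: sec_eq => x; exact: scalerA. Qed.
Lemma smul0l s : smul 0 s = 0.
Proof. by apply: sec_eq => x; exact: scale0r. Qed.
Lemma smul0r f : smul f (0 : sec E) = 0.
Proof. by apply: sec_eq => x; exact: scaler0. Qed.
Lemma smulNl f s : smul (- f) s = - smul f s.
Proof. by apply/eqP; rewrite -addr_eq0 -smulDl addNr smul0l. Qed.
Lemma smulNr f s : smul f (- s) = - smul f s.
Proof. by apply/eqP; rewrite -addr_eq0 -smulDr addNr smul0r. Qed.
Lemma smulZr f (k : R) s : smul f (k *: s) = k *: smul f s.
Proof. by apply: sec_eq => x /=; rewrite !scalerA mulrC. Qed.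
Lemma smul_sumr f (I : Type) (r : seq I) (F : I -> sec E) :
  smul f (\sum_(i <- r) F i) = \sum_(i <- r) smul f (F i).
Proof.
elim: r => [|i r IH]; first by rewrite !big_nil smul0r.
by rewrite !big_cons smulDr IH.
Qed.

Lemma cst_smooth (c : R) : smooth_section (fun x => c : line M x).
Proof. by apply/line_smoothP; apply: smooth_fun_cst; exact: openT. Qed.
Definition cinf_cst (c : R) : Cinf M := Sec (cst_smooth c).

Lemma smul_cst c s : smul (cinf_cst c) s = c *: s.
Proof. exact: sec_eq. Qed.

Lemma sec_sumE (I : Type) (r : seq I) (F : I -> sec E) x :
  (\sum_(i <- r) F i) x = \sum_(i <- r) F i x.
Proof. by elim: r => [|i r IH]; rewrite ?big_nil // !big_cons -IH. Qed.

End Smul.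

Lemma smulC (R : realType) (M : manifold R) (f g : Cinf M) : smul f g = smul g f.
Proof. by apply: sec_eq => x; exact: mulrC. Qed.

Section Frames.
Variables (R : realType) (M : manifold R) (E : vbundle M).

Lemma dual_frame_exists (x : M) :
  exists2 g : Cinf M, \near x, g x = 1 & inhabited (dual_frame E g).
Proof.
have [g gx dfs] := near_dual_frames (fun _ : 'I_1 => E) x.
by exists g => //; exact: dfs ord0.
Qed.

Lemma near_at (T : topologicalType) (P : T -> Prop) x : (\near x, P x) -> P x.
Proof. exact: nbhs_singleton. Qed.

(** A cut-off frame is globally defined, so its combinations with constant coefficients already
    realize every vector over x. *)
Lemma sec_through_exists (x : M) (v : E x) : exists s : sec E, s x = v.
Proof.
have [g /near_at gx [df]] := dual_frame_exists x.
exists (\sum_i fcov df i v *: fvec df i).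
rewrite sec_sumE -[RHS]scale1r -gx -(fdual df v).
by apply: eq_bigr.
Qed.

Definition sec_through (x : M) (v : E x) : sec E := sval (cid (sec_through_exists v)).
Lemma sec_throughE (x : M) (v : E x) : sec_through v x = v.
Proof. exact: svalP (cid (sec_through_exists v)). Qed.

Definition fcovs (g : M -> R) (df : dual_frame E g) i (s : sec E) : Cinf M :=
  Sec (fcov_smooth df i s).
Arguments fcovs {g} df i s.

Lemma fcovsD (g : M -> R) (df : dual_frame E g) i (s t : sec E) :
  fcovs df i (s + t) = fcovs df i s + fcovs df i t.
Proof.
apply: sec_eq => x /=; have := fcov_linear df i 1 (s x) (t x).
by rewrite scale1r mul1r.
Qed.

Lemma fcovs_smul (g : M -> R) (df : dual_frame E g) i (f : Cinf M) (s : sec E) :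
  fcovs df i (smul f s) = smul f (fcovs df i s).
Proof.
have f0 : fcovs df i 0 = 0 by apply: (addIr (fcovs df i 0)); rewrite -fcovsD !add0r.
apply: sec_eq => x; have := fcov_linear df i (f x) (s x) 0; rewrite addr0.
by have /= -> := congr1 (fun u : Cinf M => u x) f0; rewrite addr0.
Qed.

Lemma fdual_sec (g : Cinf M) (df : dual_frame E g) (s : sec E) :
  \sum_i smul (fcovs df i s) (fvec df i) = smul g s.
Proof. by apply: sec_eq => x; rewrite sec_sumE; exact: fdual. Qed.

(** Since g s is the sum of phi_i(s) u_i over a cut-off dual frame and g is 1 at x, P s at x is the
    sum of phi_i(s x) P(u_i)(x), where s enters only through its value at x. *)
Lemma Clinear_ptw (F : vbundle M) (P : sec E -> sec F) x (s t : sec E) :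
  (forall s t : sec E, P (s + t) = P s + P t) ->
  (forall f (s : sec E), P (smul f s) = smul f (P s)) ->
  s x = t x -> P s x = P t x.
Proof.
move=> PD PZ st; have [g /near_at gx [df]] := dual_frame_exists x.
have P0 : P 0 = 0 by apply: (addIr (P 0)); rewrite -PD !add0r.
have Psum (I : Type) (r : seq I) (G : I -> sec E) :
    P (\sum_(i <- r) G i) = \sum_(i <- r) P (G i).
  by elim: r => [|i r IH]; rewrite ?big_nil // !big_cons PD IH.
have key u : P u x = \sum_i fcov df i (u x) *: P (fvec df i) x.
  rewrite -[LHS]scale1r -gx -[LHS]/(smul g (P u) x) -PZ -(fdual_sec df) Psum.
  by rewrite sec_sumE; apply: eq_bigr => i _; rewrite PZ.
by rewrite !key st.
Qed.

End Frames.
Arguments fcovs {R M E g} df i s.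
Arguments sec_through {R M E x} v.

Section Cochains.
Variables (R : realType) (M : manifold R) (A : vbundle M).
Local Notation AA := (sec A).

Section Defs.
Variables (V : lmodType R) (cs : Cinf M -> V -> V).

Definition cmlin (f : seq AA -> V) := forall s1 s2 (c : Cinf M) u v,
  f (s1 ++ (smul c u + v) :: s2) = cs c (f (s1 ++ u :: s2)) + f (s1 ++ v :: s2).
Definition cskew (f : seq AA -> V) := forall s1 s2 u v,
  f (s1 ++ u :: v :: s2) = - f (s1 ++ v :: u :: s2).

Lemma cmlin_cons f u : cmlin f -> cmlin (f \o cons u).
Proof. by move=> mf s1 s2 c v w; rewrite /= -!cat_cons mf. Qed.
Lemma cskew_cons f u : cskew f -> cskew (f \o cons u).
Proof. by move=> mf s1 s2 v w; rewrite /= -!cat_cons mf. Qed.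

Hypothesis csD : forall c u v, cs c (u + v) = cs c u + cs c v.

Lemma cs0 c : cs c 0 = 0.
Proof. by apply: (addIr (cs c 0)); rewrite -csD !add0r. Qed.
Lemma csN c u : cs c (- u) = - cs c u.
Proof. by apply/eqP; rewrite -addr_eq0 -csD addNr cs0. Qed.

Lemma cmlin0 : cmlin 0. Proof. by move=> *; rewrite cs0 addr0. Qed.
Lemma cskew0 : cskew 0. Proof. by move=> *; rewrite oppr0. Qed.
Lemma cmlinD f g : cmlin f -> cmlin g -> cmlin (f + g).
Proof. by move=> mf mg s1 s2 c u v; rewrite !ptwD mf mg csD addrACA. Qed.
Lemma cskewD f g : cskew f -> cskew g -> cskew (f + g).
Proof. by move=> mf mg s1 s2 u v; rewrite !ptwD mf mg opprD. Qed.
Lemma cmlinN f : cmlin f -> cmlin (- f).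
Proof. by move=> mf s1 s2 c u v; rewrite !ptwN mf opprD csN. Qed.
Lemma cskewN f : cskew f -> cskew (- f).
Proof. by move=> mf s1 s2 u v; rewrite !ptwN mf. Qed.
Lemma cmlin_sign f : cmlin f -> cmlin (deg_sign f).
Proof.
move=> mf s1 s2 c u v; rewrite !deg_signE !size_cat /=; case: odd => //.
by rewrite mf opprD csN.
Qed.
Lemma cskew_sign f : cskew f -> cskew (deg_sign f).
Proof.
by move=> mf s1 s2 u v; rewrite !deg_signE !size_cat /=; case: odd => //; rewrite mf.
Qed.

Lemma cmlin_head f : cskew f ->
  (forall c u v s, f ((smul c u + v) :: s) = cs c (f (u :: s)) + f (v :: s)) -> cmlin f.
Proof.
move=> sf lf s1 s2 c; elim/last_ind: s1 s2 => [|s1 w IH] s2 u v; first exact: lf.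
by rewrite !cat_rcons sf IH (sf s1 s2 w u) (sf s1 s2 w v) opprD csN.
Qed.

End Defs.

Section WedgeCochains.
Variables (U V W : lmodType R) (mu : U -> V -> W).
Variables (cU : Cinf M -> U -> U) (cV : Cinf M -> V -> V) (cW : Cinf M -> W -> W).
Hypothesis muDl : forall u u' v, mu (u + u') v = mu u v + mu u' v.
Hypothesis muDr : forall u v v', mu u (v + v') = mu u v + mu u v'.
Hypothesis cUD : forall c u v, cU c (u + v) = cU c u + cU c v.
Hypothesis cWD : forall c u v, cW c (u + v) = cW c u + cW c v.
Hypothesis muCl : forall c u v, mu (cU c u) v = cW c (mu u v).
Hypothesis muCr : forall c u v, mu u (cV c v) = cW c (mu u v).

Lemma wedge_cZl c (f : seq AA -> U) g s :
  wedge_with mu (cU c \o f) g s = cW c (wedge_with mu f g s).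
Proof.
elim: s f g => [|u s IH] f g /=; first exact: muCl.
rewrite (IH (f \o cons u)) cWD -(IH (deg_sign f)); congr (_ + wedge_with _ _ _ _).
by apply/funext => t; rewrite /= !deg_signE /=; case: odd; rewrite ?csN.
Qed.

Lemma wedge_cZr c (f : seq AA -> U) (g : seq AA -> V) s :
  wedge_with mu f (cV c \o g) s = cW c (wedge_with mu f g s).
Proof.
elim: s f g => [|u s IH] f g /=; first exact: muCr.
by rewrite IH (IH _ (g \o cons u)) cWD.
Qed.

Lemma cmlin_wedge f g : cmlin cU f -> cmlin cV g -> cmlin cW (wedge_with mu f g).
Proof.
move=> mf mg s1; elim: s1 f g mf mg => [|w s1 IH] f g mf mg s2 c u v /=.
  have -> : f \o cons (smul c u + v) = (cU c \o (f \o cons u)) + (f \o cons v).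
    by apply/funext => s; exact: (mf [::]).
  have -> : g \o cons (smul c u + v) = (cV c \o (g \o cons u)) + (g \o cons v).
    by apply/funext => s; exact: (mg [::]).
  by rewrite wedgeDl // wedgeDr // !ptwD wedge_cZl wedge_cZr cWD addrACA.
rewrite (IH _ _ (cmlin_cons w mf) mg) (IH _ _ (cmlin_sign cUD mf) (cmlin_cons w mg)).
by rewrite cWD addrACA.
Qed.

Lemma cskew_wedge (f : seq AA -> U) (g : seq AA -> V) :
  cskew f -> cskew g -> cskew (wedge_with mu f g).
Proof.
move=> kf kg s1; elim: s1 f g kf kg => [|w s1 IH] f g kf kg s2 u v /=; last first.
  by rewrite (IH _ _ (cskew_cons w kf) kg s2 u v)
    (IH _ _ (cskew_sign kf) (cskew_cons w kg) s2 u v) opprD.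
have -> : (f \o cons u) \o cons v = - ((f \o cons v) \o cons u).
  by apply/funext => s; exact: (kf [::]).
have -> : (g \o cons u) \o cons v = - ((g \o cons v) \o cons u).
  by apply/funext => s; exact: (kg [::]).
rewrite !deg_sign_cons deg_signK !(wedgeNl muDl) (wedgeNr muDr) !ptwN !opprD !opprK.
exact: addrACA.
Qed.

End WedgeCochains.

Section FormCochain.
Variable E : vbundle M.

Lemma form_app_cmlin (w : form A E) : cmlin (@smul R M E) (form_app w).
Proof.
move=> s1 s2 c u v; apply: sec_eq => x /=.
by rewrite !map_cat /= form_linear.
Qed.
Lemma form_app_cskew (w : form A E) : cskew (form_app w).
Proof.
move=> s1 s2 u v; apply: sec_eq => x /=.
by rewrite !map_cat /= form_skew; exact: esym (scaleN1r _).
Qed.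

Variable f : seq AA -> sec E.
Hypothesis mf : cmlin (@smul R M E) f.
Hypothesis kf : cskew f.

(** The entries are exchanged one at a time, each slot being a C^oo(M)-linear operator; [r] collects
    the slots already treated. *)
Lemma cochain_ptw x s t : map (fun a : AA => a x) s = map (fun a : AA => a x) t -> f s x = f t x.
Proof.
have one : smul (cinf_cst M 1) = id :> (AA -> AA).
  by apply/funext => u; rewrite smul_cst scale1r.
have oneE : smul (cinf_cst M 1) = id :> (sec E -> sec E).
  by apply/funext => u; rewrite smul_cst scale1r.
suff H r : map (fun a : AA => a x) s = map (fun a : AA => a x) t -> f (r ++ s) x = f (r ++ t) x.
  exact: (H [::]).
elim: s t r => [|a s IH] [|b t] r //= [ab st].
rewrite -cat_rcons (IH t) // cat_rcons.
apply: (Clinear_ptw (P := fun a => f (r ++ a :: t))) ab => [u v|c u].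
  by have := mf r t (cinf_cst M 1) u v; rewrite one oneE.
have := mf r t c u 0; rewrite addr0 => ->.
(* Multilinearity with coefficient -1 and two zero sections gives f(.., 0, ..) = - f(.., 0, ..) +
   f(.., 0, ..) = 0. *)
have := mf r t (cinf_cst M (-1)) 0 0; rewrite smul0r addr0.
rewrite smul_cst scaleN1r addNr => ->; exact: addr0.
Qed.

Definition cochain_val (x : M) (s : seq (A x)) : E x := f (map (sec_through (E := A) (x := x)) s) x.

Lemma cochain_valE x (s : seq AA) : cochain_val [seq (a : AA) x | a <- s] = f s x.
Proof.
apply: cochain_ptw; rewrite -!map_comp; apply: eq_map => a /=.
exact: sec_throughE.
Qed.

Lemma map_sec_throughE x (s : seq (A x)) : [seq (a : AA) x | a <- map (sec_through (E := A) (x := x)) s] = s.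
Proof. by rewrite -map_comp -[RHS]map_id; apply: eq_map => a /=; exact: sec_throughE. Qed.

Lemma cochain_val_linear x (s1 s2 : seq (A x)) (c : R) (u v : A x) :
  cochain_val (s1 ++ (c *: u + v) :: s2) =
  c *: cochain_val (s1 ++ u :: s2) + cochain_val (s1 ++ v :: s2).
Proof.
pose s1' := map (sec_through (E := A) (x := x)) s1; pose s2' := map (sec_through (E := A) (x := x)) s2.
have := congr1 (fun t : sec E => t x) (mf s1' s2' (cinf_cst M c) (sec_through u) (sec_through v)).
rewrite smul_cst /=; rewrite -!cochain_valE !map_cat /= !map_sec_throughE !sec_throughE.
by [].
Qed.

Lemma cochain_val_skew x (s1 s2 : seq (A x)) (u v : A x) :
  cochain_val (s1 ++ u :: v :: s2) = - cochain_val (s1 ++ v :: u :: s2).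
Proof.
pose s1' := map (sec_through (E := A) (x := x)) s1; pose s2' := map (sec_through (E := A) (x := x)) s2.
have := congr1 (fun t : sec E => t x) (kf s1' s2' (sec_through u) (sec_through v)).
rewrite -[- f _ : sec E]scaleN1r /= -!cochain_valE !map_cat /= !map_sec_throughE !sec_throughE scaleN1r.
by [].
Qed.

Lemma cochain_val_smooth (a : seq AA) :
  smooth_section (fun x => cochain_val [seq (b : AA) x | b <- a]).
Proof.
have -> : (fun x => cochain_val [seq (b : AA) x | b <- a]) = f a :> (forall x, E x).
  by apply: functional_extensionality_dep => x; exact: cochain_valE.
exact: sec_smooth.
Qed.

(** Together with [form_app_inj] this identifies forms with alternating C^oo(M)-multilinear
    cochains; from here on identities between forms are proved for cochains. *)
Definition form_of : form A E := Form cochain_val_linear cochain_val_skew cochain_val_smooth.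

Lemma form_ofE : form_app form_of = f.
Proof. by apply/funext => s; apply: sec_eq => x; exact: cochain_valE. Qed.

End FormCochain.

Lemma form_app_inj (E : vbundle M) (w t : form A E) : form_app w = form_app t -> w = t.
Proof.
move=> wt; apply: form_eq => x s; rewrite -(map_sec_throughE s).
by have := congr1 (fun u : sec E => u x) (congr1 (@^~ (map (sec_through (E := A) (x := x)) s)) wt).
Qed.

End Cochains.

Section Anchor.
Variables (R : realType) (M : manifold R) (A : lie_algebroid M).
Local Notation AA := (sec A).
Local Notation ρ := (rho (la_anchor A)).
Implicit Types (a b : AA) (f g h : Cinf M).

Lemma rhoDr a f g : ρ a (f + g) = ρ a f + ρ a g.
Proof.
apply: sec_eq => x /=; have [H _] := anc_tangent (la_anchor A) (a x).
by rewrite -[f in LHS]scale1r H mul1r.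
Qed.
Lemma rhoZr (c : R) a f : ρ a (c *: f) = c *: ρ a f.
Proof.
have rho0 : ρ a 0 = 0 by apply: (addIr (ρ a 0)); rewrite -rhoDr !add0r.
apply: sec_eq => x /=; have [H _] := anc_tangent (la_anchor A) (a x).
have /(congr1 (fun u : Cinf M => u x)) /= a0 := rho0.
by rewrite -[c *: f]addr0 H a0 addr0.
Qed.
Lemma rhoM a f g : ρ a (smul f g) = smul (ρ a f) g + smul f (ρ a g).
Proof.
by apply: sec_eq => x /=; have [_ H] := anc_tangent (la_anchor A) (a x); rewrite H.
Qed.
Lemma rho_lin h a b f : ρ (smul h a + b) f = smul h (ρ a f) + ρ b f.
Proof. by apply: sec_eq => x; exact: anc_linear. Qed.
Lemma rhoDl a b f : ρ (a + b) f = ρ a f + ρ b f.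
Proof.
have := rho_lin (cinf_cst M 1) a b f.
by rewrite !smul_cst !scale1r.
Qed.
Lemma rho0l f : ρ 0 f = 0.
Proof. by apply: (addIr (ρ 0 f)); rewrite -rhoDl !add0r. Qed.
Lemma rhoZl h a f : ρ (smul h a) f = smul h (ρ a f).
Proof. by rewrite -[smul h a]addr0 rho_lin rho0l addr0. Qed.

Lemma brDr a b c : br a (b + c) = br a b + br a c.
Proof. by have := br_linear a 1 b c; rewrite !scale1r. Qed.
Lemma brNr a b : br a (- b) = - br a b.
Proof.
have br0 : br a 0 = 0 by apply: (addIr (br a 0)); rewrite -brDr !add0r.
by apply/eqP; rewrite -addr_eq0 -brDr addNr br0.
Qed.
Lemma brDl a b c : br (a + b) c = br a c + br b c.
Proof. by rewrite (br_skew (a + b)) brDr opprD -(br_skew a) -(br_skew b). Qed.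
Lemma brZl h a b : br (smul h a) b = smul h (br a b) - smul (ρ b h) a.
Proof. by rewrite (br_skew (smul h a)) br_leibniz opprD -(smulNr h (br b a)) -(br_skew a). Qed.

Local Notation ld := (lie_der (@br R M A) (fun a f => ρ a f)).
Local Notation cd := (ce_diff (@br R M A) (fun a f => ρ a f)).
Local Notation lin := (@cmlin R M A (sec (line M)) (@smul R M (line M))).
Local Notation skw := (@cskew R M A (sec (line M))).
Implicit Types (w : seq AA -> Cinf M).

Lemma cmlin_one (V : lmodType R) (cs : Cinf M -> V -> V) (w : seq AA -> V) s1 s2 u v :
  (forall x, cs (cinf_cst M 1) x = x) -> cmlin cs w ->
  w (s1 ++ (u + v) :: s2) = w (s1 ++ u :: s2) + w (s1 ++ v :: s2).
Proof.
by move=> cs1 /(_ s1 s2 (cinf_cst M 1) u v); rewrite smul_cst scale1r cs1.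
Qed.

Let headD w u v s : lin w -> w ((u + v) :: s) = w (u :: s) + w (v :: s).
Proof. by apply: (cmlin_one [::]) => x; rewrite smul_cst scale1r. Qed.

Let headN w u s : lin w -> w (- u :: s) = - w (u :: s).
Proof.
move=> lw; have w0 : w (0 :: s) = 0.
  by apply: (addIr (w (0 :: s))); rewrite -headD // !add0r.
by apply/eqP; rewrite -addr_eq0 -headD // addNr w0.
Qed.

Let headZ w h u s : lin w -> w (smul h u :: s) = smul h (w (u :: s)).
Proof.
move=> lw; have := lw [::] s h u 0; rewrite /= addr0 => ->.
have -> : w (0 :: s) = 0 by apply: (addIr (w (0 :: s))); rewrite -headD // !add0r.
by rewrite addr0.
Qed.

Lemma lie_der_skew a w : skw w -> skw (ld a w).
Proof.
move=> kw s1; elim: s1 w kw => [|c s1 IH] w kw s2 u v /=; last first.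
  by rewrite (IH _ (cskew_cons c kw)) (kw (br a c :: s1)) opprD.
have -> : (w \o cons u) \o cons v = - ((w \o cons v) \o cons u).
  by apply/funext => s; exact: (kw [::]).
rewrite lie_derN => [|? ? ?]; last exact: rhoDr.
rewrite ptwN (kw [::] s2 u (br a v)) (kw [::] s2 (br a u) v) /= !opprD !opprK.
by rewrite -!addrA; congr (_ + _); exact: addrC.
Qed.

Lemma ce_diff_skew w : lin w -> skw w -> skw (cd w).
Proof.
move=> + + s1; elim: s1 w => [|c s1 IH] w lw kw s2 u v /=; last first.
  by rewrite (lie_der_skew c kw) (IH _ (cmlin_cons c lw) (cskew_cons c kw)) opprD.
have -> : (w \o cons v) \o cons u = - ((w \o cons u) \o cons v).
  by apply/funext => s; exact: (kw [::]).
rewrite ce_diffN => [|? ? ?]; last exact: rhoDr.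
rewrite (br_skew v u) headN // ptwN !opprD !opprK.
by rewrite [LHS](AC (2*2) (3*2*(1*4))).
Qed.

Lemma lie_derDl a b w s : lin w -> ld (a + b) w s = ld a w s + ld b w s.
Proof.
elim: s w => [|c s IH] w lw /=; first exact: rhoDl.
by rewrite IH; [rewrite brDl headD // opprD addrACA|exact: cmlin_cons].
Qed.

Let ld_act_smul a h w s :
  ld a (smul h \o w) s = smul (ρ a h) (w s) + smul h (ld a w s).
Proof.
elim: s w => [|c s IH] w /=; first exact: rhoM.
by rewrite (IH (w \o cons c)) /= smulDr smulNr addrA.
Qed.

(** L_(ha) w and d(h i_a w) both differ from their h-linear versions by dh i_a w, so the difference,
    which is i_(ha) dw, is linear in h. *)
Lemma ce_diff_head_smul h a w s : lin w -> skw w ->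
  ld (smul h a) w s - cd (smul h \o (w \o cons a)) s =
  smul h (ld a w s - cd (w \o cons a) s).
Proof.
elim: s w => [|b s IH] w lw kw /=.
  by rewrite !subr0 rhoZl.
rewrite (_ : (smul h \o (w \o cons a)) \o cons b = - (smul h \o ((w \o cons b) \o cons a))); last first.
  by apply/funext => t; rewrite /= (kw [::]) smulNr.
rewrite (_ : (w \o cons a) \o cons b = - ((w \o cons b) \o cons a)); last first.
  by apply/funext => t; rewrite /= (kw [::]).
rewrite !ce_diffN; do ?by move=> ? ? ?; exact: rhoDr.
rewrite !ptwN !opprK (ld_act_smul b h (w \o cons a)) brZl headD // headN // !headZ //.
have := IH _ (cmlin_cons b lw) (cskew_cons b kw).
move/(canRL (subrK _)) => ->.
rewrite !(opprD, smulDr, smulNr, opprK) /=.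
by rewrite [LHS](AC (3*2*3) ((1*4*(7*2))*((3*8)*(5*6)))) /= !subrr !addr0.
Qed.

Lemma ce_diff_lin w : lin w -> skw w -> lin (cd w).
Proof.
move=> lw kw; apply: cmlin_head; [exact: smulDr|exact: ce_diff_skew|].
move=> h a b s /=; rewrite lie_derDl //.
have -> : w \o cons (smul h a + b) = (smul h \o (w \o cons a)) + (w \o cons b).
  by apply/funext => t; rewrite ptwD /= headD // headZ.
rewrite ce_diffD => [|? ? ?]; last exact: rhoDr.
by rewrite ptwD opprD addrACA ce_diff_head_smul.
Qed.

Definition koszul_cochain w (a : seq AA) : Cinf M :=
  \sum_(i < size a) (-1) ^+ i *: ρ a`_i (w (omit i a)) +
  \sum_(j < size a) \sum_(i < j)
     (-1) ^+ (i + j) *: w (br a`_i a`_j :: omit i (omit j a)).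

Lemma lie_der_skewE a w s : skw w ->
  ld a w s = ρ a (w s) - \sum_(j < size s) (-1) ^+ j *: w (br a s`_j :: omit j s).
Proof.
elim: s w => [|b s IH] w kw /=; first by rewrite big_ord0 subr0.
rewrite IH; last exact: cskew_cons.
rewrite big_ord_recl /= expr0 scale1r /omit /= drop0 opprD addrA addrAC; congr (_ - _ + _).
apply: eq_bigr => j _ /=.
by rewrite (kw [::] _ (br a _) b) /bump /= add1n exprS mulN1r scaleNr scalerN opprK.
Qed.

(** The link with the Koszul formula that defines [is_dA]. The terms with i = 0 in both sums form
    L_a w, and the others are those of i_a w one degree below, with opposite sign. *)
Lemma koszul_cochainE w s : skw w -> koszul_cochain w s = cd w s.
Proof.
elim: s w => [|a s IH] w kw; first by rewrite /koszul_cochain !big_ord0 addr0.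
rewrite /= -IH; last exact: cskew_cons.
rewrite lie_der_skewE // /koszul_cochain /= !big_ord_recl /= big_ord0 add0r.
rewrite expr0 scale1r /omit /= drop0 -!addrA; congr (_ + _).
rewrite opprD [RHS]addrCA -!sumrN; congr (_ + _).
  apply: eq_bigr => i _; by rewrite /bump /= add1n exprS mulN1r scaleNr.
rewrite -big_split; apply: eq_bigr => j _ /=.
rewrite big_ord_recl /= add0n /bump /= add1n exprS mulN1r scaleNr; congr (_ + _).
  by rewrite drop0.
rewrite -sumrN; apply: eq_bigr => i _ /=.
rewrite (kw [::] _ _ a) /= !add1n addSn addnS !exprS !mulN1r opprK scalerN.
by [].
Qed.

End Anchor.

(** * The operator D as a flat superconnection *)

Definition tsec (R : realType) (M : manifold R) (n : nat) (E : 'I_n -> vbundle M) : Type :=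
  forall z, sec (E z).

Section TotalSections.
Variables (R : realType) (M : manifold R) (n : nat) (E : 'I_n -> vbundle M).
Local Notation H := (tsec E).
Implicit Types h k : H.

Lemma tsec_eq h k : (forall z, h z = k z) -> h = k.
Proof. exact: functional_extensionality_dep. Qed.

HB.instance Definition _ := gen_eqMixin H.
HB.instance Definition _ := gen_choiceMixin H.

Definition tsec0 : H := fun z => 0.
Definition tsecD h k : H := fun z => h z + k z.
Definition tsecN h : H := fun z => - h z.
Definition tsecZ (c : R) h : H := fun z => c *: h z.

Fact tsecDA : associative tsecD.
Proof. by move=> h k u; apply: tsec_eq => z; exact: addrA. Qed.
Fact tsecDC : commutative tsecD.
Proof. by move=> h k; apply: tsec_eq => z; exact: addrC. Qed.
Fact tsec0D : left_id tsec0 tsecD.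
Proof. by move=> h; apply: tsec_eq => z; exact: add0r. Qed.
Fact tsecND : left_inverse tsec0 tsecN tsecD.
Proof. by move=> h; apply: tsec_eq => z; exact: addNr. Qed.
HB.instance Definition _ := GRing.isZmodule.Build H tsecDA tsecDC tsec0D tsecND.

Fact tsecZA (a b : R) h : tsecZ a (tsecZ b h) = tsecZ (a * b) h.
Proof. by apply: tsec_eq => z; exact: scalerA. Qed.
Fact tsec1Z : left_id 1 tsecZ.
Proof. by move=> h; apply: tsec_eq => z; exact: scale1r. Qed.
Fact tsecZDr : right_distributive tsecZ +%R.
Proof. by move=> a h k; apply: tsec_eq => z; exact: scalerDr. Qed.
Fact tsecZDl h : {morph tsecZ^~ h : a b / a + b}.
Proof. by move=> a b; apply: tsec_eq => z; exact: scalerDl. Qed.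
HB.instance Definition _ :=
  GRing.Zmodule_isLmodule.Build R H tsecZA tsec1Z tsecZDr tsecZDl.

Lemma tsecDE h k z : (h + k) z = h z + k z. Proof. by []. Qed.
Lemma tsecNE h z : (- h) z = - h z. Proof. by []. Qed.

Lemma tsec_sumE (I : Type) (r : seq I) (F : I -> H) z :
  (\sum_(i <- r) F i) z = \sum_(i <- r) F i z.
Proof. by elim: r => [|i r IH]; rewrite ?big_nil // !big_cons -IH. Qed.

Definition tsmul (f : Cinf M) h : H := fun z => smul f (h z).

Lemma tsmulDl f g h : tsmul (f + g) h = tsmul f h + tsmul g h.
Proof. by apply: tsec_eq => z; exact: smulDl. Qed.
Lemma tsmulDr f h k : tsmul f (h + k) = tsmul f h + tsmul f k.
Proof. by apply: tsec_eq => z; exact: smulDr. Qed.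
Lemma tsmulA f g h : tsmul f (tsmul g h) = tsmul (smul f g) h.
Proof. by apply: tsec_eq => z; exact: smulA. Qed.
Lemma tsmulNr f h : tsmul f (- h) = - tsmul f h.
Proof. by apply: tsec_eq => z; exact: smulNr. Qed.
Lemma tsmul0r f : tsmul f 0 = 0.
Proof. by apply: tsec_eq => z; exact: smul0r. Qed.
Lemma tsmulZr f (c : R) h : tsmul f (c *: h) = c *: tsmul f h.
Proof. by apply: tsec_eq => z; exact: smulZr. Qed.

Definition tinj (z : 'I_n) (s : sec (E z)) : H :=
  @eqtype.dfwith _ (fun w => sec (E w)) (fun=> 0) z s.

Arguments tinj {z} s.

Lemma tinjE z (s : sec (E z)) : tinj s z = s.
Proof. by rewrite /tinj eqtype.dfwith_in. Qed.
Lemma tinj_out z (s : sec (E z)) w : z != w -> tinj s w = 0.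
Proof. by move=> zw; rewrite /tinj eqtype.dfwith_out. Qed.

Lemma tinjD z (s t : sec (E z)) : tinj (s + t) = tinj s + tinj t.
Proof.
apply: tsec_eq => w; rewrite tsecDE; have [<-|zw] := eqVneq z w; first by rewrite !tinjE.
by rewrite !tinj_out // addr0.
Qed.
Lemma tinj_smul z f (s : sec (E z)) : tinj (smul f s) = tsmul f (tinj s).
Proof.
apply: tsec_eq => w; rewrite /tsmul; have [<-|zw] := eqVneq z w; first by rewrite !tinjE.
by rewrite !tinj_out // smul0r.
Qed.
Lemma tinj_sum h : \sum_z tinj (h z) = h.
Proof.
apply: tsec_eq => w; rewrite tsec_sumE (bigD1 w) //= tinjE big1 ?addr0 //.
by move=> z zw; rewrite tinj_out.
Qed.

(* Sections of End of the total bundle, as [C^oo(M)]-linear operators. *)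
Record endo := Endo {
  endo_val :> H -> H;
  endoD : forall h k, endo_val (h + k) = endo_val h + endo_val k;
  endoS : forall f h, endo_val (tsmul f h) = tsmul f (endo_val h) }.
Implicit Types P Q : endo.

Lemma endo_eq P Q : (forall h, P h = Q h) -> P = Q.
Proof.
case: P Q => [P Pd Ps] [Q Qd Qs] /= PQ; have e : P = Q by apply/funext.
by subst Q; congr Endo; exact: Prop_irrelevance.
Qed.

Lemma endo0 P : P 0 = 0.
Proof. by apply: (addIr (P 0)); rewrite -endoD !add0r. Qed.
Lemma endoN P h : P (- h) = - P h.
Proof. by apply/eqP; rewrite -addr_eq0 -endoD addNr endo0. Qed.
Lemma endo_sum P (I : Type) (r : seq I) (F : I -> H) :
  P (\sum_(i <- r) F i) = \sum_(i <- r) P (F i).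
Proof. by elim: r => [|i r IH]; rewrite ?big_nil ?endo0 // !big_cons endoD IH. Qed.

HB.instance Definition _ := gen_eqMixin endo.
HB.instance Definition _ := gen_choiceMixin endo.

Definition zero_endo : endo.
Proof. by exists (fun=> 0) => *; rewrite ?addr0 ?tsmul0r. Defined.
Definition add_endo P Q : endo.
Proof.
exists (fun h => P h + Q h) => [h k|f h]; first by rewrite !endoD addrACA.
by rewrite !endoS tsmulDr.
Defined.
Definition opp_endo P : endo.
Proof.
exists (fun h => - P h) => [h k|f h]; first by rewrite endoD opprD.
by rewrite endoS tsmulNr.
Defined.
Definition scale_endo (c : R) P : endo.
Proof.
exists (fun h => c *: P h) => [h k|f h]; first by rewrite endoD scalerDr.
by rewrite endoS tsmulZr.
Defined.

Fact add_endoA : associative add_endo.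
Proof. by move=> P Q S; apply: endo_eq => h; exact: addrA. Qed.
Fact add_endoC : commutative add_endo.
Proof. by move=> P Q; apply: endo_eq => h; exact: addrC. Qed.
Fact add_endo0 : left_id zero_endo add_endo.
Proof. by move=> P; apply: endo_eq => h; exact: add0r. Qed.
Fact add_endoN : left_inverse zero_endo opp_endo add_endo.
Proof. by move=> P; apply: endo_eq => h; exact: addNr. Qed.
HB.instance Definition _ := GRing.isZmodule.Build endo add_endoA add_endoC add_endo0 add_endoN.
Fact scale_endoA (a b : R) P : scale_endo a (scale_endo b P) = scale_endo (a * b) P.
Proof. by apply: endo_eq => h; exact: scalerA. Qed.
Fact scale_endo1 : left_id 1 scale_endo.
Proof. by move=> P; apply: endo_eq => h; exact: scale1r. Qed.
Fact scale_endoDr : right_distributive scale_endo +%R.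
Proof. by move=> a P Q; apply: endo_eq => h; exact: scalerDr. Qed.
Fact scale_endoDl P : {morph scale_endo^~ P : a b / a + b}.
Proof. by move=> a b; apply: endo_eq => h; exact: scalerDl. Qed.
HB.instance Definition _ :=
  GRing.Zmodule_isLmodule.Build R endo scale_endoA scale_endo1 scale_endoDr scale_endoDl.

Lemma endoDE P Q h : (P + Q) h = P h + Q h. Proof. by []. Qed.
Lemma endoNE P h : (- P) h = - P h. Proof. by []. Qed.

Definition esmul (f : Cinf M) P : endo.
Proof.
exists (fun h => tsmul f (P h)) => [h k|g h]; first by rewrite endoD tsmulDr.
by rewrite endoS !tsmulA smulC.
Defined.

Definition ecomp P Q : endo.
Proof.
by exists (fun h => P (Q h)) => [h k|f h]; rewrite ?endoD ?endoS.
Defined.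

(** The parity operator (-1)^z of the graded bundle. It carries the Koszul signs and turns the trace
    into the supertrace. *)
Definition eps_val h : H := fun z => if odd z then - h z else h z.

Definition eps_endo : endo.
Proof.
exists eps_val => [h k|f h]; apply: tsec_eq => z; rewrite /eps_val ?tsecDE.
  by case: odd => //; exact: opprD.
by rewrite /tsmul; case: odd => //; rewrite smulNr.
Defined.

Definition eps : endo := locked eps_endo.

Lemma epsE h z : eps h z = if odd z then - h z else h z.
Proof. by rewrite /eps -lock. Qed.
Lemma epsK h : eps (eps h) = h.
Proof. by apply: tsec_eq => z; rewrite !epsE; case: odd; rewrite ?opprK. Qed.

Lemma ecompDl P P' Q : ecomp (P + P') Q = ecomp P Q + ecomp P' Q.
Proof. exact: endo_eq. Qed.
Lemma ecompDr P Q Q' : ecomp P (Q + Q') = ecomp P Q + ecomp P Q'.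
Proof. by apply: endo_eq => h; exact: endoD. Qed.
Lemma ecompA P Q S : ecomp P (ecomp Q S) = ecomp (ecomp P Q) S.
Proof. exact: endo_eq. Qed.
Lemma ecomp_epsK P : ecomp eps (ecomp eps P) = P.
Proof. by apply: endo_eq => h; exact: epsK. Qed.

End TotalSections.
Arguments tinj {R M n E z} s.
Arguments eps {R M n E}.

Section TotalConnection.
Variables (R : realType) (M : manifold R) (A : lie_algebroid M).
Variables (n : nat) (E : 'I_n -> vbundle M).
Variable nabla : forall z : 'I_n, connection A (E z).
Local Notation AA := (sec A).
Local Notation H := (tsec E).
Local Notation B := (endo E).
Local Notation ρ := (rho (la_anchor A)).
Implicit Types (a b c : AA) (f g : Cinf M) (h k : H) (P Q : B).

Definition tnab a h : H := fun z => nabla z a (h z).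

Lemma tnabDl a b h : tnab (a + b) h = tnab a h + tnab b h.
Proof. by apply: tsec_eq => z; exact: nabDl. Qed.
Lemma tnabZl f a h : tnab (smul f a) h = tsmul f (tnab a h).
Proof. by apply: tsec_eq => z; exact: nabZl. Qed.
Lemma tnabDr a h k : tnab a (h + k) = tnab a h + tnab a k.
Proof.
apply: tsec_eq => z; rewrite /tnab tsecDE -[h z]scale1r nab_linear !scale1r.
by [].
Qed.
Lemma tnab0r a : tnab a 0 = 0.
Proof. by apply: (addIr (tnab a 0)); rewrite -tnabDr !add0r. Qed.
Lemma tnabNr a h : tnab a (- h) = - tnab a h.
Proof. by apply/eqP; rewrite -addr_eq0 -tnabDr addNr tnab0r. Qed.
Lemma tnab0l h : tnab 0 h = 0.
Proof. by apply: (addIr (tnab 0 h)); rewrite -tnabDl !add0r. Qed.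
Lemma tnabNl a h : tnab (- a) h = - tnab a h.
Proof. by apply/eqP; rewrite -addr_eq0 -tnabDl addNr tnab0l. Qed.
Lemma tnab_smul a f h : tnab a (tsmul f h) = tsmul f (tnab a h) + tsmul (ρ a f) h.
Proof. by apply: tsec_eq => z; exact: nab_leibniz. Qed.
Lemma tnab_eps a h : tnab a (eps h) = eps (tnab a h).
Proof.
apply: tsec_eq => z; rewrite epsE /tnab epsE; case: odd => //.
by have /(congr1 (@^~ z)) := tnabNr a h.
Qed.

(** The induced connection on End, as the commutator with nabla_a; the derivatives of functions
    cancel in it. *)
Definition eact a P : B.
Proof.
exists (fun h => tnab a (P h) - P (tnab a h)) => [h k|f h].
  by rewrite endoD !tnabDr endoD opprD addrACA.
rewrite endoS !tnab_smul endoD !endoS opprD addrACA subrr addr0.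
by rewrite tsmulDr tsmulNr.
Defined.

Lemma eactE a P h : eact a P h = tnab a (P h) - P (tnab a h). Proof. by []. Qed.
Lemma eactD a P Q : eact a (P + Q) = eact a P + eact a Q.
Proof. by apply: endo_eq => h; rewrite eactE !endoDE tnabDr opprD addrACA. Qed.
Lemma eact_comp a P Q : eact a (ecomp P Q) = ecomp (eact a P) Q + ecomp P (eact a Q).
Proof.
apply: endo_eq => h; rewrite endoDE /= endoD endoN addrA subrK.
by [].
Qed.
Lemma tnab_app a P h : tnab a (P h) = eact a P h + P (tnab a h).
Proof. by rewrite eactE subrK. Qed.

Definition curv a b : B.
Proof.
exists (fun h => tnab a (tnab b h) - tnab b (tnab a h) - tnab (br a b) h) => [h k|f h].
  by rewrite !tnabDr !opprD !addrA [LHS](AC (6) (1*3*5*2*4*6)).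
rewrite !tnab_smul !tnabDr !tnab_smul br_anchor tsmulDl.
have tsmulNl (u : Cinf M) k : tsmul (- u) k = - tsmul u k.
  by apply: tsec_eq => z; exact: smulNl.
rewrite tsmulNl !tsmulDr !tsmulNr !opprD !opprK.
rewrite [LHS](AC (((2*2)*(2*2))*(1*2)) ((1*5*9)*((2*7)*(3*6)*(4*10)*(8*11)))) /=.
by rewrite !subrr addNr !addr0.
Defined.

Lemma curvE a b h :
  curv a b h = tnab a (tnab b h) - tnab b (tnab a h) - tnab (br a b) h.
Proof. by []. Qed.

Lemma curv_skew a b : curv a b = - curv b a.
Proof.
apply: endo_eq => h; rewrite endoNE !curvE !opprD !opprK (br_skew a b) tnabNl !opprK.
by congr (_ + _); exact: addrC.
Qed.

Lemma curv_lin f a b c : curv (smul f a + b) c = esmul f (curv a c) + curv b c.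
Proof.
apply: endo_eq => h; rewrite endoDE -[esmul _ _ h]/(tsmul f (curv a c h)) !curvE brDl brZl !tnabDl tnabNl !tnabZl !tnabDr tnab_smul.
rewrite !opprD !opprK !tsmulDr !tsmulNr.
by rewrite [LHS](AC (2*3*3) ((1*3*6*(4*7))*(2*5*8))) /= addNr addr0.
Qed.

Definition curv_cochain (s : seq AA) : B :=
  match s with [:: a; b] => curv a b | _ => 0 end.

Local Notation edd := (ce_diff (@br R M A) eact).
Local Notation hdd := (ce_diff (@br R M A) tnab).

(** Only lists of length three matter. Once [b, [a, c]] is rewritten by the Jacobi identity, the
    terms of the expansion cancel in pairs. *)
Lemma bianchi : edd curv_cochain = 0.
Proof.
apply/funext => s; have [s3|s3] := eqVneq (size s) 3; last first.
  apply: (ce_diff_degree _ _ (m := 2)) => //; first exact: eactD.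
  by case=> [|? [|? []]].
case: s s3 => [|a [|b [|c []]]] // _; apply: endo_eq => h.
rewrite /= !subr0 !(tnabDr, tnabNr).
have jac : br b (br a c) = br a (br b c) - br (br a b) c.
  apply/esym/subr0_eq; rewrite -[RHS](br_jacobi a b c) (br_skew c a) brNr.
  by rewrite (br_skew c (br a b)) addrAC.
rewrite jac tnabDl tnabNl !(opprD, opprK) !addrA.
by rewrite [LHS](AC 28 ((1*26)*(17*2)*(20*3)*(15*4)*(5*24)*(6*21)*(16*7)*(8*19)*(9*22)*(13*10)*(28*11)*(12*25)*(27*14)*(23*18))) /= !subrr !addr0.
Qed.

End TotalConnection.

Section FormTools.
Variables (R : realType) (M : manifold R) (A : vbundle M).
Local Notation AA := (sec A).

Lemma form_app_wedge (F : vbundle M) (w : form A (line M)) (t : form A F) :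
  form_app (wedge w t) = wedge_with (@smul R M F) (form_app w) (form_app t).
Proof.
apply/funext => s; apply: sec_eq => x; apply/esym.
apply: (wedge_rel (h := fun a : AA => a x) (mu := @smul R M F)
  (mu' := fun (a : R^o) (e : F x) => a *: e)
  (RU := fun (u : Cinf M) u' => u x = u')
  (RV := fun (u : sec F) u' => u x = u') (RW := fun (u : sec F) u' => u x = u')) => //.
- by move=> u _ <-; exact: scaleN1r.
- by move=> u _ v _ <- <-.
- by move=> u _ v _ <- <-.
Qed.

Lemma form_appD (F : vbundle M) (w t : form A F) : form_app (w + t) = form_app w + form_app t.
Proof. by apply/funext => s; exact: sec_eq. Qed.
Lemma form_appZ (F : vbundle M) (c : R) (w : form A F) : form_app (c *: w) = c *: form_app w.
Proof. by apply/funext => s; exact: sec_eq. Qed.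
Lemma form_appN (F : vbundle M) (w : form A F) : form_app (- w) = - form_app w.
Proof. by rewrite -scaleN1r form_appZ scaleN1r. Qed.
Lemma form_app_zero (F : vbundle M) : form_app (0 : form A F) = 0.
Proof. by apply/funext => s; exact: sec_eq. Qed.
Lemma form_app_sum (F : vbundle M) (I : Type) (r : seq I) (w : I -> form A F) :
  form_app (\sum_(i <- r) w i) = \sum_(i <- r) form_app (w i).
Proof.
elim: r => [|i r IH]; first by rewrite !big_nil form_app_zero.
by rewrite !big_cons form_appD IH.
Qed.

Lemma has_degree_app (F : vbundle M) k (w : form A F) :
  (forall s, size s != k -> form_app w s = 0) -> has_degree k w.
Proof.
move=> w0 x s sk; pose s' := map (sec_through (E := A) (x := x)) s.
have ws : form_app w s' = 0 by apply: w0; rewrite size_map.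
by have := congr1 (fun u : sec F => u x) ws; rewrite /= map_sec_throughE.
Qed.

Lemma app_has_degree (F : vbundle M) k (w : form A F) s :
  has_degree k w -> size s != k -> form_app w s = 0.
Proof. by move=> w0 sk; apply: sec_eq => x /=; rewrite w0 // size_map. Qed.

Lemma deg_sign_degree (V : lmodType R) (f : seq AA -> V) k :
  (forall s, size s != k -> f s = 0) -> deg_sign f = (if odd k then - f else f).
Proof.
move=> f0; apply/funext => s; rewrite deg_signE; have [->|/f0 fs] := eqVneq (size s) k.
  by case: odd.
by case: (odd k); rewrite ?ptwN fs; case: odd; rewrite ?oppr0.
Qed.

Lemma cochain0_lin (V : lmodType R) (cs : Cinf M -> V -> V) (v : V) :
  (forall c, cs c 0 = 0) -> cmlin cs (cochain0 v : seq AA -> V).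
Proof. by move=> c0 [|? ?] s2 c u w /=; rewrite c0 addr0. Qed.
Lemma cochain0_skew (V : lmodType R) (v : V) : cskew (cochain0 v : seq AA -> V).
Proof. by move=> [|? ?] s2 u w /=; rewrite oppr0. Qed.

Definition zform (F : vbundle M) (s : sec F) : form A F :=
  form_of (cochain0_lin s (@smul0r R M F)) (cochain0_skew s).
Lemma zformE (F : vbundle M) (s : sec F) : form_app (zform s) = cochain0 s.
Proof. exact: form_ofE. Qed.

Lemma zform_degree (F : vbundle M) (s : sec F) : has_degree 0 (zform s).
Proof. by apply: has_degree_app => t; rewrite zformE; case: t. Qed.

End FormTools.

Section Dform.
Variables (R : realType) (M : manifold R) (A : lie_algebroid M).
Local Notation cd := (ce_diff (@br R M A) (fun a f => rho (la_anchor A) a f)).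

(** The Leibniz rule of an n-representation speaks of pairs related by [is_dA]; this supplies the
    partner of every form. *)
Definition dform (w : form A (line M)) : form A (line M) :=
  form_of (ce_diff_lin (form_app_cmlin w) (form_app_cskew w))
          (ce_diff_skew (form_app_cmlin w) (form_app_cskew w)).
Lemma dformE w : form_app (dform w) = cd (form_app w).
Proof. exact: form_ofE. Qed.

Lemma koszulE (w : form A (line M)) a : koszul w a = cd (form_app w) a.
Proof. by rewrite -koszul_cochainE //; exact: form_app_cskew. Qed.

Lemma is_dA_dform w : is_dA w (dform w).
Proof. by move=> a; rewrite koszulE dformE. Qed.

Lemma cd_cochain0 (f : Cinf M) s :
  cd (cochain0 f) s = if s is [:: a] then rho (la_anchor A) a f else 0.
Proof. by rewrite ce_diff_cochain0 // => *; exact: rhoDr. Qed.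

End Dform.

Section NRep.
Variables (R : realType) (M : manifold R) (A : lie_algebroid M).
Variables (n : nat) (E : 'I_n -> vbundle M).
Variable nabla : forall z : 'I_n, connection A (E z).
Variable D : gform A E -> gform A E.
Hypothesis repD : is_nrepresentation D.
Local Notation AA := (sec A).
Local Notation H := (tsec E).
Local Notation B := (endo E).
Local Notation G := (gform A E).
Local Notation ρ := (rho (la_anchor A)).
Local Notation nab := (tnab nabla).
Local Notation edd := (ce_diff (@br R M A) (eact nabla)).
Local Notation hdd := (ce_diff (@br R M A) nab).
Local Notation cd := (ce_diff (@br R M A) (fun a f => ρ a f)).
Local Notation app := (fun (P : B) (h : H) => P h).
Implicit Types (eta xi : G) (h k : H) (w : form A (line M)).

Lemma gform_eq eta xi : (forall z, form_app (eta z) = form_app (xi z)) -> eta = xi.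
Proof.
by move=> ex; apply: functional_extensionality_dep => z; exact: form_app_inj.
Qed.

(* [hat] multiplies the component in form degree [k] and internal degree [z] by
   (-1)^(kz). This absorbs the Koszul signs: operators of the graded algebra of
   End-valued forms become plain wedge products with composition of values. *)
Definition hat eta (s : seq AA) : H := fun z =>
  (if odd z then deg_sign (form_app (eta z)) else form_app (eta z)) s.

Definition gz h : G := fun z => zform A (h z).

Lemma hat_gz h : hat (gz h) = cochain0 h.
Proof.
apply/funext => s; apply: tsec_eq => z; rewrite /hat zformE deg_sign_cochain0.
by case: (odd z); case: s.
Qed.

Lemma hatD eta xi : hat (fun z => eta z + xi z) = hat eta + hat xi.
Proof.
apply/funext => s; apply: tsec_eq => z; rewrite ptwD tsecDE /hat form_appD deg_signD.
by case: (odd z).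
Qed.

Lemma DD eta xi : D (fun z => eta z + xi z) = (fun z => D eta z + D xi z).
Proof.
apply: functional_extensionality_dep => z; case: repD => lin _ _ _.
have := lin 1 eta xi z; rewrite scale1r => <-; congr (D _ z).
by apply: functional_extensionality_dep => y; rewrite scale1r.
Qed.

Lemma D0 : D (fun=> 0) = fun=> 0.
Proof.
have := DD (fun=> 0) (fun=> 0); rewrite (_ : (fun z => 0 + 0) = (fun=> 0 : form A (E _))).
  move=> e; apply: functional_extensionality_dep => z.
  have /(congr1 (fun x : G => x z)) := e; rewrite -[LHS]addr0 => /addrI <-.
  by [].
by apply: functional_extensionality_dep => z; rewrite addr0.
Qed.

Lemma gz_smul f h : gz (tsmul f h) = fun z => wedge (zform A f) (gz h z).
Proof.
apply: gform_eq => z; rewrite form_app_wedge !zformE.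
apply/funext => s; rewrite wedge_cochain0l; first by case: s => //=; rewrite smul0r.
exact: smulDl.
Qed.

Lemma gzD h k : gz (h + k) = fun z => gz h z + gz k z.
Proof.
apply: gform_eq => z; rewrite form_appD !zformE.
by apply/funext => -[|a s]; rewrite ptwD //= addr0.
Qed.

Definition tw (b : bool) h : H := if b then eps h else h.

(** If w has degree l, the twist (-1)^((l+k)z) of the product exceeds the twist (-1)^(kz) of eta by
    (-1)^(lz), which is the l-th power of [eps]. *)
Lemma hat_wedge l w eta : has_degree l w ->
  hat (fun z => wedge w (eta z)) =
  tw (odd l) \o wedge_with (@tsmul R M n E) (form_app w) (hat eta).
Proof.
move=> dw; have sw := deg_sign_degree (fun s => app_has_degree (s := s) dw).
have proj z s X : wedge_with (@tsmul R M n E) (form_app w) X s z =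
    wedge_with (@smul R M (E z)) (form_app w) (fun s => X s z) s.
  by apply: (wedge_map (FU := id) (FV := fun h : H => h z) (FW := fun h : H => h z)).
apply/funext => s; apply: tsec_eq => z.
rewrite /hat form_app_wedge deg_sign_wedge => [|*|*]; [|exact: smulDl|exact: smulDr].
rewrite -[RHS]/(tw (odd l) (wedge_with (@tsmul R M n E) (form_app w) (hat eta) s) z).
rewrite sw /tw; case: (odd l) {sw}; rewrite ?epsE proj /hat; case: (odd z) => //.
by rewrite wedgeNl //; exact: smulDl.
Qed.

Lemma leibniz_wedge l w eta : has_degree l w ->
  D (fun z => wedge w (eta z)) =
  fun z => wedge (dform w) (eta z) + (-1) ^+ l *: wedge w (D eta z).
Proof.
move=> dw; apply: functional_extensionality_dep => z.
by case: repD => _ _ _ leib; exact: (leib l _ _ _ _ dw (is_dA_dform w)).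
Qed.

Lemma dform_degree l w : has_degree l w -> has_degree l.+1 (dform w).
Proof.
move=> dw; apply: has_degree_app => s sl; rewrite dformE.
apply: (ce_diff_degree _ _ (m := l)) => //; first exact: rhoDr.
by move=> t tl; exact: app_has_degree dw tl.
Qed.

Lemma hatZ (c : R) eta : hat (fun z => c *: eta z) = c *: hat eta.
Proof.
apply/funext => s; apply: tsec_eq => z; rewrite -[RHS]/(c *: hat eta s z) /hat.
by case: (odd z); rewrite ?deg_signE form_appZ //; case: odd => //; rewrite scalerN.
Qed.

Local Notation wt := (wedge_with (@tsmul R M n E)).

Lemma hat_leibniz l w eta : has_degree l w ->
  hat (D (fun z => wedge w (eta z))) =
  (tw (odd l.+1) \o wt (cd (form_app w)) (hat eta)) +
  (-1) ^+ l *: (tw (odd l) \o wt (form_app w) (hat (D eta))).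
Proof.
move=> dw; rewrite (leibniz_wedge _ dw) hatD hatZ (hat_wedge _ dw).
by rewrite (hat_wedge _ (dform_degree dw)) dformE.
Qed.

(** The twisted image of the one-form d_nabla h: in form degree one the twist is [eps]. *)
Definition nab1 h (s : seq AA) : H := if s is [:: a] then eps (nab a h) else 0.

Lemma wt_cd0 (f : Cinf M) (X : seq AA -> H) h s :
  wt (cd (cochain0 f)) (cochain0 h) s = if s is [:: a] then tsmul (ρ a f) h else 0.
Proof.
rewrite wedge_cochain0r; last exact: tsmulDr.
rewrite cd_cochain0; case: s => [|a [|b s]] //; apply: tsec_eq => z; exact: smul0l.
Qed.

Lemma wt_cochain0 (f : Cinf M) (X : seq AA -> H) s : wt (cochain0 f) X s = tsmul f (X s).
Proof. by rewrite wedge_cochain0l //; exact: tsmulDl. Qed.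

(** Replacing h by f h adds the same term to D and to nabla, namely the twisted d_A f h; it cancels
    in the difference, which is therefore C^oo(M)-linear in h. *)
Definition theta_endo (s : seq AA) : B.
Proof.
exists (fun h => hat (D (gz h)) s - nab1 h s) => [h k|f h].
  rewrite gzD DD hatD ptwD.
  have -> : nab1 (h + k) s = nab1 h s + nab1 k s.
    case: s => [|a [|b s]]; rewrite /nab1 ?addr0 // tnabDr; exact: endoD.
  by rewrite opprD addrACA.
rewrite gz_smul (hat_leibniz _ (@zform_degree R M A _ f)) zformE hat_gz expr0 scale1r ptwD /=.
rewrite wt_cd0 // wt_cochain0 tsmulDr tsmulNr.
have -> : nab1 (tsmul f h) s =
    tsmul f (nab1 h s) + eps (if s is [:: a] then tsmul (ρ a f) h else 0).
  case: s => [|a [|b s]]; rewrite /nab1 ?endo0 ?addr0 ?tsmul0r //.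
  by rewrite tnab_smul endoD !endoS.
by rewrite opprD [LHS](AC (2*2) ((2*3)*(1*4))) /= subrr addr0.
Defined.

Definition theta (s : seq AA) : B := locked (theta_endo s).

Lemma thetaE s h : theta s h = hat (D (gz h)) s - nab1 h s.
Proof. by rewrite /theta -lock. Qed.

(** The superconnection nabla + theta seen through the twist. Since d_nabla raises the form degree
    by one, it picks up the sign (-1)^z, that is, [eps]. *)
Definition calD (X : seq AA -> H) : seq AA -> H :=
  (eps \o hdd X) + wedge_with app theta X.

Let appDr (P : B) h k : P (h + k) = P h + P k. Proof. exact: endoD. Qed.
Let epsD h k : (eps : B) (h + k) = eps h + eps k. Proof. exact: endoD. Qed.

Lemma hdd_eps (X : seq AA -> H) : eps \o hdd X = hdd (eps \o X).
Proof. by apply: ce_diff_map => [|a h]; [exact: epsD|rewrite tnab_eps]. Qed.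

Lemma calDD X Y : calD (X + Y) = calD X + calD Y.
Proof.
rewrite /calD ce_diffD; last exact: tnabDr.
rewrite wedgeDr // addrACA; congr (_ + _).
by apply/funext => s; exact: epsD.
Qed.

Lemma calD_0 : calD 0 = 0.
Proof. by apply: (addIr (calD 0)); rewrite -calDD !add0r. Qed.

Lemma calD_sum (I : Type) (r : seq I) (F : I -> seq AA -> H) :
  calD (\sum_(i <- r) F i) = \sum_(i <- r) calD (F i).
Proof. by elim: r => [|i r IH]; rewrite ?big_nil ?calD_0 // !big_cons calDD IH. Qed.

Lemma hat_D_gz h : hat (D (gz h)) = calD (cochain0 h).
Proof.
apply/funext => s; rewrite /calD ptwD wedge_cochain0r // /= ce_diff_cochain0; last exact: tnabDr.
rewrite thetaE addrC -[LHS](subrK (nab1 h s)); congr (_ + _).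
by case: s => [|a [|b s]]; rewrite /nab1 ?endo0.
Qed.

Lemma total_degree_app p eta :
  (forall (z : 'I_n) s, (size s + z)%N != p -> form_app (eta z) s = 0) -> has_total_degree p eta.
Proof.
move=> e0 z x s sk; pose s' := map (sec_through (E := A) (x := x)) s.
have ws : form_app (eta z) s' = 0 by apply: e0; rewrite size_map.
by have := congr1 (fun u : sec (E z) => u x) ws; rewrite /= map_sec_throughE.
Qed.

Lemma app_total_degree p eta (z : 'I_n) s :
  has_total_degree p eta -> (size s + z)%N != p -> form_app (eta z) s = 0.
Proof. by move=> e0 sk; apply: sec_eq => x /=; rewrite e0 // size_map. Qed.

Lemma gz_degree (w : 'I_n) (v : sec (E w)) : has_total_degree w (gz (tinj v)).
Proof.
apply: total_degree_app => z s; rewrite zformE; case: s => [|//] /=.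
by rewrite add0n => zw; rewrite tinj_out // eq_sym; apply: contra zw => /eqP ->.
Qed.

Lemma D_degree p eta : has_total_degree p eta -> has_total_degree p.+1 (D eta).
Proof. by case: repD => _ deg _ _; exact: deg. Qed.

Lemma theta_degree (w : 'I_n) (v : sec (E w)) s (z : 'I_n) : (size s + z)%N != w.+1 -> theta s (tinj v) z = 0.
Proof.
move=> sz; rewrite thetaE tsecDE tsecNE.
have -> : hat (D (gz (tinj v))) s z = 0.
  have e := app_total_degree (D_degree (gz_degree v)) sz.
  by rewrite /hat; case: (odd z); rewrite ?deg_signE e //; case: odd; rewrite ?oppr0.
rewrite sub0r; apply/eqP; rewrite oppr_eq0; apply/eqP.
case: s sz => [|a [|b s]] //=; rewrite add1n eqSS => zw.
have n0 : nab a (tinj v) z = 0.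
  rewrite /tnab tinj_out; last by rewrite eq_sym; apply: contra zw => /eqP ->.
  by have := congr1 (fun h : H => h z) (tnab0r nabla a).
by rewrite epsE n0; case: (odd z); rewrite ?oppr0.
Qed.

(* That [D] has total degree 1 reads, after the twist [hat],
   eps (-1)^deg(theta) theta eps = - theta. *)
Lemma theta_odd s h : theta s (eps h) = - eps (deg_sign theta s h).
Proof.
rewrite -(tinj_sum h) !endo_sum -sumrN; apply: eq_bigr => w _.
have -> : eps (tinj (h w)) = if odd w then - tinj (h w) else tinj (h w).
  apply: tsec_eq => z; rewrite epsE; have [<-|wz] := eqVneq w z; first by case: odd.
  by case: (odd z); case: (odd w); rewrite ?tsecNE ?tinj_out ?oppr0.
apply: tsec_eq => z; rewrite tsecNE epsE deg_signE.
have [sz|/theta_degree sz] := eqVneq (size s + z)%N w.+1; last first.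
  by case: (odd w); case: (odd z); case: (odd (size s)); rewrite ?endoN ?endoNE ?tsecNE ?sz ?oppr0.
have := congr1 odd sz; rewrite oddD /=; move: (theta s) => P.
by case: (odd w); case: (odd z); case: (odd (size s)) => //= _; rewrite ?endoN ?endoNE ?tsecNE ?opprK.
Qed.

Lemma theta_wedge_eps (Y : seq AA -> H) :
  wedge_with app theta (eps \o Y) = - (eps \o wedge_with app (deg_sign theta) Y).
Proof.
have -> : - (eps \o wedge_with app (deg_sign theta) Y) =
    eps \o wedge_with app (- deg_sign theta) Y.
  by rewrite wedgeNl //; apply/funext => s; rewrite ptwN /= endoN.
apply/funext => s; rewrite -[in RHS](map_id s) /=.
apply: (wedge_rel (h := id) (mu := app) (mu' := app) (RU := fun P P' : B => forall h, P (eps h) = eps (P' h))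
  (RV := fun v v' : H => v = eps v') (RW := fun w w' : H => w = eps w')).
- by move=> u u' uu h; rewrite !endoNE uu endoN.
- by move=> w w' x x' -> ->; rewrite epsD.
- by move=> u u' v v' uu ->.
- by move=> t h; rewrite map_id ptwN endoNE theta_odd endoN.
- by move=> t; rewrite map_id.
Qed.

(** Endomorphisms commute with multiplication by functions, so only the Koszul sign of the form
    degrees remains; both sides are the product of W and X acting on Y, reordered by [wedgeC]. *)
Lemma app_wedge_comm (X : seq AA -> B) (W : seq AA -> Cinf M) (Y : seq AA -> H) (b : bool) :
  deg_sign W = (if b then - W else W) ->
  wedge_with app X (wt W Y) = wt W (wedge_with app (if b then deg_sign X else X) Y).
Proof.
move=> sW; pose es f (P : B) := esmul f P.
have esDl f g P : es (f + g) P = es f P + es g P.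
  by apply: endo_eq => h; exact: tsmulDl.
have esDr f P Q : es f (P + Q) = es f P + es f Q.
  by apply: endo_eq => h; exact: tsmulDr.
transitivity (wedge_with app (wedge_with es W (if b then deg_sign X else X)) Y); last first.
  by apply: wedgeA => // *; exact: tsmulDr.
rewrite (wedgeC esDl esDr _ sW).
have -> : (if b then deg_sign (if b then deg_sign X else X) else (if b then deg_sign X else X)) = X.
  by case: b {sW}; rewrite ?deg_signK.
apply/esym; apply: wedgeA => //.
by move=> P f h; rewrite -[LHS]/(tsmul f (P h)) -endoS.
Qed.

Lemma theta_wedge_comm l (W : seq AA -> Cinf M) (Y : seq AA -> H) :
  deg_sign W = (if odd l then - W else W) ->
  wedge_with app theta (tw (odd l) \o wt W Y) =
  (-1) ^+ l *: (tw (odd l) \o wt W (wedge_with app theta Y)).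
Proof.
move=> sW; rewrite -signr_odd; case: (odd l) sW => sW.
  rewrite -[LHS]/(wedge_with app theta (eps \o wt W Y)) theta_wedge_eps (app_wedge_comm (b := true) _ _ sW).
  by rewrite deg_signK expr1 scaleN1r.
by rewrite expr0 scale1r -(app_wedge_comm (b := false) _ _ sW).
Qed.

Lemma tw_hdd b (X : seq AA -> H) : tw b \o hdd X = hdd (tw b \o X).
Proof. by case: b; [exact: hdd_eps|]. Qed.

Lemma hdd_wedge (W : seq AA -> Cinf M) (X : seq AA -> H) :
  hdd (wt W X) = wt (cd W) X + wt (deg_sign W) (hdd X).
Proof.
apply: ce_diff_wedge.
- exact: tsmulDl.
- exact: tsmulDr.
- exact: rhoDr.
- exact: tnabDr.
- by move=> a f h; rewrite tnab_smul addrC.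
Qed.

Lemma wt_eps (W : seq AA -> Cinf M) (X : seq AA -> H) : wt W (eps \o X) = eps \o wt W X.
Proof.
apply/esym/funext => s; apply: (wedge_map (FU := id) (FV := eps) (FW := eps)) => //.
by move=> f h; rewrite endoS.
Qed.

(** The same rule as [hat_leibniz] for D, which is what makes the two operators comparable. The sign
    in front of the last term comes from the oddness of theta. *)
Lemma calD_wedge l (W : seq AA -> Cinf M) (X : seq AA -> H) :
  deg_sign W = (if odd l then - W else W) ->
  calD (tw (odd l) \o wt W X) =
  (tw (odd l.+1) \o wt (cd W) X) + (-1) ^+ l *: (tw (odd l) \o wt W (calD X)).
Proof.
move=> sW; rewrite /calD (theta_wedge_comm _ sW) -tw_hdd hdd_wedge sW.
rewrite (wedgeDr (@tsmulDr R M n E)) wt_eps.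
rewrite -signr_odd /=; case: (odd l) {sW} => /=; rewrite ?expr1 ?expr0 ?scaleN1r ?scale1r.
  rewrite (wedgeNl (@tsmulDl R M n E)); apply/funext => s.
  by rewrite !(ptwD, ptwN) /= !(ptwD, ptwN) !epsK !(epsD, endoN) !epsK opprD addrA.
apply/funext => s; rewrite !(ptwD, ptwN) /= !(ptwD, ptwN) epsD addrA.
by [].
Qed.

Lemma hat_D_wedge_gz l w h : has_degree l w ->
  hat (D (fun z => wedge w (gz h z))) = calD (hat (fun z => wedge w (gz h z))).
Proof.
move=> dw; rewrite (hat_leibniz _ dw) (hat_wedge _ dw) hat_D_gz hat_gz.
by rewrite (calD_wedge _ (deg_sign_degree (fun s => app_has_degree (s := s) dw))).
Qed.

Lemma D_sum (I : Type) (r : seq I) (F : I -> G) :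
  D (fun z => \sum_(i <- r) F i z) = fun z => \sum_(i <- r) D (F i) z.
Proof.
elim: r => [|i r IH].
  rewrite (_ : (fun z => \sum_(i <- [::]) F i z) = (fun=> 0 : form A (E _))).
    by rewrite D0; apply: functional_extensionality_dep => z; rewrite big_nil.
  by apply: functional_extensionality_dep => z; rewrite big_nil.
rewrite (_ : (fun z => \sum_(j <- i :: r) F j z) = (fun z => F i z + \sum_(j <- r) F j z)).
  by rewrite DD IH; apply: functional_extensionality_dep => z; rewrite big_cons.
by apply: functional_extensionality_dep => z; rewrite big_cons.
Qed.

Lemma hat_sum (I : Type) (r : seq I) (F : I -> G) :
  hat (fun z => \sum_(i <- r) F i z) = \sum_(i <- r) hat (F i).
Proof.
elim: r => [|i r IH].
  rewrite big_nil (_ : (fun z => \sum_(i <- [::]) F i z) = (fun z => 0 *: (0 : form A (E z)))).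
    by rewrite (hatZ 0 (fun z => 0)) scale0r.
  by apply: functional_extensionality_dep => z; rewrite big_nil scale0r.
rewrite big_cons -IH -hatD; congr hat.
by apply: functional_extensionality_dep => z; rewrite big_cons.
Qed.

(* Both sides obey the same Leibniz rule and agree on products of a homogeneous
   form with a section; by a dual frame, a multiple of [eta] by a function
   equal to 1 at the given point is a sum of such products. *)
Lemma hat_D p eta : has_total_degree p eta -> hat (D eta) = calD (hat eta).
Proof.
move=> deg; apply/funext => s; apply: tsec_eq => z; apply: sec_eq => x.
have [g /near_at gx dfs] := near_dual_frames E x.
have ex y : exists d : dual_frame (E y) g, True by have [d] := dfs y; exists d.
pose df y := sval (cid (ex y)).
have fcovsL y i (c : Cinf M) (u v : sec (E y)) :
    fcovs (df y) i (smul c u + v) = smul c (fcovs (df y) i u) + fcovs (df y) i v.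
  by rewrite fcovsD fcovs_smul.
have fcovs0 y i : fcovs (df y) i 0 = 0.
  by apply: (addIr (fcovs (df y) i 0)); rewrite -fcovsD !add0r.
have lin y i : cmlin (@smul R M (line M)) (fcovs (df y) i \o form_app (eta y)).
  by move=> s1 s2 c u v; rewrite /= form_app_cmlin fcovsL.
have skw y i : cskew (fcovs (df y) i \o form_app (eta y)).
  move=> s1 s2 u v; rewrite /= form_app_cskew -scaleN1r -[in LHS]smul_cst.
  by rewrite -[smul _ _]addr0 fcovsL fcovs0 addr0 smul_cst scaleN1r.
pose om y i := form_of (lin y i) (skw y i).
(* For y > p the subtraction is truncated to 0, which is harmless: the component of eta in E_y then
   vanishes. *)
have om_deg (y : 'I_n) i : has_degree (p - y) (om y i).
  apply: has_degree_app => t tp; rewrite form_ofE /= (app_total_degree deg) //.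
  by apply: contra tp => /eqP <-; rewrite addnK.
have dec : (fun y => wedge (zform A g) (eta y)) = (fun y' => \sum_y (fun y' => \sum_i
    (fun y' => wedge (om y i) (gz (tinj (fvec (df y) i)) y')) y') y').
  apply: gform_eq => y'; rewrite form_app_wedge zformE form_app_sum.
  apply/funext => t; rewrite wedge_cochain0l; last exact: smulDl.
  rewrite ptw_sum.
  have term y i : form_app (wedge (om y i) (gz (tinj (fvec (df y) i)) y')) t =
      smul (fcovs (df y) i (form_app (eta y) t)) (tinj (fvec (df y) i) y').
    rewrite form_app_wedge zformE form_ofE wedge_cochain0r //; exact: smulDr.
  rewrite (bigD1 y') //= [X in _ + X]big1 => [|y yy'].
    rewrite addr0 form_app_sum ptw_sum -(fdual_sec (df y')).
    by apply: eq_bigr => i _; rewrite term tinjE.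
  rewrite form_app_sum ptw_sum big1 // => i _; rewrite term tinj_out // smul0r.
  by [].
have LW : hat (D (fun y => wedge (zform A g) (eta y))) =
          calD (hat (fun y => wedge (zform A g) (eta y))).
  rewrite dec D_sum !hat_sum calD_sum; apply: eq_bigr => y _.
  rewrite D_sum !hat_sum calD_sum; apply: eq_bigr => i _.
  exact: hat_D_wedge_gz.
have dg := zform_degree (A := A) g.
(* Both Leibniz rules contain the same term in d_A g. Cancelling it leaves g times the two sides of
   the claim, and g is 1 at x. *)
move: LW; rewrite (hat_leibniz _ dg) (hat_wedge _ dg).
rewrite (calD_wedge (l := 0) _ (deg_sign_degree (fun s => app_has_degree (s := s) dg))) => /addrI.
rewrite expr0 !scale1r zformE => /(congr1 (@^~ s)).
rewrite -[LHS]/(wt (cochain0 g) (hat (D eta)) s) -[RHS]/(wt (cochain0 g) (calD (hat eta)) s).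
rewrite !wt_cochain0; have key (u v : H) : tsmul g u = tsmul g v -> u z x = v z x.
  move=> /(congr1 (fun h : H => h z x)) e; have : g x *: u z x = g x *: v z x := e.
  by rewrite gx !scale1r.
exact: key.
Qed.

Lemma hdd_hdd h s : hdd (hdd (cochain0 h)) s = curv_cochain nabla s h.
Proof.
have d1 t : hdd (cochain0 h) t = if t is [:: a] then nab a h else 0.
  by apply: ce_diff_cochain0; exact: tnabDr.
have [s2|s2] := eqVneq (size s) 2.
  case: s s2 => [|a [|b []]] // _.
  rewrite -[LHS]/(nab a (hdd (cochain0 h) [:: b]) - hdd (cochain0 h) [:: br a b] -
    (nab b (hdd (cochain0 h) [:: a]) - 0)).
  by rewrite !d1 subr0 addrAC.
have -> : curv_cochain nabla s h = 0 by case: s s2 => [|a [|b []]].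
apply: (ce_diff_degree _ _ (m := 1)) => //; first exact: tnabDr.
by move=> t; rewrite d1; case: t => [|a []].
Qed.

(** As [eps] commutes with d_nabla and squares to 1, its square disappears from the curvature term.
    The products of theta with d_nabla h cancel by [theta_wedge_eps], and only the derivative of
    theta survives. *)
Lemma calD_calD h s : calD (calD (cochain0 h)) s =
  (curv_cochain nabla s + ecomp eps (edd theta s) + wedge_with (@ecomp R M n E) theta theta s) h.
Proof.
have appM (P Q : B) k : P (Q k) = ecomp P Q k by [].
rewrite {1}/calD ptwD; have -> : hdd (calD (cochain0 h)) =
    eps \o hdd (hdd (cochain0 h)) +
    (wedge_with app (edd theta) (cochain0 h) + wedge_with app (deg_sign theta) (hdd (cochain0 h))).
  rewrite /calD ce_diffD; last exact: tnabDr.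
  rewrite -hdd_eps; congr (_ + _); apply: ce_diff_wedge => //.
  - exact: eactD.
  - exact: tnabDr.
  - by move=> a P k; exact: tnab_app.
rewrite {1}/calD (wedgeDr appDr) theta_wedge_eps.
have -> : wedge_with app theta (wedge_with app theta (cochain0 h)) =
    wedge_with app (wedge_with (@ecomp R M n E) theta theta) (cochain0 h).
  by apply/esym; apply: wedgeA => // *; [exact: ecompDl | exact: ecompDr].
rewrite !(ptwD, ptwN) /= !(ptwD, ptwN) /= !epsD epsK hdd_hdd !wedge_cochain0r //.
by rewrite -!addrA; congr (_ + (_ + _)); rewrite addrA subrr add0r.
Qed.

(** D^2 = 0 is evaluated on sections of a single E_w, because [hat_D] requires an argument of
    definite total degree. *)
Lemma flatness s :
  curv_cochain nabla s + ecomp eps (edd theta s) + wedge_with (@ecomp R M n E) theta theta s = 0.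
Proof.
apply: endo_eq => h; rewrite -(tinj_sum h) !endo_sum; apply: eq_bigr => w _.
rewrite -calD_calD -hat_D_gz -(hat_D (D_degree (gz_degree (h w)))).
have -> : D (D (gz (tinj (h w)))) = fun z => 0 *: (0 : form A (E z)).
  apply: functional_extensionality_dep => z; rewrite scale0r.
  by case: repD => _ _ sq _; exact: sq.
by rewrite (hatZ 0 (fun z => 0)) scale0r.
Qed.

Local Notation blin := (cmlin (A := A) (@esmul R M n E)).

Lemma theta_lin : blin theta.
Proof.
move=> s1 s2 c u v; apply: endo_eq => h.
rewrite -[RHS]/(tsmul c (theta (s1 ++ u :: s2) h) + theta (s1 ++ v :: s2) h) !thetaE.
have smul_opp b (f : seq AA -> sec (E b)) : cmlin (@smul R M (E b)) f -> cmlin (@smul R M (E b)) (deg_sign f).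
  by apply: cmlin_sign; exact: smulDr.
have -> : hat (D (gz h)) (s1 ++ (smul c u + v) :: s2) =
    tsmul c (hat (D (gz h)) (s1 ++ u :: s2)) + hat (D (gz h)) (s1 ++ v :: s2).
  apply: tsec_eq => z; rewrite tsecDE /tsmul /hat.
  by case: (odd z); [rewrite smul_opp //|]; exact: form_app_cmlin.
have -> : nab1 h (s1 ++ (smul c u + v) :: s2) =
    tsmul c (nab1 h (s1 ++ u :: s2)) + nab1 h (s1 ++ v :: s2).
  case: s1 => [|a [|b s1]] /=; case: s2 => [|a' s2]; rewrite ?tsmul0r ?addr0 //.
  by rewrite tnabDl tnabZl epsD endoS.
by rewrite tsmulDr tsmulNr opprD addrACA.
Qed.

Lemma theta_skew : cskew theta.
Proof.
move=> s1 s2 u v; apply: endo_eq => h; rewrite endoNE !thetaE opprD opprK.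
have -> : hat (D (gz h)) (s1 ++ u :: v :: s2) = - hat (D (gz h)) (s1 ++ v :: u :: s2).
  apply: tsec_eq => z; rewrite tsecNE /hat.
  by case: (odd z); [rewrite cskew_sign //|]; exact: form_app_cskew.
by case: s1 => [|a [|b s1]]; rewrite /nab1 /= oppr0.
Qed.

Lemma curv_cochain_skew : cskew (curv_cochain nabla).
Proof.
move=> s1 s2 u v; case: s1 => [|a [|b [|c s1]]] /=; case: s2 => [|a' s2]; rewrite ?oppr0 //.
exact: curv_skew.
Qed.

Lemma curv_cochain_lin : blin (curv_cochain nabla).
Proof.
have es0 c : esmul c (0 : B) = 0 by apply: endo_eq => h; exact: tsmul0r.
apply: cmlin_head; [|exact: curv_cochain_skew|].
  by move=> c P Q; apply: endo_eq => h; exact: tsmulDr.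
by move=> c u v [|a [|b s]] /=; rewrite ?es0 ?addr0 // curv_lin.
Qed.

End NRep.

(** * Traces *)

Section LinearTrace.
Import passmx.
Variable R : realType.

Lemma lftraceD (V : vectType R) (f g : 'End(V)) : lftrace (f + g) = lftrace f + lftrace g.
Proof. by rewrite /lftrace linearD /= mxtraceD. Qed.
Lemma lftraceZ (V : vectType R) c (f : 'End(V)) : lftrace (c *: f) = c * lftrace f.
Proof. by rewrite /lftrace linearZ /= mxtraceZ. Qed.
Lemma lftrace0 (V : vectType R) : lftrace (0 : 'End(V)) = 0.
Proof. by rewrite -[0](scale0r 0) lftraceZ mul0r. Qed.
Lemma lftrace_sum (V : vectType R) (I : Type) (r : seq I) (F : I -> 'End(V)) :
  lftrace (\sum_(i <- r) F i) = \sum_(i <- r) lftrace (F i).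
Proof. by elim: r => [|i r IH]; rewrite ?big_nil ?lftrace0 // !big_cons lftraceD IH. Qed.

Lemma lftraceC (U V : vectType R) (f : 'Hom(U, V)) (g : 'Hom(V, U)) :
  lftrace (f \o g)%VF = lftrace (g \o f)%VF.
Proof.
have bU := vbasisP {:U}; have bV := vbasisP {:V}.
by rewrite /lftrace (mxof_comp _ _ bU) (mxof_comp _ _ bV) mxtrace_mulC.
Qed.

Lemma lftrace_line (f : 'End(R^o)) : lftrace f = f 1.
Proof.
have -> : f = f 1 *: \1%VF.
  apply/lfunP => c; rewrite scale_lfunE id_lfunE -[c in LHS]mulr1 -[c * 1]/(c *: (1 : R^o)).
  by rewrite linearZ; exact: mulrC.
rewrite lftraceZ scale_lfunE id_lfunE /lftrace mxof1 ?(basis_free (vbasisP _)) //.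
by rewrite mxtrace1 dimvf.
Qed.

Lemma linfun_exists (U V : vectType R) (f : U -> V) :
  linear f -> {F : 'Hom(U, V) | forall u, F u = f u}.
Proof.
move=> lf; pose fM := GRing.isLinear.Build _ _ _ _ f lf.
pose fL : {linear U -> V} := HB.pack f fM.
by exists (linfun fL) => u; rewrite lfunE.
Qed.

Lemma rank1_linear (V : vectType R) (w : V) : linear ((fun c => c *: w) : R^o -> V).
Proof. by move=> c a b; rewrite scalerDl scalerA. Qed.

Definition rank1 (V : vectType R) (w : V) : 'Hom(R^o, V) :=
  sval (linfun_exists (rank1_linear w)).

Lemma rank1E (V : vectType R) (w : V) (c : R^o) : rank1 w c = c *: w.
Proof. exact: svalP (linfun_exists (rank1_linear w)) c. Qed.

Lemma lftrace_rank1 (V : vectType R) (F : 'End(V)) (w : V) (a : 'Hom(V, R^o)) :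
  lftrace (F \o (rank1 w \o a))%VF = a (F w).
Proof.
by rewrite comp_lfunA lftraceC lftrace_line !comp_lfunE /= rank1E scale1r.
Qed.

(** The hypothesis writes c times the identity as a sum of rank one maps; F is composed with it and
    the trace is taken. The family is not a basis in the applications, where it is a cut-off frame,
    possibly joined with its derivatives. *)
Lemma lftrace_frame (V : vectType R) (F : 'End(V)) (I : finType) (w : I -> V)
    (a : I -> 'Hom(V, R^o)) (c : R) :
  (forall v, \sum_i a i v *: w i = c *: v) -> \sum_i a i (F (w i)) = c * lftrace F.
Proof.
move=> aw; under eq_bigr do rewrite -lftrace_rank1.
rewrite -lftrace_sum -lftraceZ; congr lftrace; apply/lfunP => v.
rewrite sum_lfunE scale_lfunE -linearZ -aw linear_sum; apply: eq_bigr => i _.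
by rewrite !comp_lfunE /= rank1E.
Qed.

End LinearTrace.

Section HomAt.
Variables (R : realType) (M : manifold R) (E F : vbundle M) (P : sec E -> sec F).
Hypothesis PD : forall s t : sec E, P (s + t) = P s + P t.
Hypothesis PZ : forall f (s : sec E), P (smul f s) = smul f (P s).

Lemma hom_at_exists (x : M) : {Phi : 'Hom(E x, F x) | forall s : sec E, Phi (s x) = P s x}.
Proof.
have PZ' (c : R) (s : sec E) : P (c *: s) = c *: P s by rewrite -!smul_cst PZ.
have lin : linear (fun v : E x => P (sec_through v) x).
  move=> c u v; have -> : P (sec_through (c *: u + v)) x = P (c *: sec_through u + sec_through v) x.
    by apply: Clinear_ptw => //=; rewrite !sec_throughE.
  by rewrite PD PZ'.
have [Phi PhiE] := linfun_exists lin; exists Phi => s; rewrite PhiE.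
by apply: Clinear_ptw => //; rewrite sec_throughE.
Qed.

End HomAt.

Section TotalTrace.
Variables (R : realType) (M : manifold R) (n : nat) (E : 'I_n -> vbundle M).
Local Notation H := (tsec E).
Local Notation B := (endo E).
Implicit Types (P Q : B) (z w : 'I_n) (x y : M) (h : H).

Definition block P z w (s : sec (E w)) : sec (E z) := P (tinj s) z.

Lemma blockD P z w s t : block P z (s + t : sec (E w)) = block P z s + block P z t.
Proof. by rewrite /block tinjD endoD. Qed.
Lemma blockZ P z w f s : block P z (smul f s : sec (E w)) = smul f (block P z s).
Proof. by rewrite /block tinj_smul endoS. Qed.

Definition fibre P z w x : 'Hom(E w x, E z x) :=
  sval (hom_at_exists (@blockD P z w) (@blockZ P z w) x).
Lemma fibreE P z w x (s : sec (E w)) : fibre P z w x (s x) = P (tinj s) z x.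
Proof. exact: svalP (hom_at_exists (@blockD P z w) (@blockZ P z w) x) s. Qed.

Lemma fibre_sum P h z x : P h z x = \sum_w fibre P z w x (h w x).
Proof.
rewrite -[in LHS](tinj_sum h) endo_sum tsec_sumE sec_sumE.
by apply: eq_bigr => w _; rewrite fibreE.
Qed.

Lemma hom_ext (F : vbundle M) z x (f g : 'Hom(E z x, F x)) :
  (forall s : sec (E z), f (s x) = g (s x)) -> f = g.
Proof. by move=> fg; apply/lfunP => v; rewrite -(sec_throughE v) fg. Qed.

Lemma fibreD P Q z w x : fibre (P + Q) z w x = fibre P z w x + fibre Q z w x.
Proof. by apply: hom_ext => s; rewrite add_lfunE !fibreE. Qed.
Lemma fibreS f P z w x : fibre (esmul f P) z w x = f x *: fibre P z w x.
Proof. by apply: hom_ext => s; rewrite scale_lfunE !fibreE. Qed.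
Lemma fibre_comp P Q z w x :
  fibre (ecomp P Q) z w x = \sum_k (fibre P z k x \o fibre Q k w x)%VF.
Proof.
apply: hom_ext => s; rewrite fibreE sum_lfunE -[LHS]/(P (Q (tinj s)) z x) fibre_sum.
by apply: eq_bigr => k _; rewrite comp_lfunE (fibreE Q).
Qed.
Lemma fibre_epsl P z w x : fibre (ecomp eps P) z w x = (if odd z then - fibre P z w x else fibre P z w x).
Proof.
apply: hom_ext => s; rewrite fibreE -[LHS]/(eps (P (tinj s)) z x) epsE.
case: (odd z); rewrite ?opp_lfunE fibreE //; exact: scaleN1r.
Qed.

Definition tr_val P z x : R := lftrace (fibre P z z x).

Lemma covector_exists g z (df : dual_frame (E z) g) i y :
  {a : 'Hom(E z y, R^o) | forall v, a v = fcov df i v}.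
Proof. by apply: linfun_exists => c u v; exact: fcov_linear. Qed.

Lemma tr_frame P z g (df : dual_frame (E z) g) y :
  \sum_i fcov df i (P (tinj (fvec df i)) z y) = g y * tr_val P z y.
Proof.
pose a (i : 'I_(fsize df)) : 'Hom(E z y, R^o) := sval (covector_exists i y).
have aE i v : a i v = fcov df i v := svalP (covector_exists i y) v.
rewrite -(@lftrace_frame _ _ _ _ (fun i => fvec df i y) a) => [|v].
  by apply: eq_bigr => i _; rewrite aE fibreE.
by rewrite -(fdual df v); apply: eq_bigr => i _; rewrite aE.
Qed.

(** The trace is computed in bases chosen fibre by fibre, with no relation between them. Where g =
    1, a cut-off dual frame expresses it as a sum of smooth functions. *)
Lemma tr_smooth P z : smooth_section (fun x => tr_val P z x : line M x).
Proof.
apply/line_smoothP; apply: smooth_fun_local => x _.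
have [g gx [df]] := dual_frame_exists (E z) x.
have {gx} : nbhs x [set y | g y = 1] := gx.
rewrite nbhsE => -[W [oW Wx] Wg].
exists W => //.
apply: (smooth_fun_ext oW (f := fun y => \sum_i fcov df i (P (tinj (fvec df i)) z y))) => [y Wy|].
  by rewrite tr_frame Wg // mul1r.
apply: (smooth_fun_sum oW) => i; apply: (smooth_funW oW (@subsetT _ W)).
exact/line_smoothP/(fcov_smooth df i (P (tinj (fvec df i)) z)).
Qed.

Definition tr P z : Cinf M := Sec (tr_smooth P z).

Lemma trD P Q z : tr (P + Q) z = tr P z + tr Q z.
Proof. by apply: sec_eq => x; rewrite -[LHS]/(tr_val _ _ _) /tr_val fibreD lftraceD. Qed.
Lemma tr0 z : tr 0 z = 0.
Proof. by apply: (addIr (tr 0 z)); rewrite -trD !add0r. Qed.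
Lemma trS f P z : tr (esmul f P) z = smul f (tr P z).
Proof. by apply: sec_eq => x; rewrite -[LHS]/(tr_val _ _ _) /tr_val fibreS lftraceZ. Qed.
Lemma tr_epsl P z : tr (ecomp eps P) z = if odd z then - tr P z else tr P z.
Proof.
have lftraceN (V : vectType R) (f : 'End(V)) : lftrace (- f) = - lftrace f.
  by rewrite -scaleN1r lftraceZ mulN1r.
apply: sec_eq => x; rewrite -[LHS]/(tr_val _ _ _) /tr_val fibre_epsl.
by case: (odd z) => //; rewrite lftraceN; exact/esym/scaleN1r.
Qed.

Definition Tr P : Cinf M := \sum_z tr P z.

Lemma TrD P Q : Tr (P + Q) = Tr P + Tr Q.
Proof. by rewrite -big_split; apply: eq_bigr => z _; exact: trD. Qed.
Lemma Tr0 : Tr 0 = 0.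
Proof. by apply: (addIr (Tr 0)); rewrite -TrD !add0r. Qed.
Lemma TrN P : Tr (- P) = - Tr P.
Proof. by apply/eqP; rewrite -addr_eq0 -TrD addNr Tr0. Qed.
Lemma TrS f P : Tr (esmul f P) = smul f (Tr P).
Proof. by rewrite /Tr smul_sumr; apply: eq_bigr => z _; exact: trS. Qed.

Lemma TrC P Q : Tr (ecomp P Q) = Tr (ecomp Q P).
Proof.
apply: sec_eq => x; rewrite !sec_sumE.
have ex S T : \sum_z tr (ecomp S T) z x =
    \sum_z \sum_w lftrace (fibre S z w x \o fibre T w z x)%VF.
  by apply: eq_bigr => z _; rewrite -[LHS]/(tr_val _ _ _) /tr_val fibre_comp lftrace_sum.
rewrite !ex exchange_big; apply: eq_bigr => z _; apply: eq_bigr => w _.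
exact: lftraceC.
Qed.

End TotalTrace.

Section TraceDerivation.
Variables (R : realType) (M : manifold R) (A : lie_algebroid M).
Variables (n : nat) (E : 'I_n -> vbundle M).
Variable nabla : forall z : 'I_n, connection A (E z).
Local Notation AA := (sec A).
Local Notation B := (endo E).
Local Notation ρ := (rho (la_anchor A)).
Implicit Types (a : AA) (P Q : B).

Lemma rho_sum a (I : Type) (r : seq I) (F : I -> Cinf M) :
  ρ a (\sum_(i <- r) F i) = \sum_(i <- r) ρ a (F i).
Proof.
elim: r => [|i r IH]; last by rewrite !big_cons rhoDr IH.
by rewrite !big_nil; apply: (addIr (ρ a 0)); rewrite -rhoDr !add0r.
Qed.

Lemma tnab_tinj a z (s : sec (E z)) : tnab nabla a (tinj s) = tinj (nabla z a s).
Proof.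
apply: tsec_eq => w; have [<-|zw] := eqVneq z w; first by rewrite /tnab !tinjE.
rewrite /tnab !tinj_out //.
by have := congr1 (fun h : tsec E => h w) (tnab0r nabla a).
Qed.

Lemma block_eact a P z (s : sec (E z)) :
  nabla z a (block P z s) = block (eact nabla a P) z s + block P z (nabla z a s).
Proof. by rewrite /block -tnab_tinj eactE tsecDE tsecNE subrK. Qed.

(* Differentiate [sum_i phi_i(P u_i) = g tr P] and compare with the derivative of
   [sum_i phi_i(s) u_i = g s], where (u, phi) is a dual frame. *)
Lemma tr_eact a P z : tr (eact nabla a P) z = ρ a (tr P z).
Proof.
apply: sec_eq => x; have [g /near_at gx [df]] := dual_frame_exists (E z) x.
pose u i : sec (E z) := fvec df i; pose phi i : sec (E z) -> Cinf M := fcovs df i.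
(* The derivative of the covector phi_i for the dual connection, which is again C^oo(M)-linear. *)
pose psi i s : Cinf M := ρ a (phi i s) - phi i (nabla z a s).
have psiD i s t : psi i (s + t) = psi i s + psi i t.
  rewrite /psi /phi fcovsD rhoDr.
  have -> : nabla z a (s + t) = nabla z a s + nabla z a t.
    by have := nab_linear (nabla z) a 1 s t; rewrite !scale1r.
  by rewrite fcovsD opprD addrACA.
have psiZ i f s : psi i (smul f s) = smul f (psi i s).
  rewrite /psi /phi fcovs_smul rhoM nab_leibniz fcovsD !fcovs_smul opprD smulDr smulNr.
  rewrite (smulC (ρ a f)) (smulC (phi i s)) /phi.
  by rewrite [LHS](AC (2*2) (2*3*(1*4))) /= subrr addr0.
pose psih i := hom_at_exists (psiD i) (psiZ i) x.
pose phih i := hom_at_exists (@fcovsD _ _ _ _ df i) (@fcovs_smul _ _ _ _ df i) x.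
have sum_id s : \sum_i smul (psi i s) (u i) + \sum_i smul (phi i s) (nabla z a (u i)) =
    smul (ρ a g) s.
  have nsum (F : 'I_(fsize df) -> sec (E z)) : nabla z a (\sum_i F i) = \sum_i nabla z a (F i).
    have nD s' t : nabla z a (s' + t) = nabla z a s' + nabla z a t.
      by have := nab_linear (nabla z) a 1 s' t; rewrite !scale1r.
    have n0 : nabla z a 0 = 0 by apply: (addIr (nabla z a 0)); rewrite -nD !add0r.
    by elim/big_rec2: _ => // i s' t _ <-; exact: nD.
  have := nsum (fun i => smul (phi i s) (u i)); rewrite fdual_sec nab_leibniz.
  under [in X in _ = X]eq_bigr do rewrite nab_leibniz.
  rewrite -(fdual_sec df (nabla z a s)) big_split /= => e.
  apply: (addrI (\sum_i smul (phi i (nabla z a s)) (u i))); rewrite [RHS]e addrA -big_split addrC.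
  congr (_ + _); apply: eq_bigr => i _ /=.
  by rewrite -smulDl /psi addrC subrK.
(* The vectors u_i with covectors psi_i, joined to the vectors nabla_a u_i with covectors phi_i,
   form by [sum_id] a dual system for the scalar rho_a(g). The term it contributes to the trace is
   matched by the product rule for g tr P. *)
pose w (i : 'I_(fsize df) + 'I_(fsize df)) : E z x :=
  match i with inl i => u i x | inr i => nabla z a (u i) x end.
pose al (i : 'I_(fsize df) + 'I_(fsize df)) : 'Hom(E z x, R^o) :=
  match i with inl i => sval (psih i) | inr i => sval (phih i) end.
have psihE i (s : sec (E z)) : sval (psih i) (s x) = psi i s x := svalP (psih i) s.
have phihE i (s : sec (E z)) : sval (phih i) (s x) = phi i s x := svalP (phih i) s.
have key : \sum_i psi i (block P z (u i)) x + \sum_i phi i (block P z (nabla z a (u i))) x =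
    ρ a g x * tr P z x.
  rewrite -(@lftrace_frame _ _ (fibre P z z x) _ w al) => [|v].
    by rewrite big_sumType /=; congr (_ + _); apply: eq_bigr => i _; rewrite fibreE ?psihE ?phihE.
  rewrite -(sec_throughE v) big_sumType /=.
  have := congr1 (fun s : sec (E z) => s x) (sum_id (sec_through v)).
  rewrite -[LHS]/((\sum_i smul _ _ : sec (E z)) x + (\sum_i smul _ _ : sec (E z)) x) !sec_sumE.
  move=> e; rewrite -[RHS]e; congr (_ + _); apply: eq_bigr => i _.
    by rewrite psihE.
  by rewrite phihE.
have trE Q : \sum_i phi i (block Q z (u i)) = smul g (tr Q z).
  by apply: sec_eq => y; rewrite sec_sumE; exact: tr_frame.
have := congr1 (fun f => ρ a f x) (trE P); rewrite rho_sum rhoM.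
have -> : \sum_i ρ a (phi i (block P z (u i))) = \sum_i psi i (block P z (u i)) +
    \sum_i phi i (block P z (nabla z a (u i))) + smul g (tr (eact nabla a P) z).
  rewrite -trE -!big_split; apply: eq_bigr => i _ /=.
  rewrite /psi block_eact /phi fcovsD opprD.
  by rewrite [RHS](AC ((1*2)*1*1) (1*(2*5)*(3*4))) /= !addNr !addr0.
rewrite -[X in X = _ -> _]/((\sum_i psi i (block P z (u i)) : Cinf M) x +
   (\sum_i phi i (block P z (nabla z a (u i))) : Cinf M) x + g x * tr (eact nabla a P) z x).
rewrite !sec_sumE key -[X in _ = X -> _]/(ρ a g x * tr P z x + g x * ρ a (tr P z) x).
by move/addrI; rewrite gx !mul1r.
Qed.

End TraceDerivation.

Section Supertrace.
Variables (R : realType) (M : manifold R) (T : Type).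
Variables (n : nat) (E : 'I_n -> vbundle M).
Local Notation B := (endo E).
Local Notation wm := (wedge_with (@ecomp R M n E)).
Implicit Types (P Q : B) (X Y : seq T -> B).

Definition Str P : Cinf M := Tr (ecomp eps P).

Lemma StrD P Q : Str (P + Q) = Str P + Str Q.
Proof. by rewrite /Str ecompDr TrD. Qed.
Lemma Str0 : Str 0 = 0.
Proof. by apply: (addIr (Str 0)); rewrite -StrD !add0r. Qed.
Lemma StrN P : Str (- P) = - Str P.
Proof. by apply/eqP; rewrite -addr_eq0 -StrD addNr Str0. Qed.

Let compDl P P' Q : ecomp (P + P') Q = ecomp P Q + ecomp P' Q. Proof. exact: ecompDl. Qed.
Let compDr P Q Q' : ecomp P (Q + Q') = ecomp P Q + ecomp P Q'. Proof. exact: ecompDr. Qed.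
Let compNl P Q : ecomp (- P) Q = - ecomp P Q. Proof. exact: (biaddNl compDl). Qed.
Let compNr P Q : ecomp P (- Q) = - ecomp P Q. Proof. exact: (biaddNr compDr). Qed.

Definition econj P : B := ecomp eps (ecomp P eps).

Lemma econjD P Q : econj (P + Q) = econj P + econj Q.
Proof. by rewrite /econj compDl compDr. Qed.
Lemma econjN P : econj (- P) = - econj P.
Proof. by rewrite /econj compNl compNr. Qed.
Lemma econjM P Q : econj (ecomp P Q) = ecomp (econj P) (econj Q).
Proof. by apply: endo_eq => h; rewrite /econj /= epsK. Qed.
Lemma econjE P : ecomp P eps = ecomp eps (econj P).
Proof. by rewrite /econj ecomp_epsK. Qed.

(** The involution of total parity, which counts form degree and degree in End together. *)
Definition epar X s : B := econj (deg_sign X s).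

(** Here [b] means that the operator is even. In the next statement it also means that the form
    degree is odd: for totally odd cochains the two conditions agree. *)
Let Str_pair (b b' : bool) P Q : econj P = (if b then P else - P) ->
  econj Q = (if b' then Q else - Q) ->
  Str (ecomp P Q) = if b && b' then Str (ecomp Q P) else - Str (ecomp Q P).
Proof.
have H (c : bool) S S' : econj S = (if c then S else - S) ->
    Str (ecomp S S') = if c then Str (ecomp S' S) else - Str (ecomp S' S).
  move=> cS; have e : ecomp eps S = if c then ecomp S eps else - ecomp S eps.
    by rewrite econjE cS; case: c {cS}; rewrite ?compNr ?opprK.
  rewrite /Str ecompA e; case: c {cS e}; rewrite ?compNl ?TrN -ecompA TrC -ecompA //.
case: b; case: b' => //= hP hQ; do ?[exact: (H true _ _ hP)|exact: (H false _ _ hP)].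
by rewrite (H false _ P hQ) opprK.
Qed.

Let Str_homog (b b' : bool) X Y s :
  deg_sign X = (if b then - X else X) -> (forall s, econj (X s) = if b then X s else - X s) ->
  deg_sign Y = (if b' then - Y else Y) -> (forall s, econj (Y s) = if b' then Y s else - Y s) ->
  Str (wm X Y s) = - Str (wm Y X s).
Proof.
move=> sX cX sY cY; pose mu P Q := Str (ecomp P Q).
have muDl P P' Q : mu (P + P') Q = mu P Q + mu P' Q by rewrite /mu compDl StrD.
have muDr P Q Q' : mu P (Q + Q') = mu P Q + mu P Q' by rewrite /mu compDr StrD.
have StrE X' Y' : Str (wm X' Y' s) = wedge_with mu X' Y' s.
  by apply: (wedge_map (FU := id) (FV := id) (FW := Str)) => //; exact: StrD.
rewrite !StrE (wedgeC muDl muDr _ sX).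
have flip : wedge_with (fun Q P => mu P Q) Y X s =
    if b && b' then wedge_with mu Y X s else - wedge_with mu Y X s.
  rewrite -[in RHS](map_id s).
  apply: (@wedge_rel R T T id _ _ _ _ _ _ (fun Q P => mu P Q) mu
    (fun Q Q' => Q' = Q /\ econj Q = if b' then Q else - Q)
    (fun P P' => P' = P /\ econj P = if b then P else - P)
    (fun w w' => w = if b && b' then w' else - w')).
  - by move=> u _ [-> cu]; split=> //; rewrite econjN cu; case: (b').
  - by move=> w w' x x' -> ->; case: ifP => // _; rewrite opprD.
  - by move=> u _ v _ [-> cu] [-> cv]; exact: Str_pair.
  - by move=> t; rewrite map_id.
  - by move=> t; rewrite map_id.
case: b sX cX flip => sX cX /=; last by move=> ->.
rewrite sY; case: b' sY cY => sY cY /=; last by move=> ->.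
move=> flip; rewrite (wedgeNl (mu := fun Q P => mu P Q)) => [|u u' v]; last exact: muDr.
by rewrite ptwN flip.
Qed.

(** The graded commutator of odd elements is XY + YX. Splitting X and Y by the parity of the form
    degree also fixes their parity in End, and then the Koszul sign of the forms and the sign of the
    supertrace always multiply to -1. *)
Lemma Str_comm X Y s : epar X = - X -> epar Y = - Y -> Str (wm X Y s + wm Y X s) = 0.
Proof.
pose part (b : bool) X' t : B := if odd (size t) == b then X' t else 0.
have partE X' : X' = part false X' + part true X'.
  by apply/funext => t; rewrite ptwD /part; case: odd; rewrite ?addr0 ?add0r.
have part_sign b X' : deg_sign (part b X') = (if b then - part b X' else part b X').
  apply/funext => t; rewrite deg_signE; case: b; rewrite ?ptwN /part; case: odd => //=; by rewrite oppr0.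
have part_conj : forall b (Z : seq T -> B) t, epar Z = - Z ->
    econj (part b Z t) = if b then part b Z t else - part b Z t.
  move=> b Z t pZ; have := congr1 (fun W : seq T -> B => W t) pZ; rewrite ptwN /epar deg_signE /part.
  have c0 : econj 0 = 0 by apply: (addIr (econj 0)); rewrite -econjD !add0r.
  by case: odd; case: b => //=; rewrite ?c0 ?oppr0 // econjN => /oppr_inj.
move=> pX pY; have hom b b' : Str (wm (part b X) (part b' Y) s) = - Str (wm (part b' Y) (part b X) s).
  by apply: Str_homog; [exact: part_sign|move=> t; exact: part_conj|exact: part_sign|move=> t; exact: part_conj].
suff: Str (wm (part false X + part true X) (part false Y + part true Y) s +
    wm (part false Y + part true Y) (part false X + part true X) s) = 0 by rewrite -!partE.
rewrite StrD !(wedgeDl compDl) !(wedgeDr compDr) !ptwD !StrD !hom.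
by rewrite [LHS](AC ((2*2)*(2*2)) ((1*5)*(2*7)*(3*6)*(4*8))) /= !addNr !addr0.
Qed.

End Supertrace.

(** * Characteristic forms and the vanishing of their alternating sum *)

Section Assembly.
Variables (R : realType) (M : manifold R) (A : lie_algebroid M).
Variables (n : nat) (E : 'I_n -> vbundle M).
Variable nabla : forall z : 'I_n, connection A (E z).
Local Notation AA := (sec A).
Local Notation B := (endo E).
Local Notation ρ := (rho (la_anchor A)).
Local Notation wm := (wedge_with (@ecomp R M n E)).
Local Notation edd := (ce_diff (@br R M A) (eact nabla)).
Local Notation cd := (ce_diff (@br R M A) (fun a f => ρ a f)).
Local Notation Rc := (curv_cochain nabla).
Local Notation blin := (cmlin (A := A) (@esmul R M n E)).
Local Notation clin := (cmlin (A := A) (@smul R M (line M))).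
Implicit Types (X Y : seq AA -> B).

Let compDl (P P' Q : B) : ecomp (P + P') Q = ecomp P Q + ecomp P' Q. Proof. exact: ecompDl. Qed.
Let compDr (P Q Q' : B) : ecomp P (Q + Q') = ecomp P Q + ecomp P Q'. Proof. exact: ecompDr. Qed.

Lemma edd_wedge X Y : edd (wm X Y) = wm (edd X) Y + wm (deg_sign X) (edd Y).
Proof. by apply: ce_diff_wedge => // *; first [exact: eactD|exact: eact_comp]. Qed.

Lemma esmulDr f (P Q : B) : esmul f (P + Q) = esmul f P + esmul f Q.
Proof. by apply: endo_eq => h; exact: tsmulDr. Qed.

Lemma wm_lin X Y : blin X -> blin Y -> blin (wm X Y).
Proof.
apply: cmlin_wedge => //; do ?[exact: esmulDr]; move=> c P Q; apply: endo_eq => h; first [exact: endoS | by []].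
Qed.

Lemma wm_skew X Y : cskew X -> cskew Y -> cskew (wm X Y).
Proof. exact: cskew_wedge. Qed.

(** The power l + 1 of the curvature, with the index shift of [curv_pow]. *)
Definition curv_power l : seq AA -> B := iter l (wm Rc) Rc.

Lemma curv_power_lin l : blin (curv_power l).
Proof. by elim: l => [|l IH]; [|apply: wm_lin => //]; exact: curv_cochain_lin. Qed.
Lemma curv_power_skew l : cskew (curv_power l).
Proof. by elim: l => [|l IH]; [|apply: wm_skew => //]; exact: curv_cochain_skew. Qed.

Lemma curv_power_closed l : edd (curv_power l) = 0.
Proof.
elim: l => [|l IH]; first exact: bianchi.
by rewrite /= edd_wedge IH bianchi (wedge0l compDl) (wedge0r compDr) addr0.
Qed.

Lemma curv_power_degree l s : size s != l.+1.*2 -> curv_power l s = 0.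
Proof.
have d2 t : size t != 2 -> Rc t = 0 by case: t => [|a [|b []]].
elim: l s => [|l IH] s sl; first exact: d2.
by apply: (wedge_degree compDl compDr d2 IH); rewrite add2n -doubleS.
Qed.

Lemma trZ_lin (t : B -> Cinf M) X : (forall P Q, t (P + Q) = t P + t Q) ->
  (forall f P, t (esmul f P) = smul f (t P)) -> blin X -> clin (t \o X).
Proof. by move=> tD tS lX s1 s2 c u v; rewrite /= lX tD tS. Qed.
Lemma tr_cskew (t : B -> Cinf M) X : (forall P Q, t (P + Q) = t P + t Q) ->
  cskew X -> cskew (t \o X).
Proof.
move=> tD kX s1 s2 u v; rewrite /= kX.
have t0 : t 0 = 0 by apply: (addIr (t 0)); rewrite -tD !add0r.
by apply/eqP; rewrite -addr_eq0 -tD addNr t0.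
Qed.

Lemma cd_tr (z : 'I_n) X : cd ((@tr R M n E)^~ z \o X) = (@tr R M n E)^~ z \o edd X.
Proof.
apply/esym/ce_diff_map => [P Q|a P]; first exact: trD.
exact: tr_eact.
Qed.

Lemma cd_Tr X : cd (@Tr R M n E \o X) = @Tr R M n E \o edd X.
Proof.
apply/esym/ce_diff_map => [P Q|a P]; first exact: TrD.
by rewrite /Tr rho_sum; apply: eq_bigr => z _; exact: tr_eact.
Qed.

Definition char_form l (z : 'I_n) : form A (line M) :=
  form_of (trZ_lin (fun P Q => trD P Q z) (fun f P => trS f P z) (@curv_power_lin l))
          (tr_cskew (fun P Q => trD P Q z) (@curv_power_skew l)).

Lemma char_formE l z s : form_app (char_form l z) s = tr (curv_power l s) z.
Proof. by rewrite form_ofE. Qed.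

Lemma char_form_cocycle l z : char_form l z \in @cocycle_pred R M A l.+1.*2.
Proof.
apply/asboolP; split.
  by apply: has_degree_app => s sl; rewrite char_formE curv_power_degree // tr0.
move=> a; rewrite koszulE form_app0 form_ofE cd_tr curv_power_closed.
by rewrite /= tr0.
Qed.

Definition char_cocycle l z : cocycle A l.+1.*2 := Cocycle (char_form_cocycle l z).

Definition curv_val (z : 'I_n) (x : M) (s : seq (A x)) : 'End(E z x) :=
  if s is [:: u; v] then fibre (curv nabla (sec_through u) (sec_through v)) z z x else 0.

Lemma curv_valP z : is_curvature (nabla z) (curv_val z).
Proof.
split=> [x s|a b e x]; first by case: s => [|u [|v []]].
pose f (s : seq AA) : sec (E z) := Rc s (tinj e) z.
have mf : cmlin (@smul R M (E z)) f.
  by move=> s1 s2 c u v; rewrite /f curv_cochain_lin.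
rewrite fibreE; transitivity (f [:: a; b] x).
  by apply: (cochain_ptw mf (s := [:: _; _])); rewrite /= !sec_throughE.
by rewrite /f [Rc _]/= curvE !tsecDE !tsecNE /tnab tinjE.
Qed.

(** A block of a product is in general a sum over intermediate blocks. The total connection is a
    direct sum, so its curvature is block diagonal; [Rel] expresses this for row z at x, and it is
    preserved by products. *)
Lemma fibre_end_pow l z x s :
  fibre (curv_power l s) z z x = end_pow (curv_val z) l.+1 [seq (a : AA) x | a <- s].
Proof.
pose Rel (P : B) (Phi : 'End(E z x)) :=
  forall h : tsec E, Phi (h z x) = P h z x.
suff RP : forall t, Rel (curv_power l t) (end_pow (curv_val z) l.+1 [seq (a : AA) x | a <- t]).
  by apply: hom_ext => e; rewrite fibreE -RP tinjE.
have Rcurv t : Rel (Rc t) (curv_val z (map (fun a : AA => a x) t)).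
  move=> h; have [F0 FE] := curv_valP z.
  case: t => [|a [|b [|c t]]]; do ?by rewrite F0 // zero_lfunE.
  exact: FE.
(* The l + 1 factors applied to the unit become l factors applied to the curvature, as in
   [curv_power]. *)
have -> : end_pow (curv_val z) l.+1 (x := x) =
    iter l (wedge_with (fun f g : 'End(E z x) => (f \o g)%VF) (curv_val z (x := x))) (curv_val z (x := x)).
  rewrite /end_pow iterSr; congr (iter _ _ _); apply/funext => t.
  rewrite -[@end_one _ _ _ _ x]/(cochain0 \1%VF) wedge_cochain0r ?comp_lfun1r // => f g g'.
  exact: comp_lfunDr.
elim: l => [|l IH] t; first exact: Rcurv.
apply: (wedge_rel (h := fun a : AA => a x) (RU := Rel) (RV := Rel) (RW := Rel)) => //.
- by move=> P Phi PP h; rewrite opp_lfunE PP; exact/esym/scaleN1r.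
- by move=> P Phi Q Psi PP QQ h; rewrite add_lfunE PP QQ.
- by move=> P Phi Q Psi PP QQ h; rewrite comp_lfunE QQ PP.
Qed.

Lemma char_cocycleP l z :
  is_pontryagin_char (nabla z) l.+1 (cohomology_class (char_cocycle l z)).
Proof.
exists (curv_val z), (char_cocycle l z); split=> //; first exact: curv_valP.
move=> x s; rewrite -(map_sec_throughE s) -fibre_end_pow.
by have := congr1 (fun f : Cinf M => f x) (char_formE l z (map (sec_through (E := A) (x := x)) s)).
Qed.

End Assembly.

Section Exactness.
Variables (R : realType) (M : manifold R) (A : lie_algebroid M).
Variables (n : nat) (E : 'I_n -> vbundle M).
Variable nabla : forall z : 'I_n, connection A (E z).
Variable D : gform A E -> gform A E.
Hypothesis repD : is_nrepresentation D.
Local Notation AA := (sec A).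
Local Notation B := (endo E).
Local Notation K := (seq AA -> B).
Local Notation wm := (wedge_with (@ecomp R M n E)).
Local Notation edd := (ce_diff (@br R M A) (eact nabla)).
Local Notation cd := (ce_diff (@br R M A) (fun a f => rho (la_anchor A) a f)).
Local Notation Rc := (curv_cochain nabla).
Local Notation th := (theta nabla repD).
Local Notation blin := (cmlin (A := A) (@esmul R M n E)).
Local Notation clin := (cmlin (A := A) (@smul R M (line M))).
Implicit Types (X Y : K).

Let compDl (P P' Q : B) : ecomp (P + P') Q = ecomp P Q + ecomp P' Q. Proof. exact: ecompDl. Qed.
Let compDr (P Q Q' : B) : ecomp P (Q + Q') = ecomp P Q + ecomp P Q'. Proof. exact: ecompDr. Qed.

(** The twisted covariant derivative. For the plain wedge product with composition it is an odd
    derivation with respect to [epar]. *)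
Definition delta X : K := fun s => ecomp eps (edd X s).

Lemma epar_curv : epar Rc = Rc.
Proof.
apply/funext => s; have c0 : econj (0 : B) = 0.
  by apply: (addIr (econj 0)); rewrite -econjD !add0r.
rewrite /epar deg_signE; case: s => [|a [|b [|c s]]] //=; last by case: odd => //=; rewrite ?oppr0 c0.
  by rewrite oppr0 c0.
apply: endo_eq => h; rewrite -[LHS]/(eps (curv nabla a b (eps h))) !curvE !tnab_eps.
by rewrite -!endoN -!endoD epsK.
Qed.

Lemma epar_theta : epar th = - th.
Proof.
apply/funext => s; apply: endo_eq => h.
rewrite ptwN endoNE -[LHS]/(eps (deg_sign th s (eps h))).
by rewrite -[in RHS](epsK h) theta_odd opprK.
Qed.

Lemma eparD X Y : epar (X + Y) = epar X + epar Y.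
Proof. by apply/funext => s; rewrite /epar deg_signD econjD. Qed.

Lemma eparM X Y : epar (wm X Y) = wm (epar X) (epar Y).
Proof.
apply/funext => s; rewrite /epar deg_sign_wedge //.
by apply: (wedge_map (FU := @econj _ _ _ _) (FV := @econj _ _ _ _)); [exact: econjN|exact: econjD|exact: econjM].
Qed.

Lemma deltaD X Y : delta (X + Y) = delta X + delta Y.
Proof.
apply/funext => s; rewrite /delta ce_diffD ?ptwD ?compDr //; exact: eactD.
Qed.

Lemma deltaM X Y : delta (wm X Y) = wm (delta X) Y + wm (epar X) (delta Y).
Proof.
apply/funext => s; rewrite /delta edd_wedge ptwD compDr ptwD.
have -> : ecomp eps (wm (edd X) Y s) = wm (delta X) Y s.
  apply: (wedge_map (FU := ecomp eps) (FV := id) (FW := ecomp eps)) => [P|P Q|P Q].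
  - exact: (biaddNr compDr).
  - exact: compDr.
  - exact: ecompA.
congr (_ + _).
apply: (wedge_map (FU := @econj _ _ _ _) (FV := ecomp eps) (FW := ecomp eps)) => [P|P Q|P Q].
- exact: econjN.
- exact: compDr.
- by apply: endo_eq => h; rewrite /= epsK.
Qed.

Lemma theta_flat : Rc + delta th + wm th th = 0.
Proof. by apply/funext => s; exact: flatness. Qed.

Lemma delta_curv : delta Rc = 0.
Proof. by apply/funext => s; rewrite /delta bianchi; exact: (biadd0r compDr). Qed.

(** The [eps] of the supertrace cancels the [eps] of delta, so a supertrace becomes the differential
    of an ordinary trace. *)
Lemma Str_delta X : @Str R M n E \o delta X = cd (@Tr R M n E \o X).
Proof. by rewrite (cd_Tr nabla); apply/funext => s; rewrite /= /Str /delta ecomp_epsK. Qed.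

Lemma wmA X Y (Z : K) : wm X (wm Y Z) = wm (wm X Y) Z.
Proof. by apply/esym; apply: wedgeA => // *; exact/esym/ecompA. Qed.

Lemma Str_curv_power_exact l : exists Y : seq AA -> Cinf M,
  [/\ clin Y, cskew Y & cd Y = @Str R M n E \o curv_power nabla l].
Proof.
have [Q QE [U [V [QD oddV oddU SUV]]]] := transgression (wedgeDl compDl) (wedgeDr compDr)
  wmA eparD eparM deltaD deltaM epar_curv epar_theta delta_curv erefl erefl theta_flat l.
have csD c (u v : Cinf M) : smul c (u + v) = smul c u + smul c v by exact: smulDr.
have cdD (u v : seq AA -> Cinf M) : cd (u + v) = cd u + cd v.
  by apply: ce_diffD; exact: rhoDr.
have cdZ (c : R) (u : seq AA -> Cinf M) : cd (c *: u) = c *: cd u.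
  apply/esym/(@ce_diff_map _ _ _ _ _ _ _ ( *:%R c)) => [f g|a f]; first exact: scalerDr.
  exact/esym/rhoZr.
pose S X := blin X /\ cskew X.
have SU k : S (U k).
  suff [] : S (U k) /\ S (V k) by [].
  apply: (SUV S).
  - by split; [exact: cmlin0 (@esmulDr R M n E)|exact: cskew0].
  - by move=> X X' [lX kX] [lX' kX']; split; [exact: cmlinD (@esmulDr R M n E) _ _ _ _|exact: cskewD].
  - by move=> X [lX kX]; split; [exact: cmlinN (@esmulDr R M n E) _ _|exact: cskewN].
  - by move=> X X' [lX kX] [lX' kX']; split; [exact: wm_lin|exact: wm_skew].
  - by split; [exact: curv_cochain_lin|exact: curv_cochain_skew].
  - by split; [exact: theta_lin|exact: theta_skew].
(* The supertrace kills the anticommutator with theta, and dividing by k + 1 replaces the integral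
   over t. *)
have StrQ k : @Str R M n E \o Q k = k.+1%:R^-1 *: cd (@Tr R M n E \o U k).
  apply/funext => s; have := congr1 (fun X : K => Str (X s)) (QD k); rewrite !ptwD StrD.
  rewrite -[wm th (V k) s + _]ptwD Str_comm ?epar_theta // addr0 => e.
  rewrite -[RHS]/(k.+1%:R^-1 *: cd (@Tr R M n E \o U k) s) -Str_delta /= -e.
  have StrMn m (P : B) : Str (P *+ m) = Str P *+ m.
    by elim: m => [|m IH]; rewrite ?mulr0n ?Str0 // !mulrS StrD IH.
  have ptwMn m X : (X *+ m) s = X s *+ m by elim: m => [|m IH]; rewrite ?mulr0n // !mulrS ptwD IH.
  rewrite ptwMn StrMn -(scaler_nat k.+1 (Str (Q k s))) scalerA mulVf ?scale1r //.
have TrU k : clin (k.+1%:R^-1 *: (@Tr R M n E \o U k)) /\ cskew (k.+1%:R^-1 *: (@Tr R M n E \o U k)).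
  have [lU kU] := SU k.
  have lT : clin (@Tr R M n E \o U k) := trZ_lin (@TrD R M n E) (@TrS R M n E) lU.
  have kT : cskew (@Tr R M n E \o U k) := tr_cskew (@TrD R M n E) kU.
  split=> [s1 s2 c u v|s1 s2 u v]; rewrite -[LHS]/(_ *: (@Tr R M n E \o U k) _).
    by rewrite lT scalerDr -smulZr.
  by rewrite kT scalerN.
exists (- \sum_(k < l.*2.+2) k.+1%:R^-1 *: (@Tr R M n E \o U k)); split.
- apply: cmlinN => //; elim/big_rec: _ => [|k f _ lf]; first exact: cmlin0.
  by apply: cmlinD => //; have [] := TrU k.
- apply: cskewN; elim/big_rec: _ => [|k f _ kf]; first exact: cskew0.
  by apply: cskewD => //; have [] := TrU k.
- have cdN (u : seq AA -> Cinf M) : cd (- u) = - cd u by apply: ce_diffN; exact: rhoDr.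
  have cdsum (I : Type) (r : seq I) (F : I -> seq AA -> Cinf M) :
      cd (\sum_(i <- r) F i) = \sum_(i <- r) cd (F i).
    elim: r => [|i r IH]; last by rewrite !big_cons cdD IH.
    by rewrite !big_nil; apply: ce_diff0; exact: rhoDr.
  rewrite cdN cdsum; apply/funext => s; rewrite /= /curv_power QE !ptwN !ptw_sum.
  have Strsum (I : Type) (r : seq I) (F : I -> B) :
      Str (- \sum_(i <- r) F i) = - \sum_(i <- r) Str (F i).
    by rewrite StrN; congr (- _); elim: r => [|i r IH]; rewrite ?big_nil ?Str0 // !big_cons StrD IH.
  rewrite Strsum; congr (- _); apply: eq_bigr => k _.
  by rewrite cdZ -StrQ.
Qed.

Lemma cohomology_sum l :
  \sum_(i < n) cohomology_class (char_cocycle nabla l i) *~ (-1) ^+ i = 0.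
Proof.
pose z : cocycle A l.+1.*2 := \sum_(i < n) char_cocycle nabla l i *~ (-1) ^+ i.
have -> : \sum_(i < n) cohomology_class (char_cocycle nabla l i) *~ (-1) ^+ i =
    cohomology_class z.
  by rewrite /cohomology_class raddf_sum; apply: eq_bigr => i _; rewrite raddfMz.
have zE : cocycle_val z = \sum_(i < n) (if odd i then - char_form nabla l i else char_form nabla l i).
  rewrite -[cocycle_val z]/(\val z) raddf_sum; apply: eq_bigr => i _.
  by rewrite raddfMz -signr_odd; case: odd.
have zapp : form_app z = @Str R M n E \o curv_power nabla l.
  apply/funext => s; rewrite zE form_app_sum ptw_sum; apply: eq_bigr => i _.
  by rewrite tr_epsl -char_formE; case: odd => //; rewrite form_appN.
have [Y [lY kY dY]] := Str_curv_power_exact l.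
(* Y may have mixed degree, whereas a coboundary needs a primitive of degree 2 l + 1. Keeping that
   component leaves dY unchanged in degree 2 l + 2, the only degree where the supertrace of the
   power is nonzero. *)
pose Y' s := if (size s).+1 == l.+1.*2 then Y s else 0.
have lY' : clin Y'.
  move=> s1 s2 c u v; rewrite /Y' !size_cat /=; case: ifP => _; first exact: lY.
  by rewrite smul0r addr0.
have kY' : cskew Y'.
  move=> s1 s2 u v; rewrite /Y' !size_cat /=; case: ifP => _; first exact: kY.
  by rewrite oppr0.
have cdY' : cd Y' = form_app z.
  apply/funext => s; rewrite zapp -dY; have [sl|sl] := eqVneq (size s) l.+1.*2.
    apply/eqP; rewrite -subr_eq0; apply/eqP.
    rewrite -[LHS]/((cd Y' - cd Y) s) -ce_diffB; last exact: rhoDr.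
    apply: ce_diff_at => [*|t ts]; first exact: rhoDr.
    by rewrite ptwD ptwN /Y' ts sl eqxx subrr.
  rewrite dY /= curv_power_degree // Str0.
  apply: (ce_diff_degree _ _ (m := l.*2.+1)) => // [*|t tl]; first exact: rhoDr.
  by rewrite /Y' doubleS eqSS (negbTE tl).
apply/eqP; rewrite -[0](raddf0 (@cohomology_class _ _ _ _)) -Quotient.idealrBE subr0.
apply/asboolP; exists (form_of lY' kY').
  have deg : has_degree l.*2.+1 (form_of lY' kY').
    by apply: has_degree_app => s sl; rewrite form_ofE /Y' doubleS eqSS (negbTE sl).
  by move=> x s; rewrite doubleS eqSS; exact: deg.
by move=> s; rewrite koszulE form_ofE cdY'.
Qed.

End Exactness.

Theorem theorem1 (R : realType) (M : manifold R) (n : nat)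
    (E : 'I_n -> vbundle M) (A : lie_algebroid M)
    (hD : exists D : gform A E -> gform A E, is_nrepresentation D)
    (nabla : forall i : 'I_n, connection A (E i))
    (l : nat) (hl : (1 < l)%N) :
  exists sigma : 'I_n -> cohomology A l.*2,
    (forall i : 'I_n, is_pontryagin_char (nabla i) l (sigma i)) /\
    \sum_(i < n) sigma i *~ (-1) ^+ i = 0.
Proof.
case: hD => D repD; case: l hl => // l _.
exists (fun i => cohomology_class (char_cocycle nabla l i)); split.
  by move=> i; exact: char_cocycleP.
exact: cohomology_sum repD l.
Qed.
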